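(* Let $\kappa\subseteq\lambda$ be strict partitions. Then \[ gq_{\lambda/\kappa}=\sum_{(\nu,\mu)}2^{\ell(\lambda)-\ell(\kappa)+\mathsf{overlap}(\nu/\kappa)}(-1)^{\mathsf{cols}(\lambda/\mu)}(-\beta/2)^{|\nu/\kappa|+|\lambda/\mu|}\, gp_{\mu/\nu}, \] where the sum is over all pairs of strict partitions $(\nu,\mu)$ with $\kappa\subseteq\nu\subseteq\mu\subseteq\lambda$, $\ell(\kappa)=\ell(\nu)\le\ell(\mu)=\ell(\lambda)$, and $\mathsf{SD}_{\lambda/\mu}$ a vertical strip.
   Context: A strict partition is a finite strictly decreasing sequence $\lambda=(\lambda_1>\dots>\lambda_\ell>0)$ of positive integers (possibly empty); $\ell(\lambda)=\ell$, $|\lambda|=\sum\lambda_i$. $\mathsf{SD}_\lambda=\{(i,j)\in\mathbb{Z}^2:0<i\le j<i+\lambda_i\}$. $\mu\subseteq\lambda$ means $\mu_i\le\lambda_i$ for all $i$; $\mathsf{SD}_{\lambda/\mu}=\mathsf{SD}_\lambda\setminus\mathsf{SD}_\mu$, $|\lambda/\mu|=|\mathsf{SD}_{\lambda/\mu}|$, $\mathsf{cols}(\lambda/\mu)$ = number of distinct columns $j$ meeting $\mathsf{SD}_{\lambda/\mu}$, $\mathsf{overlap}(\lambda/\mu)=|\{(i,j)\in\mathsf{SD}_{\lambda/\mu}:(i-1,j)\in\mathsf{SD}_{\lambda/\mu}\}|$; vertical strip = at most one box per row. Let $i'=i-\frac12$ ($1'<1<2'<2<\cdots$). A semistandard set-valued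 shifted tableau of shape $\lambda$ is a filling $T$ of $\mathsf{SD}_\lambda$ by nonempty finite sets of positive half-integers, weakly increasing along rows and columns ($S\le S'$ iff $\max S\le\min S'$), with no unprimed number in two boxes of a column and no primed number in two boxes of a row; $P$-type if no diagonal box $(j,j)$ contains a primed number. $x^T=\prod x_i^{m_i}$ ($m_i$ = total occurrences of $i$ or $i'$), $|T|$ = total number of elements. $GP_\lambda=\sum_{T\ P\text{-type}}\beta^{|T|-|\lambda|}x^T$, $GQ_\lambda=\sum_{T}\beta^{|T|-|\lambda|}x^T$ (all semistandard $T$). Let $\overline{x}:=\frac{-x}{1+\beta x}$. The dual functions $gp_\lambda,gq_\lambda\in\mathbb{Z}[\beta][[x_1,x_2,\dots]]$ are the unique elements, indexed by strict partitions, with $\sum_\lambda GQ_\lambda(x)gp_\lambda(y)=\sum_\lambda GP_\lambda(x)gq_\lambda(y)=\prod_{i,j\ge1}\frac{1-\overline{x_i}y_j}{1-x_iy_j}$. It is known that for strict $\mu,\nu$ there are unique integers $a^\lambda_{\mu\nu},b^\lambda_{\mu\nu}$ with $GP_\mu GP_\nu=\sum_\lambda a^\lambda_{\mu\nu}\beta^{|\lambda|-|\mu|-|\nu|}GP_\lambda$ and $GQ_\mu GQ_\nu=\sum_\lambda b^\lambda_{\mu\nu}\beta^{|\lambda|-|\mu|-|\nu|}GQ_\lambda$ (sums over all strict $\lambda$). Define $gq_{\lambda/\mu}:=\sum_\nu a^\lambda_{\mu\nu}\beta^{|\lambda|-|\mu|-|\nu|}gq_\nu$ and $gp_{\lambda/\mu}:=\sum_\nu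 b^\lambda_{\mu\nu}\beta^{|\lambda|-|\mu|-|\nu|}gp_\nu$ (sums over strict $\nu$). *)

(* Defs.v *)
From HB Require Import structures.
From mathcomp Require Import all_boot all_order all_algebra.
From mathcomp Require Import finmap.
From mathcomp Require Import boolp classical_sets functions cardinality fsbigop.
From mathcomp.multinomials Require Import monalg.

Set Implicit Arguments.
Unset Strict Implicit.
Unset Printing Implicit Defensive.

Import GRing.Theory.

Local Open Scope fset_scope.
Local Open Scope classical_set_scope.
Local Open Scope ring_scope.

Local Notation "1" := (@mone _) : monom_scope.
Local Notation "x * y" := (mmul x y) : monom_scope.

(** Formal power series in commuting variables indexed by a (possibly
    infinite) type [I]: arbitrary functions on the monomials [{cmonom I}],
    with the Cauchy product. *)

Section Splits.
Context {I : choiceType}.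
Implicit Types (m d e : {cmonom I}) (p : {cmonom I} * {cmonom I}).

Definition mdivisors m : {fset {cmonom I}} :=
  [fset d in [seq mkcmonom [fsfun i : finsupp m => nat_of_ord (h i) | 0%N]
                | h : {ffun finsupp m -> 'I_(mdeg m).+1}]]%fset.

Definition splits m : {fset {cmonom I} * {cmonom I}} :=
  [fset p in mdivisors m `*` mdivisors m | (p.1 * p.2)%M == m]%fset.

Lemma mdivisorsM d e : d \in mdivisors (d * e)%M.
Proof.
set m := (d * e)%M.
have mi (i : I) : (d i <= m i)%N by rewrite cmM leq_addr.
have degi (i : I) : (m i <= mdeg m)%N.
  case: (mdomP m i) => // im.
  by rewrite mdegE (big_fsetD1 i) //= leq_addr.
rewrite inE /=; apply/mapP.
exists [ffun i : finsupp m => inord (d (val i))]; first by rewrite mem_enum.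
apply/eqP/cmP => i; rewrite cmE fsfun_ffun; case: insubP => [j _ ji|].
  by move=> /=; rewrite ffunE inordK ji // ltnS (leq_trans (mi i)).
by rewrite -cmE_neq0 negbK => /eqP m0; move: (mi i); rewrite m0 leqn0 => /eqP.
Qed.

Lemma in_splits m p : (p \in splits m) = ((p.1 * p.2)%M == m).
Proof.
have inE' (D : {fset {cmonom I}}) :
    (p \in [fset p in D `*` D | (p.1 * p.2)%M == m]%fset) =
    (p.1 \in D) && (p.2 \in D) && ((p.1 * p.2)%M == m) by rewrite !inE.
rewrite inE'; apply: andb_idl => /eqP <-.
by rewrite mdivisorsM mulmC mdivisorsM.
Qed.

End Splits.

Record series (I : choiceType) (R : Type) :=
  Series { scoef :> {cmonom I} -> R }.

HB.instance Definition _ (I : choiceType) (R : Type) :=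
  gen_eqMixin (series I R).
HB.instance Definition _ (I : choiceType) (R : Type) :=
  gen_choiceMixin (series I R).

Section SeriesRing.
Context {I : choiceType} {R : comNzRingType}.
Implicit Types (f g h : series I R) (m : {cmonom I}) (c : R).

Lemma seriesP f g : (forall m, f m = g m) -> f = g.
Proof. by case: f g => [f] [g] /= fg; congr Series; apply/funext. Qed.

Definition szero : series I R := Series (fun=> 0).
Definition sopp f : series I R := Series (fun m => - f m).
Definition sadd f g : series I R := Series (fun m => f m + g m).
Definition smon m : series I R := Series (fun m' => (m' == m)%:R).
Definition smul f g : series I R :=
  Series (fun m => \sum_(p <- splits m) f p.1 * g p.2).
Definition sscale c f : series I R := Series (fun m => c * f m).

Let saddA : associative sadd.
Proof. by move=> f g h; apply: seriesP => m /=; rewrite addrA. Qed.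
Let saddC : commutative sadd.
Proof. by move=> f g; apply: seriesP => m /=; rewrite addrC. Qed.
Let sadd0 : left_id szero sadd.
Proof. by move=> f; apply: seriesP => m /=; rewrite add0r. Qed.
Let saddN : left_inverse szero sopp sadd.
Proof. by move=> f; apply: seriesP => m /=; rewrite addNr. Qed.

HB.instance Definition _ :=
  GRing.isZmodule.Build (series I R) saddA saddC sadd0 saddN.

Let smulC : commutative smul.
Proof.
move=> f g; apply: seriesP => m /=.
rewrite [RHS](perm_big [seq (p.2, p.1) | p <- splits m]) /=.
  by rewrite big_map; apply: eq_bigr => p _; rewrite mulrC.
have swap_inj : injective (fun p : {cmonom I} * {cmonom I} => (p.2, p.1)).
  by case=> [? ?] [? ?] [-> ->].
apply: uniq_perm; rewrite ?map_inj_uniq ?fset_uniq //.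
case=> d e; rewrite in_splits /=; apply/idP/mapP => [de|[[d' e']]].
  by exists (e, d); rewrite // in_splits /= mulmC.
by rewrite in_splits /= => de [-> ->]; rewrite mulmC.
Qed.

Let smulA : associative smul.
Proof.
move=> f g h; apply: seriesP => m /=.
pose F (t : {cmonom I} * {cmonom I} * {cmonom I}) := f t.1.1 * g t.1.2 * h t.2.
transitivity (\sum_(t <- [seq (p.1, q.1, q.2) | p <- splits m, q <- splits p.2])
  F t).
  rewrite big_allpairs_dep; apply: eq_bigr => p _.
  by rewrite mulr_sumr; apply: eq_bigr => q _; rewrite mulrA.
transitivity (\sum_(t <- [seq (q.1, q.2, p.2) | p <- splits m, q <- splits p.1])
  F t); last first.
  rewrite big_allpairs_dep; apply: eq_bigr => p _.
  by rewrite mulr_suml; apply: eq_bigr => q _.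
apply: perm_big; apply: uniq_perm.
- apply: allpairs_uniq_dep; first exact: fset_uniq.
    by move=> p _; exact: fset_uniq.
  move=> u v /allpairsPdep[[d e] [[a b] [_ + ->]]].
  rewrite in_splits /= => /eqP <- /allpairsPdep[[d' e'] [[a' b'] [_ + ->]]].
  by rewrite in_splits /= => /eqP <- [-> -> ->].
- apply: allpairs_uniq_dep; first exact: fset_uniq.
    by move=> p _; exact: fset_uniq.
  move=> u v /allpairsPdep[[d e] [[a b] [_ + ->]]].
  rewrite in_splits /= => /eqP <- /allpairsPdep[[d' e'] [[a' b'] [_ + ->]]].
  by rewrite in_splits /= => /eqP <- [-> -> ->].
case=> [[a b] c]; apply/allpairsPdep/allpairsPdep.
  move=> [[x y] [[u v] /= []]]; rewrite !in_splits /= => /eqP <- /eqP <- [-> -> ->].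
  by exists ((x * u)%M, v), (x, u); rewrite !in_splits /= mulmA !eqxx.
move=> [[x y] [[u v] /= []]]; rewrite !in_splits /= => /eqP <- /eqP <- [-> -> ->].
by exists (u, (v * y)%M), (v, y); rewrite !in_splits /= mulmA !eqxx.
Qed.

Let smul1 : left_id (smon 1%M) smul.
Proof.
move=> f; apply: seriesP => m /=.
rewrite (big_fsetD1 (1%M, m)) /=; last by rewrite in_splits /= mul1m.
rewrite eqxx mul1r big_seq big1 ?addr0 // => -[d e].
rewrite in_fsetD1 in_splits xpair_eqE /= => /andP[+ /eqP de].
by case: eqP => [d1|]; rewrite ?mul0r // -de d1 mul1m eqxx.
Qed.

Let smulDl : left_distributive smul sadd.
Proof.
move=> f g h; apply: seriesP => m /=.
by rewrite -big_split /=; apply: eq_bigr => p _; rewrite mulrDl.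
Qed.

Let smon1_neq0 : smon 1%M != 0.
Proof.
apply/eqP => /(congr1 (fun f : series I R => f 1%M)) /eqP /=.
by rewrite eqxx oner_eq0.
Qed.

HB.instance Definition _ := GRing.Zmodule_isComNzRing.Build (series I R)
  smulA smulC smul1 smulDl smon1_neq0.

Let sscaleA c d f : sscale c (sscale d f) = sscale (c * d) f.
Proof. by apply: seriesP => m /=; rewrite mulrA. Qed.
Let sscale1 : left_id 1 sscale.
Proof. by move=> f; apply: seriesP => m /=; rewrite mul1r. Qed.
Let sscaleDr : right_distributive sscale +%R.
Proof. by move=> c f g; apply: seriesP => m /=; rewrite mulrDr. Qed.
Let sscaleDl f : {morph sscale^~ f : c d / c + d}.
Proof. by move=> c d; apply: seriesP => m /=; rewrite mulrDl. Qed.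

HB.instance Definition _ := GRing.Zmodule_isLmodule.Build R (series I R)
  sscaleA sscale1 sscaleDr sscaleDl.

Let sscaleAl c f g : c *: (f * g) = (c *: f) * g.
Proof.
apply: seriesP => m /=; rewrite mulr_sumr.
by apply: eq_bigr => p _; rewrite mulrA.
Qed.

HB.instance Definition _ := GRing.Lmodule_isLalgebra.Build R (series I R)
  sscaleAl.
HB.instance Definition _ := GRing.Lalgebra_isComAlgebra.Build R (series I R).

Lemma scoef0 m : (0 : series I R) m = 0. Proof. by []. Qed.
Lemma scoef1 m : (1 : series I R) m = (m == 1%M)%:R. Proof. by []. Qed.
Lemma scoefN f m : (- f) m = - f m. Proof. by []. Qed.
Lemma scoefD f g m : (f + g) m = f m + g m. Proof. by []. Qed.
Lemma scoefB f g m : (f - g) m = f m - g m. Proof. by []. Qed.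
Lemma scoefM f g m : (f * g) m = \sum_(p <- splits m) f p.1 * g p.2.
Proof. by []. Qed.
Lemma scoefZ c f m : (c *: f) m = c * f m. Proof. by []. Qed.
Lemma scoef_sum (T : Type) (r : seq T) (P : pred T) (F : T -> series I R) m :
  (\sum_(t <- r | P t) F t) m = \sum_(t <- r | P t) F t m.
Proof. by elim/big_rec2: _ => // t x y _ <-. Qed.

Definition svar (i : I) : series I R := smon (ucm i).

(** [1 / f] for [f] with constant coefficient 1, as the geometric series in
    [1 - f]; its [k]-th term only involves monomials of degree at least [k]
    (see [mulr_sinv]). *)
Definition sinv f : series I R :=
  Series (fun m => \sum_(k < (mdeg m).+1) ((1 - f) ^+ k) m).

Lemma scoefX_eq0 g k m : g 1%M = 0 -> (mdeg m < k)%N -> (g ^+ k) m = 0.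
Proof.
move=> g0; elim: k m => // k IHk m lt_mk.
rewrite exprS scoefM big_seq big1 // => -[d e]; rewrite in_splits /= => /eqP de.
have [->|d1] := eqVneq d 1%M; first by rewrite g0 mul0r.
rewrite [X in _ * X]IHk ?mulr0 //; move: d1 lt_mk; rewrite -mdeg_eq0 -de mdegM.
by case: (mdeg d) => // n _; rewrite addSn ltnS; apply: leq_ltn_trans (leq_addl _ _).
Qed.

Lemma mulr_sinv f : f 1%M = 1 -> f * sinv f = 1.
Proof.
move=> f1; have g0 : (1 - f) 1%M = 0 by rewrite scoefB scoef1 eqxx f1 subrr.
apply: seriesP => m; set N := (mdeg m).+1.
have sinvE e : (mdeg e < N)%N -> sinv f e = (\sum_(k < N) (1 - f) ^+ k) e.
  move=> leN; rewrite scoef_sum /= (big_ord_widen _ (fun k => ((1 - f) ^+ k) e) leN).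
  rewrite big_mkcond; apply: eq_bigr => k _; case: ltnP => // lek.
  by rewrite scoefX_eq0.
transitivity ((f * \sum_(k < N) (1 - f) ^+ k) m).
  rewrite !scoefM big_seq [RHS]big_seq; apply: eq_bigr => p.
  by rewrite in_splits => /eqP de; rewrite sinvE // ltnS -de mdegM leq_addl.
have -> : f * \sum_(k < N) (1 - f) ^+ k = 1 - (1 - f) ^+ N.
  rewrite -[LHS]opprK -mulNr -[RHS]opprB; congr (- _); rewrite subrX1.
  by congr (_ * _); rewrite addrAC subrr add0r.
by rewrite scoefB scoefX_eq0 // subr0.
Qed.

(** Sum of a coefficientwise finite family: every coefficient is a finitely
    supported sum. *)
Definition ssum (T : choiceType) (A : set T) (F : T -> series I R) :
  series I R := Series (fun m => \sum_(t \in A) F t m).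

Definition scvg (u : nat -> series I R) f :=
  forall m, exists N, forall n, (N <= n)%N -> u n m = f m.

End SeriesRing.

Definition smap (I : choiceType) (R S : Type) (phi : R -> S) (f : series I R) :
  series I S := Series (fun m => phi (f m)).

(** Variables [x_i = svar (inl i)] and [y_j = svar (inr j)]: the coefficient of
    [x^a y^b] in [f(x) g(y)] is [f a * g b]. *)
Section TwoAlphabets.
Implicit Types (m : {cmonom (nat + nat)%type}).

Definition xpart m : {cmonom nat} :=
  [cmonom m (inl i) | i in
    [fset i in pmap (fun s => if s is inl i then Some i else None)
                    (finsupp m)]]%M.
Definition ypart m : {cmonom nat} :=
  [cmonom m (inr j) | j in
    [fset j in pmap (fun s => if s is inr j then Some j else None)
                    (finsupp m)]]%M.

Lemma xpartE m i : xpart m i = m (inl i).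
Proof.
rewrite cmE fsfun_fun inE mem_pmap; case: ifP => // /negbT im.
apply/esym/eqP; rewrite cmE_eq0; apply: contra im => im.
by apply/mapP; exists (inl i).
Qed.

Lemma ypartE m j : ypart m j = m (inr j).
Proof.
rewrite cmE fsfun_fun inE mem_pmap; case: ifP => // /negbT im.
apply/esym/eqP; rewrite cmE_eq0; apply: contra im => im.
by apply/mapP; exists (inr j).
Qed.

Definition sxy (R : comNzRingType) (f g : series nat R) :
  series (nat + nat)%type R := Series (fun m => f (xpart m) * g (ypart m)).

End TwoAlphabets.

Definition strict_seq (s : seq nat) := sorted gtn s && (0%N \notin s).

Record strictp := StrictP {
  parts :> seq nat;
  partsP : strict_seq parts
}.
HB.instance Definition _ := [isSub for parts].
HB.instance Definition _ := [Countable of strictp by <:].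

Section Shapes.
Local Open Scope nat_scope.
Implicit Types (la mu : strictp).

(** [part la i] is the [i]-th part, [i >= 1]. *)
Definition part la i := nth 0 la i.-1.
Definition plen la := size la.
Definition psize la := sumn la.

Definition SD la : {fset nat * nat} :=
  [fset p in allpairs pair (iota 0 (size la + psize la).+1)
                           (iota 0 (size la + psize la).+1)
     | [&& 0 < p.1, p.1 <= p.2 & p.2 < p.1 + part la p.1]]%fset.

Lemma in_SD la (p : nat * nat) :
  (p \in SD la) = [&& 0 < p.1, p.1 <= p.2 & p.2 < p.1 + part la p.1].
Proof.
have inE' (B : seq (nat * nat)) :
    (p \in [fset p in B
             | [&& 0 < p.1, p.1 <= p.2 & p.2 < p.1 + part la p.1]]%fset) =
    (p \in B) && [&& 0 < p.1, p.1 <= p.2 & p.2 < p.1 + part la p.1].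
  by rewrite !inE.
rewrite inE' {inE'}; set B := allpairs _ _ _; apply: andb_idl.
case: p => i j /= /and3P[i0 ij jl].
have part_gt0 : 0 < part la i.
  by rewrite -(ltn_add2l i) addn0; exact: leq_ltn_trans ij jl.
have i_le : i <= size la.
  case: i {ij jl} i0 part_gt0 => // i _; rewrite /part /=.
  by case: (ltnP i (size la)) => // /(nth_default _) ->.
have part_le : part la i <= psize la.
  rewrite /part /psize; elim: (parts la) i.-1 => [|x s IHs] [|k] //=.
    exact: leq_addr.
  exact: leq_trans (IHs k) (leq_addl _ _).
have j_lt : j < (size la + psize la).+1.
  by apply: leq_trans jl _; apply: leqW; exact: leq_add.
rewrite /B; apply/allpairsPdep; exists i, j.
by rewrite !mem_iota /= (leq_ltn_trans ij).
Qed.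

Definition subp mu la := forall i, 0 < i -> part mu i <= part la i.

Definition SDskew la mu : {fset nat * nat} := (SD la `\` SD mu)%fset.
Definition skew_size la mu := #|` SDskew la mu|.
Definition cols la mu := #|` [fset p.2 | p in SDskew la mu]%fset|.
Definition overlap la mu :=
  #|` [fset p in SDskew la mu | (p.1.-1, p.2) \in SDskew la mu]%fset|.
Definition vertical_strip (D : {fset nat * nat}) :=
  forall p q, p \in D -> q \in D -> p.1 = q.1 -> p = q.

End Shapes.

(** Entries: [k : nat] encodes the positive half-integer [(k + 1) / 2], so that
    0, 1, 2, 3, ... stand for 1' < 1 < 2' < 2 < ...; both [i'] and [i] are sent
    to the variable number [k./2 = i - 1], i.e. [svar i] stands for the variable
    [x_(i+1)]. *)
Definition primed (k : nat) := ~~ odd k.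
Definition entry_var (k : nat) := k./2.

Definition filling := {fsfun nat * nat -> {fset nat} with fset0}.

Definition entry_le (S S' : {fset nat}) :=
  forall k k', k \in S -> k' \in S' -> (k <= k')%N.

(** Entries outside the support are [fset0], so [finsupp T = SD la] says that
    exactly the boxes of the shape are filled, by nonempty sets. *)
Record semistandard (la : strictp) (T : filling) : Prop := {
  ss_shape : finsupp T = SD la;
  ss_rows : forall i j j', (j < j')%N -> entry_le (T (i, j)) (T (i, j'));
  ss_cols : forall i i' j, (i < i')%N -> entry_le (T (i, j)) (T (i', j));
  ss_unprimed : forall i i' j k, ~~ primed k ->
    k \in T (i, j) -> k \in T (i', j) -> i = i';
  ss_primed : forall i j j' k, primed k ->
    k \in T (i, j) -> k \in T (i, j') -> j = j'
}.

Definition Ptype (T : filling) :=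
  forall j k, k \in T (j, j) -> ~~ primed k.

Definition tab_weight (T : filling) : {cmonom nat} :=
  \big[mmul/1%M]_(p <- finsupp T) \big[mmul/1%M]_(k <- T p) ucm (entry_var k).

Definition tab_size (T : filling) : nat := (\sum_(p <- finsupp T) #|` T p|)%N.

(** The ring Z[beta] is [{poly int}], with [beta = 'X]. *)
Definition beta : {poly int} := 'X.

Definition tableau_term (la : strictp) (T : filling) : series nat {poly int} :=
  beta ^+ (tab_size T - psize la) *: smon (tab_weight T).

Definition GP (la : strictp) : series nat {poly int} :=
  ssum [set T | semistandard la T /\ Ptype T] (tableau_term la).

Definition GQ (la : strictp) : series nat {poly int} :=
  ssum [set T | semistandard la T] (tableau_term la).

Section Cauchy.
Local Notation xy_series := (series (nat + nat)%type {poly int}).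

Definition xvar (i : nat) : xy_series := svar (inl i).
Definition yvar (j : nat) : xy_series := svar (inr j).

Definition xbar (x : xy_series) : xy_series := - x * sinv (1 + beta *: x).

Definition cauchy_factor (i j : nat) : xy_series :=
  (1 - xbar (xvar i) * yvar j) * sinv (1 - xvar i * yvar j).

(** sum_la G_la(x) g_la(y) = prod_(i, j) (1 - xbar_i y_j) / (1 - x_i y_j), the
    infinite product being the coefficientwise limit of its finite parts. *)
Definition cauchy_dual (G g : strictp -> series nat {poly int}) :=
  scvg (fun n => \prod_(i < n) \prod_(j < n) cauchy_factor i j)
       (ssum setT (fun la => sxy (G la) (g la))).

End Cauchy.

(** [c mu nu la] is the coefficient of [G la] in [G mu * G nu]. The truncated
    subtraction is harmless: [G la] only has monomials of degree at least
    [psize la], and the lowest degree parts are linearly independent, so the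
    equation itself forces [c mu nu la = 0] when
    [psize la < psize mu + psize nu]. *)
Definition structure_constants (G : strictp -> series nat {poly int})
    (c : strictp -> strictp -> strictp -> int) :=
  forall mu nu, G mu * G nu =
    ssum setT (fun la =>
      (c mu nu la *: beta ^+ (psize la - psize mu - psize nu)) *: G la).

Definition skew_dual (c : strictp -> strictp -> strictp -> int)
    (g : strictp -> series nat {poly int}) (la mu : strictp) :
    series nat {poly int} :=
  ssum setT (fun nu =>
    (c mu nu la *: beta ^+ (psize la - psize mu - psize nu)) *: g nu).

(** Extension of scalars from Z[beta] to Q[beta]. *)
Definition toQ : series nat {poly int} -> series nat {poly rat} :=
  smap (map_poly intr).

(* Main.v *)
Require Import Defs.
From HB Require Import structures.
From mathcomp Require Import all_boot all_order all_algebra.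
From mathcomp Require Import finmap.
From mathcomp Require Import boolp classical_sets functions cardinality fsbigop.
From mathcomp.multinomials Require Import monalg.
From mathcomp Require Import zify ring.

(** Work over Q[beta] and write [K] for the common value of the two Cauchy sums
    at a fixed monomial in [y], so that [GP_ka K = sum_la gq_(la/ka) GP_la] and
    [GQ_nu K = sum_mu gp_(mu/nu) GQ_mu].  The theorem follows by comparing
    coefficients, once three facts are known: [GQ_mu = sum_la M_(mu,la) GP_la]
    with [M] the vertical strip matrix; the overlap matrix [N] is a left inverse
    of [M]; and [gp_(mu/nu) = 0] unless [nu] is contained in [mu].

    Everything rests on the branching rule: splitting off the last variable [x]
    from [GP_la] or [GQ_la] gives [sum_s A(la,s) G_s], where [A(la,s)] is a
    product over the rows of explicit polynomials in [x] and [beta x], nonzero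
    only if [la] and [s] interlace.  Hence the [G_la] are linearly independent
    (the coefficient of [x^(la_1)] at [s = (la_2, la_3, ...)] is triangular), and
    the expansion of [GQ] in [GP] is equivalent to the one-variable identity
    [A_P M = M A_Q], proved row by row.

    For the containment, let [b] be the structure constants of the [GQ].
    Branching a product expresses the [b^la_(nu,ka)] through smaller ones; so if
    [nu_k <= la_k] is necessary for nonvanishing, then so is
    [nu_(k+1) <= la_(k+1)].  The case [k = 1] comes from the products with a
    single row, [GQ_n GQ_nu = GQ_(n,nu) + (terms with first part > n)], where
    subtracting [x] times the branching equation for [n - 1] from the one for [n]
    makes the sum over the first row telescope. *)

Set Implicit Arguments.
Unset Strict Implicit.
Unset Printing Implicit Defensive.

Import GRing.Theory.

Local Open Scope ring_scope.

Local Notation hd := (head 0%N).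

(** * Sums over strict partitions *)

(** With [M] and [N] at hand, [GQ_nu K] is expanded in the [GP_l] in two ways: through
    [GQ_nu = sum_ka M_(nu,ka) GP_ka], and through its own skew expansion followed by [M].
    Independence gives [sum_ka M_(nu,ka) gq_(l/ka) = sum_mu gp_(mu/nu) M_(mu,l)], and multiplying by
    [N] on the left isolates [gq_(l/ka)]. The supports of [N] and [M] yield every condition on the
    pairs [(nu, mu)] except that [nu] lies in [mu], which concerns the structure constants and
    therefore needs an argument of its own. Infinite sums are cut down at once: [G_la] starts in
    degree [|la|], so an identity read at one monomial involves only a finite list [sp N]. The
    scalars are extended to Q[beta] because [N] must invert the value [2] that [M] gives to a row
    that stays. *)

Fixpoint sp (N : nat) : seq (seq nat) :=
  if N is N'.+1 then sp N' ++ [seq N :: l | l <- sp N'] else [:: [::]].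

Lemma strict_cons c l : strict_seq (c :: l) = (hd l < c)%N && strict_seq l.
Proof.
rewrite /strict_seq /= in_cons negb_or.
case: l => [|d l] /=; first by case: c.
by case: c => [|c] /=; rewrite ?andbF ?andbA // ltn0.
Qed.

Lemma strict_behead l : strict_seq l -> strict_seq (behead l).
Proof. by case: l => // c l; rewrite strict_cons => /andP[]. Qed.

Lemma strict_hd0 l : strict_seq l -> hd l = 0%N -> l = [::].
Proof. by case: l => // c l; rewrite strict_cons /= => /andP[+ _] e; rewrite e. Qed.

Lemma strict_hd_behead l : strict_seq l -> (hd (behead l) <= (hd l).-1)%N.
Proof. by case: l => // c l; rewrite strict_cons /= => /andP[+ _]; lia. Qed.

Lemma mem_sp N l : (l \in sp N) = strict_seq l && (hd l <= N)%N.
Proof.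
elim: N l => [|N IH] l /=.
  rewrite inE; case: l => // c l; rewrite strict_cons /= leqn0.
  by case: c => [|c]; rewrite ?andbF ?ltn0.
rewrite mem_cat IH; apply/idP/idP.
  case/orP => [/andP[-> /= /leqW->]//|/mapP[l' +] ->].
  by rewrite IH strict_cons /= leqnn ltnS => /andP[-> ->].
case/andP => ls; rewrite leq_eqVlt ltnS => /orP[/eqP lN|->]; last by rewrite ls.
apply/orP; right; apply/mapP; exists (behead l); last by case: l lN ls => //= c l ->.
by rewrite IH strict_behead //= (leq_trans (strict_hd_behead ls)) // lN.
Qed.

Lemma uniq_sp N : uniq (sp N).
Proof.
elim: N => //= N IH; rewrite cat_uniq IH map_inj_uniq ?IH ?andbT /=; last by move=> ? ? [].
apply/hasPn => l /mapP[l' _ ->]; rewrite mem_sp /= ltnn andbF //.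
Qed.

Lemma nil_sp N : [::] \in sp N.
Proof. by rewrite mem_sp. Qed.

Section SpSum.
Context {V : nmodType}.
Implicit Types F : seq nat -> V.

Lemma sp_split N F : \sum_(l <- sp N) F l =
  F [::] + \sum_(c < N) \sum_(l <- sp c) F (c.+1 :: l).
Proof.
elim: N => [|N IH] /=; first by rewrite big_seq1 big_ord0 addr0.
by rewrite big_cat big_map big_ord_recr /= IH addrA.
Qed.

Lemma sp_widen M N F : (M <= N)%N ->
  (forall l, strict_seq l -> (M < hd l)%N -> F l = 0) ->
  \sum_(l <- sp N) F l = \sum_(l <- sp M) F l.
Proof.
move=> MN F0; rewrite [in LHS](bigID (fun l => hd l <= M)%N) /= [X in _ + X]big_seq_cond.
rewrite [X in _ + X]big1 ?addr0; last first.
  by move=> l; rewrite mem_sp -ltnNge => /andP[/andP[ls _]]; exact: F0.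
rewrite -big_filter; apply: perm_big; apply: uniq_perm; rewrite ?filter_uniq ?uniq_sp //.
move=> l; rewrite mem_filter !mem_sp; case: (strict_seq l) => /=; last by rewrite andbF.
by rewrite andb_idr // => /leq_trans; apply.
Qed.

Lemma sp_sum1 N l0 F : l0 \in sp N -> (forall l, l \in sp N -> l != l0 -> F l = 0) ->
  \sum_(l <- sp N) F l = F l0.
Proof.
move=> l0N F0; rewrite (bigD1_seq l0) ?uniq_sp //= big_seq_cond big1 ?addr0 // => l.
by case/andP; exact: F0.
Qed.

End SpSum.

(* Sums over strict partitions of products of weights attached to single rows,
   when the weights already force strictness. *)
Section RowProducts.
Context {S : comNzRingType}.
Implicit Types gs : seq (nat -> S).

Fixpoint rowprod gs (l : seq nat) : S :=
  if gs is g :: gs' then g (hd l) * rowprod gs' (behead l) else (l == [::])%:R.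

Fixpoint rowcompat gs : Prop :=
  if gs is g :: gs' then
    (if gs' is g' :: _ then
      forall p q, ~~ ((q < p)%N || (q == 0%N)) -> g p * g' q = 0 else True)
    /\ rowcompat gs'
  else True.

Lemma sum_rowprod N gs : rowcompat gs ->
  \sum_(l <- sp N) rowprod gs l = \prod_(g <- gs) \sum_(p < N.+1) g p.
Proof.
elim: gs => [|g gs IH].
  move=> _; rewrite big_nil (sp_sum1 (nil_sp N)) //= => l _.
  by case: eqP.
case=> gg' /IH {}IH; rewrite big_cons -IH mulr_suml sp_split big_ord_recl /=.
have Z (p : nat) l : strict_seq l -> ~~ ((hd l < p)%N || (hd l == 0)%N) -> g p * rowprod gs l = 0.
  case: gs gg' {IH} => [|g' gs] gg' ls h /=; last by rewrite mulrA gg' ?mul0r.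
  by case: l ls h => [|c l] ls; rewrite ?orbT // mulr0.
congr (_ + _).
  rewrite mulr_sumr (sp_sum1 (nil_sp N)) // => l; rewrite mem_sp => /andP[ls _] l0.
  by apply: Z => //=; apply: contra l0 => /eqP/(strict_hd0 ls) ->.
(* The tail below a first row [c.+1] ranges over [sp c]; compatibility makes the further terms up to
   [sp N] vanish, so that its range no longer depends on [c]. *)
apply: eq_bigr => c _; rewrite /bump /= add1n mulr_sumr.
apply/esym/sp_widen; first by rewrite ltnW.
by move=> l ls cl; apply: Z => //; lia.
Qed.

End RowProducts.

(** * One-variable transfer weights *)

Section Transfer.
Context {S : comNzRingType} (x be : S).
Let t := be * x.

(* Row weights of a layer of [n']'s, resp. of [n]'s: row length [a] becomes
   [p], resp. [p] becomes [b]; [d], [c] are the lengths of the row below,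
   before, resp. after, the layer; [P] forbids primes on the diagonal. *)
Definition vfac (P : bool) (p a d : nat) : S :=
  if p == a.+1 then (if P && (a == 0%N) then 0 else x)
  else if p == a then
    1 + (if [&& (0 < a)%N, (d == 0%N) || (d.+1 < a)%N & ~~ (P && (a == 1%N))]
         then t else 0)
  else 0.

Definition hfac (b p c : nat) : S :=
  if (p <= b)%N then
    x ^+ (b - p) * ((if (c == 0%N) || (c < p)%N then 1 else 0) +
                    (if (0 < p)%N && ((c == 0%N) || (c.+1 < p)%N) then t else 0))
  else 0.

Fixpoint vtr (P : bool) (l s : seq nat) : S :=
  if l is b :: l' then vfac P b (hd s) (hd (behead s)) * vtr P l' (behead s)
  else (s == [::])%:R.

Fixpoint htr (l s : seq nat) : S :=
  if l is b :: l' then hfac b (hd s) (hd l') * htr l' (behead s)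
  else (s == [::])%:R.

(** Weight of a row through both layers of one variable. A layer of primed letters adds at most one
    box per row, so the intermediate length is [a] or [a.+1]. *)
Definition wfac (P : bool) (b a c d : nat) : S :=
  vfac P a a d * hfac b a c + vfac P a.+1 a d * hfac b a.+1 c.

Fixpoint tr (P : bool) (l s : seq nat) : S :=
  if l is b :: l' then
    wfac P b (hd s) (hd l') (hd (behead s)) * tr P l' (behead s)
  else (s == [::])%:R.

Lemma hfac_eq0 b p c : ~~ ((c < p)%N || (c == 0%N)) -> hfac b p c = 0.
Proof.
by rewrite /hfac orbC negb_or => /andP[/negbTE-> /negbTE h]; case: ifP => // _;
  rewrite h /=; case: ifP => [|_]; rewrite ?addr0 ?mulr0 //; lia.
Qed.

Lemma hfac_gt b p c : (b < p)%N -> hfac b p c = 0.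
Proof. by rewrite /hfac ltnNge => /negbTE->. Qed.

Lemma sum_wfac P N b a c d : (b <= N)%N ->
  \sum_(p < N.+1) vfac P p a d * hfac b p c = wfac P b a c d.
Proof.
move=> bN; rewrite -(big_mkord predT (fun p => vfac P p a d * hfac b p c)).
(* The longer range contains the indices [a] and [a.+1] even if they exceed [N]; the new terms
   vanish because there [b < p]. *)
have -> : \sum_(0 <= p < N.+1) vfac P p a d * hfac b p c =
   \sum_(0 <= p < N + a.+2) vfac P p a d * hfac b p c.
  rewrite [RHS](@big_cat_nat _ _ _ N.+1) //=; last by lia.
  rewrite [X in _ + X]big_nat_cond [X in _ + X]big1 ?addr0 // => p /andP[/andP[h _] _].
  by rewrite hfac_gt ?mulr0 //; lia.
rewrite (@big_cat_nat _ _ _ a) //=; last by lia.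
rewrite big_nat_cond big1 ?add0r; last first.
  move=> p /andP[/andP[_ h] _]; rewrite /vfac.
  by rewrite !ifF ?mul0r //; apply/negbTE; lia.
rewrite big_ltn; last lia.
rewrite big_ltn; last lia.
rewrite big_nat_cond big1 ?addr0 // => p /andP[/andP[h _] _]; rewrite /vfac.
by rewrite !ifF ?mul0r //; apply/negbTE; lia.
Qed.

(** A factor sees only one part of the intermediate shape, because [vfac] reads the row below in [s]
    and [hfac] reads it in [l]. This is what brings the composition of the two layers within reach
    of [sum_rowprod]. *)
Fixpoint vhrows P (l s : seq nat) : seq (nat -> S) :=
  if l is b :: l' then
    (fun p => vfac P p (hd s) (hd (behead s)) * hfac b p (hd l')) :: vhrows P l' (behead s)
  else [::].

Lemma vhrows_compat P l s : strict_seq l -> rowcompat (vhrows P l s).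
Proof.
elim: l s => //= b l IH s; rewrite strict_cons => /andP[_ ls]; split; last exact: IH.
case: l {IH} ls => //= c l _ p q h.
have [qc|qc] := leqP q c; last by rewrite [hfac c q _]hfac_gt // !mulr0.
by rewrite [hfac b p c]hfac_eq0 ?mulr0 ?mul0r //; lia.
Qed.

Lemma rowprod_vh P l s p : strict_seq l -> strict_seq s -> strict_seq p ->
  (size s <= size l)%N -> rowprod (vhrows P l s) p = vtr P p s * htr l p.
Proof.
elim: l s p => [|b l IH] s p //=.
  move=> _ _ _; rewrite leqn0 => /nilP ->; case: p => [|c p] /=.
    by rewrite mulr1.
  by rewrite mulr0.
rewrite strict_cons => /andP[_ ls] ss sp szs.
case: p sp => [|c p] sp /=.
  rewrite IH ?strict_behead // ?size_behead; last by move: szs; case: (size s).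
  rewrite /= mulrACA; congr (_ * _); case: s ss {szs} => [|a s] ss /=.
    by rewrite /vfac /= addr0 mulr1.
  rewrite /vfac; move: ss; rewrite strict_cons; case: a => [|a] //= _.
  by rewrite mul0r.
rewrite IH ?strict_behead // ?size_behead; last by move: szs; case: (size s).
  by rewrite mulrACA.
by rewrite (strict_behead sp).
Qed.

Lemma vtr_size P l s : (size l < size s)%N -> vtr P l s = 0.
Proof.
elim: l s => [|b l IH] s /=; first by case: s.
by move=> h; rewrite IH ?mulr0 // size_behead; lia.
Qed.

Lemma htr_size l s : (size l < size s)%N -> htr l s = 0.
Proof.
elim: l s => [|b l IH] s /=; first by case: s.
by move=> h; rewrite IH ?mulr0 // size_behead; lia.
Qed.

Lemma tr_size P l s : (size l < size s)%N -> tr P l s = 0.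
Proof.
elim: l s => [|b l IH] s /=; first by case: s.
by move=> h; rewrite IH ?mulr0 // size_behead; lia.
Qed.

Lemma htr_hd l s : strict_seq l -> strict_seq s -> (hd l < hd s)%N -> htr l s = 0.
Proof.
case: l => [|b l] _ /=; first by case: s => [|c s].
by move=> _ h; rewrite hfac_gt ?mul0r.
Qed.

Lemma tr_comp P N l s : strict_seq l -> strict_seq s -> (hd l <= N)%N ->
  \sum_(p <- sp N) vtr P p s * htr l p = tr P l s.
Proof.
move=> ls ss lN; have [sl|sl] := leqP (size s) (size l); last first.
  rewrite tr_size // big1 // => p _.
  have [ps|ps] := ltnP (size p) (size s); first by rewrite vtr_size ?mul0r.
  by rewrite htr_size ?mulr0 // (leq_trans sl).
have -> : \sum_(p <- sp N) vtr P p s * htr l p = \sum_(p <- sp N) rowprod (vhrows P l s) p.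
  by apply: eq_big_seq => p; rewrite mem_sp => /andP[pst _]; rewrite rowprod_vh.
rewrite sum_rowprod; last exact: vhrows_compat.
elim: l s ls ss lN sl => [|b l IH] s ls ss lN sl /=.
  by rewrite big_nil; case: s sl {ss}.
move: ls; rewrite strict_cons => /andP[lb ls].
rewrite big_cons IH ?strict_behead ?sum_wfac ?size_behead //.
- by move: lN => /=; lia.
- by move: sl => /=; lia.
Qed.

Let subA a k : (a + k.+1 - a.+1 = k)%N. Proof. lia. Qed.
Let subB a k : (a + k.+1 - a = k.+1)%N. Proof. lia. Qed.

Ltac wfac_tac := rewrite /wfac /vfac /hfac;
  repeat (case: ifP => ?; try (exfalso; lia)); rewrite ?andbF ?andbT ?orbF ?orbT ?ltn0Sn ?ltnSn /=.

Lemma wfac_lt P b a c d : (b < a)%N -> wfac P b a c d = 0.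
Proof. by move=> h; wfac_tac; rewrite !mulr0 addr0. Qed.

Lemma wfac_gt P b a c d : (a < c)%N -> wfac P b a c d = 0.
Proof. by move=> h; rewrite /wfac !hfac_eq0 ?mulr0 ?addr0 //; lia. Qed.

(** Only the diagonal box of a new row offers a choice: [{n}], and without the P-type condition also
    [{n'}] and [{n', n}], whence [2 + t]. *)
Lemma wfac_new P k d : d = 0%N ->
  wfac P k.+1 0 0 d = x ^+ k.+1 * (if P then 1 else 2 + t).
Proof.
move=> ->; wfac_tac; rewrite !subn0 ?subn1 //=; first by ring.
by rewrite exprS; ring.
Qed.

(** The closed forms from here to [wfac5e] are sorted by how close [a] is to [c], the row below
    afterwards, and [c] to [d], the row below before. The names ending in [e] treat a row that
    stays, [b = a]; for a growing row the amount of growth enters only through the power of [x]. *)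
Lemma wfac1 P a k d : (0 < a)%N -> wfac P (a + k.+1) a a d = x ^+ k.+1.
Proof.
move=> h; wfac_tac; rewrite ?subA ?subB exprS; ring.
Qed.

Lemma wfac1e P a d : (0 < a)%N -> wfac P a a a d = 0.
Proof. by move=> h; wfac_tac; rewrite subnn; ring. Qed.

Lemma wfac2 P a c k : (0 < c)%N -> a = c.+1 ->
  wfac P (a + k.+1) a c c = x ^+ k.+1 * (2 + t).
Proof.
move=> c0 ->; wfac_tac; rewrite ?subA ?subB exprS; ring.
Qed.

Lemma wfac2e P a c : (0 < c)%N -> a = c.+1 -> wfac P a a c c = 1.
Proof. by move=> c0 ->; wfac_tac; rewrite subnn; ring. Qed.

Lemma wfac3 P a c d k : (0 < c)%N -> a = c.+1 -> (d < c)%N ->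
  wfac P (a + k.+1) a c d = x ^+ k.+1 * (2 * (1 + t)).
Proof.
move=> c0 -> dc; wfac_tac; rewrite ?subA ?subB exprS; ring.
Qed.

Lemma wfac3e P a c d : (0 < c)%N -> a = c.+1 -> (d < c)%N -> wfac P a a c d = 1 + t.
Proof. by move=> c0 -> dc; wfac_tac; rewrite subnn; ring. Qed.

Lemma wfac4 P a c d k : (c.+1 < a)%N || [&& ~~ P, c == 0%N & a == 1%N] -> (d <= c)%N ->
  wfac P (a + k.+1) a c d = x ^+ k.+1 * ((1 + t) * (2 + t)).
Proof.
move=> h dc; wfac_tac; rewrite ?subA ?subB exprS; ring.
Qed.

Lemma wfac4e P a c d : (c.+1 < a)%N || [&& ~~ P, c == 0%N & a == 1%N] -> (d <= c)%N ->
  wfac P a a c d = (1 + t) ^+ 2.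
Proof. by move=> h dc; wfac_tac; rewrite subnn; ring. Qed.

(** The only box of this row is on the diagonal, so under the P-type condition it cannot receive a
    primed letter and the weight is smaller than in [wfac4]. *)
Lemma wfac5 k : wfac true (1 + k.+1) 1 0 0 = x ^+ k.+1 * (2 * (1 + t)).
Proof. by wfac_tac; rewrite ?subSS ?subn0 ?subn1 /= exprS; ring. Qed.

Lemma wfac5e : wfac true 1 1 0 0 = 1 + t.
Proof. by wfac_tac; rewrite subnn; ring. Qed.

End Transfer.

(** * The matrix from GQ to GP *)

Section HeadSum.
Context {V : nmodType}.
Implicit Types F G : seq nat -> V.

Definition hsum (q : nat) F : V :=
  if q is q'.+1 then \sum_(l <- sp q') F (q :: l) else F [::].

Lemma sp_hsum N F : \sum_(l <- sp N) F l = \sum_(q < N.+1) hsum q F.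
Proof. by rewrite sp_split big_ord_recl. Qed.

Lemma eq_hsum q F G : (forall l, strict_seq l -> hd l = q -> F l = G l) ->
  hsum q F = hsum q G.
Proof.
case: q => [|q] FG /=; first exact: FG.
apply: eq_big_seq => l; rewrite mem_sp => /andP[ls lq].
by apply: FG; rewrite ?strict_cons ?ltnS ?lq.
Qed.

Lemma hsum0 q F : (forall l, strict_seq l -> hd l = q -> F l = 0) -> hsum q F = 0.
Proof. by move/eq_hsum->; case: q => //= q; rewrite big1. Qed.

End HeadSum.

Lemma hsumZ (S : comNzRingType) q (c : S) F :
  hsum q (fun l => c * F l) = c * hsum q F.
Proof. by case: q => //= q; rewrite mulr_sumr. Qed.

Lemma sum_two (V : nmodType) (f : nat -> V) u n :
  (forall q, q != u -> q != u.+1 -> f q = 0) ->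
  \sum_(q < n) f q = (if (u < n)%N then f u else 0) + (if (u.+1 < n)%N then f u.+1 else 0).
Proof.
move=> f0; elim: n => [|n IH]; first by rewrite big_ord0 !ltn0 addr0.
rewrite big_ord_recr /= IH !ltnS.
have [<-|nu] := eqVneq n u.
  by repeat (case: ifP => ?; try (exfalso; lia)); rewrite ?addr0 ?add0r.
have [->|nu'] := eqVneq n u.+1.
  by repeat (case: ifP => ?; try (exfalso; lia)); rewrite ?addr0 ?add0r.
by rewrite [f n]f0 // addr0; congr (_ + _); congr (if _ then _ else _); lia.
Qed.

Section Intertwine.
Context {S : comNzRingType} (x be : S).
Local Notation t := (be * x).
Local Notation tr := (tr x be).
Local Notation wfac := (wfac x be).

(* The coefficient of GP_la in GQ_mu, row by row: a row that grows contributes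
   [be], with a sign if the added box continues a column downwards. *)
Definition mfac (m b m2 b2 : nat) : S :=
  if b == m then 2
  else if b == m.+1 then be * (if (m == m2.+1) && (b2 == m) then -1 else 1)
  else 0.

Fixpoint mtr (mu la : seq nat) : S :=
  if mu is m :: mu' then
    mfac m (hd la) (hd mu') (hd (behead la)) * mtr mu' (behead la)
  else (la == [::])%:R.

(** The two sides of the intertwining identity, refined by the first part [q] of the summation
    variable. A row factor also looks at the next row, so only the refined sums satisfy a
    recursion. *)
Definition Lh mu rho q := hsum q (fun la => tr true la rho * mtr mu la).
Definition Rh mu rho q := hsum q (fun s => mtr s rho * tr false mu s).
(** The factor [mtr s rho] forces the first part of [s] to be that of [rho] or one less; this is the
    second case. *)
Definition R1 mu rho := if hd rho is r.+1 then Rh mu rho r else 0.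

Arguments Lh : simpl never.
Arguments Rh : simpl never.

Lemma mfac0 m b m2 b2 : b != m -> b != m.+1 -> mfac m b m2 b2 = 0.
Proof. by rewrite /mfac => /negbTE-> /negbTE->. Qed.

Lemma mfac_id m m2 b2 : mfac m m m2 b2 = 2.
Proof. by rewrite /mfac eqxx. Qed.

Lemma mfac_succ m m2 b2 :
  mfac m m.+1 m2 b2 = be * (if (m == m2.+1) && (b2 == m) then -1 else 1).
Proof. by rewrite /mfac eqxx ifF // gtn_eqF. Qed.

Lemma Lh_rec m mu rho c : Lh (m :: mu) rho c.+1 =
  \sum_(q < c.+1) wfac true c.+1 (hd rho) q (hd (behead rho)) * mfac m c.+1 (hd mu) q *
     Lh mu (behead rho) q.
Proof.
rewrite {1}/Lh {1}/hsum sp_hsum; apply: eq_bigr => q _; rewrite /Lh -hsumZ.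
by apply: eq_hsum => l _ lq /=; rewrite lq; ring.
Qed.

Lemma Rh_rec m mu r rho c : Rh (m :: mu) (r :: rho) c.+1 =
  \sum_(q < c.+1) mfac c.+1 r q (hd rho) * wfac false m c.+1 (hd mu) q * Rh mu rho q.
Proof.
rewrite {1}/Rh {1}/hsum sp_hsum; apply: eq_bigr => q _; rewrite /Rh -hsumZ.
by apply: eq_hsum => l _ lq /=; rewrite lq; ring.
Qed.

Lemma Lh0 mu rho q : q != hd mu -> q != (hd mu).+1 -> Lh mu rho q = 0.
Proof.
move=> q0 q1; apply: hsum0 => l ls lq; case: mu q0 q1 => [|m mu] /= q0 q1.
  by case: l ls lq => [|c l] ls /= lq; [rewrite -lq in q0 | rewrite mulr0].
by rewrite lq mfac0 ?mul0r ?mulr0.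
Qed.

Lemma Lh_nil rho : Lh [::] rho 1 = 0.
Proof. by apply: hsum0 => -[|c l] //=; rewrite mulr0. Qed.

Lemma Rh0 mu rho q : strict_seq rho -> q != hd rho -> q.+1 != hd rho -> Rh mu rho q = 0.
Proof.
move=> rs q0 q1; apply: hsum0 => l ls lq.
case: l ls lq => [|c l] ls /= lq.
  case: rho rs q0 q1 => [|r rho] rs /= q0 q1; last by rewrite mul0r.
  by rewrite -lq in q0.
by rewrite lq mfac0 ?mul0r 1?eq_sym.
Qed.

Lemma Rh00 mu r rho : Rh mu (r :: rho) 0 = 0.
Proof. by rewrite /Rh /= mul0r. Qed.

(** The part of [la] matched with a first part [u] of [mu] is [u] or [u.+1], so the recursion closes
    on two quantities. Here the new first row stays; in [L1_cons] it grows. *)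
Lemma L0_cons m mu rho (u := hd mu) (a := hd rho) (d := hd (behead rho)) :
  (u < m)%N -> Lh (m :: mu) rho m =
  2 * (wfac true m a u d * Lh mu (behead rho) u +
       if (u.+1 < m)%N then wfac true m a u.+1 d * Lh mu (behead rho) u.+1 else 0).
Proof.
case: m => // m um; rewrite Lh_rec (@sum_two _ (fun q : nat =>
  wfac true m.+1 a q d * mfac m.+1 m.+1 (hd mu) q * Lh mu (behead rho) q) u).
  by rewrite um /mfac eqxx; case: ifP => _; ring.
by move=> q q0 q1; rewrite Lh0 ?mulr0.
Qed.

Lemma L1_cons m mu rho (u := hd mu) (a := hd rho) (d := hd (behead rho)) :
  (u < m)%N -> Lh (m :: mu) rho m.+1 =
  be * (wfac true m.+1 a u d * Lh mu (behead rho) u +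
        (if m == u.+1 then -1 else 1) * wfac true m.+1 a u.+1 d * Lh mu (behead rho) u.+1).
Proof.
move=> um; rewrite Lh_rec (@sum_two _ (fun q : nat =>
  wfac true m.+1 a q d * mfac m m.+1 (hd mu) q * Lh mu (behead rho) q) u); last first.
  by move=> q q0 q1; rewrite Lh0 ?mulr0.
rewrite !ltnS um ltnW // !mfac_succ -/u.
by do ![case: ifP => ?; try (exfalso; lia)]; ring.
Qed.

Lemma R0_cons m mu r rho (u := hd mu) (d := hd rho) :
  strict_seq rho -> (d < r)%N -> Rh (m :: mu) (r :: rho) r =
  2 * (wfac false m r u d * Rh mu rho d + wfac false m r u d.-1 * R1 mu rho).
Proof.
move=> rs; case: r => // r dr; rewrite Rh_rec.
rewrite (@sum_two _ (fun q : nat =>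
  mfac r.+1 r.+1 q (hd rho) * wfac false m r.+1 u q * Rh mu rho q) d.-1); last first.
  by move=> q q0 q1; rewrite Rh0 ?mulr0 //; apply/eqP; rewrite -/d; lia.
(* For [d = 0] the two indices are [0] and [1] rather than [d.-1] and [d]; the term at [1] vanishes
   by [Rh0], and [R1] is [0]. *)
rewrite !mfac_id /R1 -/d; case dE: d dr => [|e] dr /=.
  rewrite [Rh mu rho 1]Rh0 //; try by apply/eqP; rewrite -/d; lia.
  by case: ifP => _; ring.
by rewrite dr ltnW //; ring.
Qed.

Lemma R1_cons m mu r rho (u := hd mu) (d := hd rho) :
  strict_seq rho -> (d < r)%N -> R1 (m :: mu) (r :: rho) =
  if r == 1%N then 0 else
  be * ((if (d < r.-1)%N then wfac false m r.-1 u d * Rh mu rho d else 0) +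
        (if r == d.+1 then -1 else 1) * wfac false m r.-1 u d.-1 * R1 mu rho).
Proof.
move=> rs; case: r => // -[|r] dr; first by rewrite /R1 /= Rh00.
rewrite {1}/R1 /= Rh_rec (@sum_two _ (fun q : nat =>
  mfac r.+1 r.+2 q (hd rho) * wfac false m r.+1 u q * Rh mu rho q) d.-1); last first.
  by move=> q q0 q1; rewrite Rh0 ?mulr0 //; apply/eqP; rewrite -/d; lia.
rewrite !mfac_succ /R1 -/d; case dE: d dr => [|e] dr /=.
  rewrite [Rh mu rho 1]Rh0 //; try by apply/eqP; rewrite -/d; lia.
  by do ![case: ifP => ?; try (exfalso; lia)]; ring.
have [dr'|dr'] := ltnP e.+1 r.+1.
  by do ![case: ifP => ?; try (exfalso; lia)]; ring.
by do ![case: ifP => ?; try (exfalso; lia)]; ring.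
Qed.

End Intertwine.

Arguments Lh : simpl never.
Arguments Rh : simpl never.

(** * The intertwining identity by induction on rows *)

Section Invariant.
Context {S : comNzRingType} (x be : S).
Local Notation t := (be * x).
Local Notation tr := (tr x be).
Local Notation wfac := (wfac x be).
Local Notation Lh := (Lh x be).
Local Notation Rh := (Rh x be).
Local Notation R1 := (R1 x be).
Local Notation mtr := (mtr be).

(* [u], [r] are the first parts of [mu], [rho]; [L0], [L1] (resp. [K0], [K1])
   the sums over [la] with first part [u], [u + 1] (resp. over [sigma] with
   first part [r], [r - 1]).  Equality of the totals alone is not inductive. *)
Record inv (u r : nat) (L0 L1 K0 K1 : S) : Prop := {
  inv_total : L0 + L1 = K0 + K1;
  inv_gt : (r < u)%N -> t * L0 = 2 * L1;
  inv_eq : r = u -> (0 < u)%N -> (1 + t) ^+ 2 * L0 - (1 + t) * L1 = K0 + (1 + t) * K1;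
  inv_lt : (u < r)%N -> L0 = 0 /\ K0 = 0;
  inv_lt1 : (u.+1 < r)%N -> L1 = 0 /\ K1 = 0;
  inv_nil : u = 0%N -> L1 = 0;
  inv_nilr : r = 0%N -> K1 = 0 }.

(** Proves an identity modulo one known equation: [k] is the cofactor of that equation, and a pure
    ring identity is left. The explicit values of [k] below are such cofactors. *)
Lemma lin (k p q a b : S) : a - b = k * (p - q) -> p = q -> a = b.
Proof. by move=> h pq; apply: subr0_eq; rewrite h pq subrr mulr0. Qed.

(** [g] is the common factor of all growing rows and [z] the value for a row that stays. Splitting
    off the power of [x] leaves finitely many identities, whatever the lengths of the rows. *)
Definition wspec P a c d (g z : S) :=
  (forall k, wfac P (a + k.+1) a c d = x ^+ k.+1 * g) /\ wfac P a a c d = z.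

(** Existence is enough wherever the weight multiplies a vanishing sum or only the power of [x]
    matters. *)
Lemma wspec_ex P a c d : exists g z, wspec P a c d g z.
Proof.
exists (vfac x be P a a d * ((if (c == 0%N) || (c < a)%N then 1 else 0) +
                    (if (0 < a)%N && ((c == 0%N) || (c.+1 < a)%N) then t else 0)) +
  (if P && (a == 0%N) then 0 else 1) * ((if (c == 0%N) || (c < a.+1)%N then 1 else 0) +
                    (if (0 < a.+1)%N && ((c == 0%N) || (c.+1 < a.+1)%N) then t else 0))).
exists (wfac P a a c d); split=> // k; rewrite /wfac /hfac.
have -> : (a <= a + k.+1)%N by lia.
have -> : (a < a + k.+1)%N by lia.
have -> : (a + k.+1 - a = k.+1)%N by lia.
have -> : (a + k.+1 - a.+1 = k)%N by lia.
rewrite exprS {2}/vfac eqxx.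
by case: (P && (a == 0%N)); ring.
Qed.

Lemma wspec1 P a d : (0 < a)%N -> wspec P a a d 1 0.
Proof. by move=> h; split=> [k|]; rewrite (wfac1, wfac1e) ?mulr1. Qed.

Lemma wspec2 P c : (0 < c)%N -> wspec P c.+1 c c (2 + t) 1.
Proof. by move=> h; split=> [k|]; rewrite (wfac2, wfac2e) ?mulr1. Qed.

Lemma wspec3 P c d : (0 < c)%N -> (d < c)%N -> wspec P c.+1 c d (2 * (1 + t)) (1 + t).
Proof. by move=> h dc; split=> [k|]; rewrite (wfac3, wfac3e). Qed.

Lemma wspec4 P a c d : (c.+1 < a)%N || [&& ~~ P, c == 0%N & a == 1%N] -> (d <= c)%N ->
  wspec P a c d ((1 + t) * (2 + t)) ((1 + t) ^+ 2).
Proof. by move=> h dc; split=> [k|]; rewrite (wfac4, wfac4e). Qed.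

(** * Adding a first row [m] to [mu] and a first row [r] to [rho] *)

Section Step.
Variables (m u r d : nat) (L0 L1 K0 K1 : S).
Hypotheses (um : (u < m)%N) (dr : (d < r)%N) (I : inv u d L0 L1 K0 K1).

Let nL0 := 2 * (wfac true m r u d * L0 +
       if (u.+1 < m)%N then wfac true m r u.+1 d * L1 else 0).
Let nL1 := be * (wfac true m.+1 r u d * L0 +
        (if m == u.+1 then -1 else 1) * wfac true m.+1 r u.+1 d * L1).
Let nK0 := 2 * (wfac false m r u d * K0 + wfac false m r u d.-1 * K1).
Let nK1 := if r == 1%N then 0 else
  be * ((if (d < r.-1)%N then wfac false m r.-1 u d * K0 else 0) +
        (if r == d.+1 then -1 else 1) * wfac false m r.-1 u d.-1 * K1).

Lemma inv_zero : nL0 = 0 -> nL1 = 0 -> nK0 = 0 -> nK1 = 0 -> inv m r nL0 nL1 nK0 nK1.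
Proof. by move=> -> -> -> ->; split=> *; rewrite ?mulr0 ?addr0 ?subr0. Qed.

(** Interlacing fails: the row [r] before the step is shorter than the row [u] below it afterwards,
    so every weight is zero. *)
Lemma inv_step_gt : (r < u)%N -> inv m r nL0 nL1 nK0 nK1.
Proof.
move=> ru; apply: inv_zero; rewrite /nL0 /nL1 /nK0 /nK1 ?wfac_gt ?mul0r ?mulr0 ?addr0;
  try lia; do ?[case: ifP => _]; rewrite ?wfac_gt ?mulr0 ?mul0r ?addr0; try lia; ring.
Qed.

Lemma inv_step_eq : u = r -> inv m r nL0 nL1 nK0 nK1.
Proof.
move=> ur; have h := inv_gt I; rewrite ur in h; have {}h := h dr.
have tot := inv_total I.
have Em : m = (r + (m - r).-1.+1)%N by lia.
have Em1 : m.+1 = (r + (m - r).+1)%N by lia.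
have r0 : (0 < r)%N by lia.
have w (P : bool) e : wfac P m r r e = x ^+ (m - r).-1.+1 by rewrite {1}Em wfac1.
have w' (P : bool) e : wfac P m.+1 r r e = x ^+ (m - r).-1.+2.
  by rewrite {1}Em1 wfac1 //; congr (_ ^+ _); lia.
have -> : nL0 = 2 * x ^+ (m - r).-1.+1 * L0.
  by rewrite /nL0 ur w [wfac _ _ _ r.+1 _]wfac_gt //; case: ifP => _; ring.
have -> : nL1 = t * x ^+ (m - r).-1.+1 * L0.
  by rewrite /nL1 ur w' [wfac _ _ _ r.+1 _]wfac_gt // exprS; ring.
have -> : nK0 = 2 * x ^+ (m - r).-1.+1 * (K0 + K1) by rewrite /nK0 ur !w; ring.
have -> : nK1 = 0.
  by rewrite /nK1 ur !(@wfac_gt _ _ _ _ _ r.-1) ?ltn_predL //; do ?[case: ifP => _]; ring.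
split; try (by move=> *; exfalso; lia).
(* The new totals differ by a multiple of [inv_gt] for the tails, which applies since [d < r = u].
   Equality of the old totals would not suffice here. *)
- by rewrite -tot; apply: (lin (k := x ^+ (m - r).-1.+1) _ h); ring.
- by move=> _; ring.
Qed.

(** Reduces the step to conditions free of [m]: [Hgt] for [m > r], [Heq] for [m = r], [Hlt] for
    [m = r - 1]; for smaller [m] all sums vanish. The pairs [(g, z)], [(h, y)], [(f, v)] are the row
    factors in the new [L]s, the new [K0] and the new [K1]; [phi] and [eps] absorb the case
    distinction and the sign in the new [K1]. *)
Lemma inv_step_gen g0 z0 g1 z1 h0 y0 h1 y1 f0 v0 f1 v1 phi eps : (u < r)%N -> (1 < r)%N ->
  wspec true r u d g0 z0 -> wspec true r u.+1 d g1 z1 ->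
  wspec false r u d h0 y0 -> wspec false r u d.-1 h1 y1 ->
  wspec false r.-1 u d f0 v0 -> wspec false r.-1 u d.-1 f1 v1 ->
  (if (d < r.-1)%N then 1 else 0) * K0 = phi * K0 ->
  (if r == d.+1 then -1 else 1) * K1 = eps * K1 ->
  let F := phi * f0 * K0 + eps * f1 * K1 in
  let V := phi * v0 * K0 + eps * v1 * K1 in
  (2 + t) * (g0 * L0 + g1 * L1) = 2 * (h0 * K0 + h1 * K1) + t * F ->
  (let A0 := 2 * (z0 * L0 + if (u.+1 < r)%N then z1 * L1 else 0) in
   let A1 := t * (g0 * L0 + (if r == u.+1 then -1 else 1) * (g1 * L1)) in
   let B0 := 2 * (y0 * K0 + y1 * K1) in
   A0 + A1 = B0 + t * F /\
   (1 + t) ^+ 2 * A0 - (1 + t) * A1 = B0 + (1 + t) * (t * F)) ->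
  ((u.+1 < r)%N -> z0 * L0 + (if r == u.+2 then -1 else 1) * (z1 * L1) = V) ->
  inv m r nL0 nL1 nK0 nK1.
Proof.
move=> ur r1 [s0 s0'] [s1 s1'] [q0 q0'] [q1 q1'] [p0 p0'] [p1 p1'] eK0 eK1 F V Hgt Heq Hlt.
have r1' : (r == 1%N) = false by lia.
have nK1E : nK1 = be * (phi * wfac false m r.-1 u d * K0 + eps * wfac false m r.-1 u d.-1 * K1).
  rewrite /nK1 r1'; congr (be * (_ + _)).
    by rewrite [phi * _]mulrC -mulrA -eK0; case: ifP => _; ring.
  by rewrite mulrAC eK1 mulrAC.
have [mr|rm|mr] := ltngtP m r.
- have -> : nL0 = 0.
    by rewrite /nL0 !wfac_lt //; case: ifP => _; ring.
  have -> : nK0 = 0 by rewrite /nK0 !wfac_lt //; ring.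
  have [mr1|mr1] := eqVneq r m.+1; last first.
    have -> : nL1 = 0 by rewrite /nL1 !wfac_lt; [ring|lia..].
    have -> : nK1 = 0.
      by rewrite nK1E !wfac_lt; [ring|lia..].
    by split=> *; rewrite ?mulr0 ?addr0 ?subr0.
  have -> : nL1 = be * V.
    rewrite /nL1 -mr1 s0' s1' -Hlt; last by lia.
    by rewrite mr1 eqSS; ring.
  have -> : nK1 = be * V.
    by rewrite nK1E (_ : m = r.-1) ?p0' ?p1' //; lia.
  split=> //; try (by move=> *; exfalso; lia).
- have Em : m = (r + (m - r).-1.+1)%N by lia.
  have Em1 : m.+1 = (r + (m - r).-1.+2)%N by lia.
  have Em2 : m = (r.-1 + (m - r).-1.+2)%N by lia.
  set X := x ^+ (m - r).-1.+1.
  have -> : nL0 = 2 * X * (g0 * L0 + g1 * L1).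
    rewrite /nL0 ifT; last by lia.
    by rewrite {1 2}Em s0 s1 -/X; ring.
  have -> : nL1 = t * X * (g0 * L0 + g1 * L1).
    rewrite /nL1 ifF; last by lia.
    by rewrite {1 2}Em1 s0 s1 exprS -/X; ring.
  have -> : nK0 = 2 * X * (h0 * K0 + h1 * K1).
    by rewrite /nK0 {1 2}Em q0 q1 -/X; ring.
  have -> : nK1 = t * X * F.
    by rewrite nK1E Em2 p0 p1 exprS -/X /F; ring.
  split; try (by move=> *; exfalso; lia).
    by apply: (lin (k := X) _ Hgt); ring.
  by move=> _; ring.
- have -> : nL0 = 2 * (z0 * L0 + if (u.+1 < r)%N then z1 * L1 else 0).
    by rewrite /nL0 mr s0' s1'.
  have Em1 : m.+1 = (r + 1)%N by lia.
  have Em2 : m = (r.-1 + 1)%N by lia.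
  have -> : nL1 = t * (g0 * L0 + (if r == u.+1 then -1 else 1) * (g1 * L1)).
    by rewrite /nL1 {1 2}Em1 s0 s1 mr expr1; ring.
  have -> : nK0 = 2 * (y0 * K0 + y1 * K1) by rewrite /nK0 mr q0' q1'.
  have -> : nK1 = t * F.
    by rewrite nK1E Em2 p0 p1 expr1 /F; ring.
  case: Heq => Heq1 Heq2.
  by split=> //; try (by move=> *; exfalso; lia).
Qed.

(** For an existing row, length one is the only case in which the diagonal condition changes the
    weights: [wfac5] on the left meets [wfac4] on the right. *)
Lemma inv_step_one : r = 1%N -> u = 0%N -> inv m r nL0 nL1 nK0 nK1.
Proof.
move=> r1 u0; have tot := inv_total I; have d0 : d = 0%N by lia.
have L10 := inv_nil I u0; have K10 := inv_nilr I d0.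
have KL : K0 = L0 by move: tot; rewrite L10 K10 !addr0.
rewrite /nL0 /nL1 /nK0 /nK1 r1 u0 d0 L10 K10 KL !mulr0 if_same /= !addr0.
have [m1|m1] := eqVneq m 1%N.
  have w5 : wfac true 2 1 0 0 = x * (2 * (1 + t)) := wfac5 x be 0.
  rewrite m1 w5 wfac5e wfac4e //.
  by split=> *; try (by exfalso; lia); try by []; ring.
have Em : m = (1 + (m - 2).+1)%N by lia.
have Em1 : m.+1 = (1 + (m - 2).+2)%N by lia.
have -> : wfac true m 1 0 0 = x ^+ (m - 2).+1 * (2 * (1 + t)) by rewrite {1}Em wfac5.
have -> : wfac true m.+1 1 0 0 = x ^+ (m - 2).+2 * (2 * (1 + t)) by rewrite {1}Em1 wfac5.
have -> : wfac false m 1 0 0 = x ^+ (m - 2).+1 * ((1 + t) * (2 + t)).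
  by rewrite {1}Em wfac4.
split=> *; try (by exfalso; lia); try by [].
  by rewrite !exprS; ring.
by rewrite !exprS; ring.
Qed.

Lemma inv_step_all0 : L0 = 0 -> L1 = 0 -> K0 = 0 -> K1 = 0 -> inv m r nL0 nL1 nK0 nK1.
Proof.
move=> a0 a1 b0 b1; apply: inv_zero; rewrite /nL0 /nL1 /nK0 /nK1 ?a0 ?a1 ?b0 ?b1 ?mulr0 ?addr0;
  do ?[case: ifP => _]; rewrite ?mulr0 ?addr0 ?mulr0 //.
Qed.

Ltac ifs := do ?[case: ifP => ?; try (exfalso; lia)].

(** The comparison of [d] with [u] decides which relation between the sums for the tails is
    available; the distance [r - u], being one, two or more, decides which closed forms apply. *)
Lemma inv_step : inv m r nL0 nL1 nK0 nK1.
Proof.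
have [ru|ur|ur] := ltngtP r u; [exact: inv_step_gt| |by apply: inv_step_eq].
have tot := inv_total I.
have [r1|r1] := eqVneq r 1%N; first by apply: inv_step_one => //; lia.
have {r1}r1 : (1 < r)%N by lia.
have [du|ud|du] := ltngtP d u.
- have h := inv_gt I du; have K1E : K1 = L0 + L1 - K0 by rewrite tot; ring.
  have [ru1|ru1] := eqVneq r u.+1; last have [ru2|ru2] := eqVneq r u.+2.
  + apply: (@inv_step_gen (2 * (1 + t)) (1 + t) 1 0 (2 * (1 + t)) (1 + t)
      (2 * (1 + t)) (1 + t) 1 0 1 0 1 1) => //; rewrite ?ru1 /=;
      try (by apply: wspec3; lia); try (by apply: wspec1; lia).
    * by ifs.
    * by ifs.
    * by rewrite K1E; apply: (lin (k := 1 + 2 * t) _ h); ring.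
    * rewrite ltnn eqxx K1E; split.
        by apply: (lin (k := 1 + 2 * t) _ h); ring.
      by apply: (lin (k := 1 + t) _ h); ring.
    * by rewrite ltnn.
  + apply: (@inv_step_gen ((1 + t) * (2 + t)) ((1 + t) ^+ 2) (2 * (1 + t)) (1 + t)
      ((1 + t) * (2 + t)) ((1 + t) ^+ 2) ((1 + t) * (2 + t)) ((1 + t) ^+ 2)
      (2 * (1 + t)) (1 + t) (2 * (1 + t)) (1 + t) 1 1) => //; rewrite ?ru2 /=;
      try (by apply: wspec3; lia); try (by apply: wspec4; lia).
    * by ifs.
    * by ifs.
    * by rewrite K1E; apply: (lin (k := t * (1 + t)) _ h); ring.
    * rewrite ltnSn ifF; last by lia.
      rewrite K1E; split.
        by apply: (lin (k := t * (1 + t)) _ h); ring.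
      by apply: (lin (k := t * (1 + t) ^+ 2) _ h); ring.
    * by rewrite eqxx K1E => _; apply: (lin (k := 1 + t) _ h); ring.
  + apply: (@inv_step_gen ((1 + t) * (2 + t)) ((1 + t) ^+ 2) ((1 + t) * (2 + t)) ((1 + t) ^+ 2)
      ((1 + t) * (2 + t)) ((1 + t) ^+ 2) ((1 + t) * (2 + t)) ((1 + t) ^+ 2)
      ((1 + t) * (2 + t)) ((1 + t) ^+ 2) ((1 + t) * (2 + t)) ((1 + t) ^+ 2) 1 1) => //;
      try (by apply: wspec4; lia).
    * by ifs.
    * by ifs.
    * by rewrite K1E; ring.
    * by rewrite K1E; ifs; split; ring.
    * by rewrite K1E => _; ifs; ring.
- have [L00 K00] := inv_lt I ud.
  have [ud1|ud1] := ltnP u.+1 d.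
    by have [L10 K10] := inv_lt1 I ud1; apply: inv_step_all0.
  have K1E : K1 = L1 by move: tot; rewrite L00 K00 !add0r.
  have [u0|u0] := posnP u.
    by have L10 := inv_nil I u0; apply: inv_step_all0; rewrite // K1E.
  have dE : d = u.+1 by lia.
  have [g0 [z0 s0]] := wspec_ex true r u d.
  have [h0 [y0 q0]] := wspec_ex false r u d.
  have [f0 [v0 p0]] := wspec_ex false r.-1 u d.
  have [ru2|ru2] := eqVneq r u.+2.
  + apply: (@inv_step_gen g0 z0 (2 + t) 1 h0 y0 ((1 + t) * (2 + t)) ((1 + t) ^+ 2)
      f0 v0 (2 + t) 1 1 (-1)) => //; rewrite ?dE ?ru2 /=;
      try (by apply: wspec2; lia); try (by apply: wspec4; lia).
    * by rewrite K00 !mulr0.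
    * by ifs.
    * by rewrite L00 K00 K1E; ring.
    * by rewrite L00 K00 K1E; ifs; split; ring.
    * by rewrite L00 K00 K1E eqxx => _; ring.
  + apply: (@inv_step_gen g0 z0 ((1 + t) * (2 + t)) ((1 + t) ^+ 2) h0 y0
      ((1 + t) * (2 + t)) ((1 + t) ^+ 2)
      f0 v0 ((1 + t) * (2 + t)) ((1 + t) ^+ 2) 1 1) => //; rewrite ?dE /=;
      try (by apply: wspec4; lia).
    * by rewrite K00 !mulr0.
    * by ifs.
    * by rewrite L00 K00 K1E; ring.
    * by rewrite L00 K00 K1E; ifs; split; ring.
    * by rewrite L00 K00 K1E => _; ifs; ring.
- have [u0|u0] := posnP u.
    have L10 := inv_nil I u0; have K10 := inv_nilr I (etrans du u0).
    have KL : K0 = L0 by move: tot; rewrite L10 K10 !addr0.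
    have [g1 [z1 s1]] := wspec_ex true r u.+1 d.
    have [h1 [y1 q1]] := wspec_ex false r u d.-1.
    have [f1 [v1 p1]] := wspec_ex false r.-1 u d.-1.
    apply: (@inv_step_gen ((1 + t) * (2 + t)) ((1 + t) ^+ 2) g1 z1
      ((1 + t) * (2 + t)) ((1 + t) ^+ 2) h1 y1
      ((1 + t) * (2 + t)) ((1 + t) ^+ 2) f1 v1 1 1) => //;
      try (by apply: wspec4; lia).
    * by ifs.
    * by ifs.
    * by rewrite L10 K10 KL; ring.
    * by rewrite L10 K10 KL; ifs; split; ring.
    * by rewrite L10 K10 KL => _; ring.
  have h := inv_eq I du u0; have K1E : K1 = L0 + L1 - K0 by rewrite tot; ring.
  rewrite K1E in h.
  have [ru1|ru1] := eqVneq r u.+1; last have [ru2|ru2] := eqVneq r u.+2.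
  + have [f0 [v0 p0]] := wspec_ex false r.-1 u d.
    apply: (@inv_step_gen (2 + t) 1 1 0 (2 + t) 1
      (2 * (1 + t)) (1 + t) f0 v0 1 0 0 (-1)) => //; rewrite ?du ?ru1 /=;
      try (by apply: wspec3; lia); try (by apply: wspec2; lia);  try (by apply: wspec1; lia).
    * by ifs.
    * by ifs.
    * by rewrite K1E; apply: (lin (k := 1) _ h); ring.
    * rewrite ltnn eqxx K1E; split.
        by apply: (lin (k := 1) _ h); ring.
      by apply: (lin (k := 1 - t) _ h); ring.
    * by rewrite ltnn.
  + apply: (@inv_step_gen ((1 + t) * (2 + t)) ((1 + t) ^+ 2) (2 * (1 + t)) (1 + t)
      ((1 + t) * (2 + t)) ((1 + t) ^+ 2) ((1 + t) * (2 + t)) ((1 + t) ^+ 2)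
      (2 + t) 1 (2 * (1 + t)) (1 + t) 1 1) => //; rewrite ?du ?ru2 /=;
      try (by apply: wspec3; lia); try (by apply: wspec2; lia); try (by apply: wspec4; lia).
    * by ifs.
    * by ifs.
    * by rewrite K1E; apply: (lin (k := t) _ h); ring.
    * rewrite ltnSn ifF; last by lia.
      rewrite K1E; split.
        by apply: (lin (k := t) _ h); ring.
      by apply: (lin (k := t * (1 + t)) _ h); ring.
    * by rewrite eqxx K1E => _; apply: (lin (k := 1) _ h); ring.
  + apply: (@inv_step_gen ((1 + t) * (2 + t)) ((1 + t) ^+ 2) ((1 + t) * (2 + t)) ((1 + t) ^+ 2)
      ((1 + t) * (2 + t)) ((1 + t) ^+ 2) ((1 + t) * (2 + t)) ((1 + t) ^+ 2)
      ((1 + t) * (2 + t)) ((1 + t) ^+ 2) ((1 + t) * (2 + t)) ((1 + t) ^+ 2) 1 1) => //;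
      try (by apply: wspec4; lia).
    * by ifs.
    * by ifs.
    * by rewrite K1E; ring.
    * by rewrite K1E; ifs; split; ring.
    * by rewrite K1E => _; ifs; ring.
Qed.

End Step.
Lemma inv_LR mu rho : strict_seq mu -> strict_seq rho ->
  inv (hd mu) (hd rho) (Lh mu rho (hd mu)) (Lh mu rho (hd mu).+1)
    (Rh mu rho (hd rho)) (R1 mu rho).
Proof.
elim: mu rho => [|m mu IH] rho ms rs.
  rewrite Lh_nil; case: rho rs => [|r rho] rs.
    rewrite /Lh /Rh /R1 /= !mul1r.
    by split=> //; rewrite ?mulr0.
  have Rz q : Rh [::] (r :: rho) q = 0.
    apply: hsum0 => -[|c l] ls lq; first by rewrite /= mul0r.
    by rewrite [tr _ _ _]/= mulr0.
  have -> : Lh [::] (r :: rho) (hd [::]) = 0 by rewrite /Lh /= mul0r.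
  rewrite /R1 /= Rz; case: r rs {Rz} (Rz) => [|r] rs Rz; rewrite ?Rz.
    by move: rs; rewrite strict_cons.
  by split=> //; rewrite ?mulr0 ?addr0.
move: ms; rewrite strict_cons => /andP[um ms].
case: rho rs => [|r rho] rs.
  rewrite L0_cons // L1_cons //=.
  have -> : R1 (m :: mu) [::] = 0 by [].
  have -> : Rh (m :: mu) [::] 0 = wfac false m 0 (hd mu) 0 * tr false mu [::].
    by rewrite /Rh /= mul1r.
  case: m um => // m um; case: mu ms um {IH} => [|c mu] ms um /=.
    rewrite Lh_nil !mulr0 if_same !addr0 !wfac_new // /Lh /=.
    by split=> //= *; rewrite ?mulr0 // !exprS; ring.
  move: ms; rewrite strict_cons => /andP[c0 _].
  rewrite !(@wfac_gt _ _ _ _ _ 0 c) ?(@wfac_gt _ _ _ _ _ 0 c.+1) //; try lia.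
  by rewrite !mulr0 !mul0r if_same addr0 mulr0; split=> *; rewrite ?mulr0 ?addr0.
have := rs; rewrite strict_cons => /andP[dr rs'].
rewrite L0_cons // L1_cons // R0_cons // R1_cons //.
exact: inv_step um dr (IH _ ms rs').
Qed.

Theorem intertwine N mu rho : strict_seq mu -> strict_seq rho ->
  (hd mu < N)%N -> (hd rho <= N)%N ->
  \sum_(la <- sp N) tr true la rho * mtr mu la =
  \sum_(s <- sp N) mtr s rho * tr false mu s.
Proof.
move=> ms rs mN rN; have := inv_total (inv_LR ms rs).
rewrite !sp_hsum (@sum_two _ (Lh mu rho) (hd mu)); last by move=> q; exact: Lh0.
rewrite !ltnS mN ltnW // => ->.
rewrite (@sum_two _ (Rh mu rho) (hd rho).-1); last first.
  by move=> q q0 q1; rewrite Rh0 //; apply/eqP; lia.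
rewrite /R1; case E: (hd rho) rN => [|r] rN /=; last by rewrite !ltnS rN ltnW // addrC.
rewrite [Rh mu rho 1]Rh0 //; try by rewrite E.
by rewrite if_same.
Qed.

End Invariant.

(** * The inverse matrix *)

Section Inverse.
Context {S : comNzRingType} (be hf : S) (hf2 : 2 * hf = 1).
Local Notation mtr := (mtr be).
Local Notation mfac := (mfac be).

(** The exponent [n2.+1 - k] is the number of boxes of the next row of [nu] that lie under added
    boxes of this row; rows are shifted by one, and truncation gives [0] when there is no
    overlap. *)
Definition nfac (k n n2 : nat) : S :=
  if (k <= n)%N then hf * (- (hf * be)) ^+ (n - k) * 2 ^+ (n2.+1 - k) else 0.

Fixpoint ntr (ka nu : seq nat) : S :=
  if ka is k :: ka' then nfac k (hd nu) (hd (behead nu)) * ntr ka' (behead nu)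
  else (nu == [::])%:R.

Definition Uh ka la q := hsum q (fun nu => ntr ka nu * mtr nu la).
Definition U1 ka la := if hd la is l.+1 then Uh ka la l else 0.

Local Arguments Uh : simpl never.

Lemma Uh_rec k ka l la c : Uh (k :: ka) (l :: la) c.+1 =
  \sum_(q < c.+1) nfac k c.+1 q * mfac c.+1 l q (hd la) * Uh ka la q.
Proof.
rewrite {1}/Uh {1}/hsum sp_hsum; apply: eq_bigr => q _; rewrite /Uh -hsumZ.
by apply: eq_hsum => s _ sq /=; rewrite sq; ring.
Qed.

Lemma Uh0 ka la q : strict_seq la -> q != hd la -> q.+1 != hd la -> Uh ka la q = 0.
Proof.
move=> rs q0 q1; apply: hsum0 => l ls lq.
case: l ls lq => [|c l] ls /= lq.
  case: la rs q0 q1 => [|r rho] rs /= q0 q1; last by rewrite mulr0.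
  by rewrite -lq in q0.
by rewrite lq mfac0 ?mul0r ?mulr0 1?eq_sym.
Qed.

Lemma Uh_sum N ka la : strict_seq la -> (hd la <= N)%N ->
  \sum_(nu <- sp N) ntr ka nu * mtr nu la = Uh ka la (hd la) + U1 ka la.
Proof.
move=> ls lN; rewrite sp_hsum (@sum_two _ (Uh ka la) (hd la).-1); last first.
  by move=> q q0 q1; rewrite Uh0 //; apply/eqP; lia.
rewrite /U1; case E: (hd la) lN => [|r] rN /=; last by rewrite !ltnS rN ltnW // addrC.
rewrite [Uh ka la 1]Uh0 //; try by rewrite E.
by rewrite if_same.
Qed.

Lemma U0_cons k ka l la (d := hd la) : strict_seq la -> (d < l)%N ->
  Uh (k :: ka) (l :: la) l = 2 * (nfac k l d * Uh ka la d + nfac k l d.-1 * U1 ka la).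
Proof.
move=> rs; case: l => // r dr; rewrite Uh_rec.
rewrite (@sum_two _ (fun q : nat => nfac k r.+1 q * mfac r.+1 r.+1 q (hd la) * Uh ka la q) d.-1);
  last first.
  by move=> q q0 q1; rewrite Uh0 ?mulr0 //; apply/eqP; rewrite -/d; lia.
rewrite !mfac_id /U1 -/d; case dE: d dr => [|e] dr /=.
  rewrite [Uh ka la 1]Uh0 //; try by apply/eqP; rewrite -/d; lia.
  by case: ifP => _; ring.
by rewrite dr ltnW //; ring.
Qed.

Lemma U1_cons k ka l la (d := hd la) : strict_seq la -> (d < l)%N -> (1 < l)%N ->
  U1 (k :: ka) (l :: la) =
  be * ((if (d < l.-1)%N then nfac k l.-1 d * Uh ka la d else 0) +
        (if l == d.+1 then -1 else 1) * nfac k l.-1 d.-1 * U1 ka la).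
Proof.
move=> rs; case: l => // -[|r] dr // _.
rewrite {1}/U1 /= Uh_rec (@sum_two _ (fun q : nat =>
  nfac k r.+1 q * mfac r.+1 r.+2 q (hd la) * Uh ka la q) d.-1); last first.
  by move=> q q0 q1; rewrite Uh0 ?mulr0 //; apply/eqP; rewrite -/d; lia.
rewrite !mfac_succ /U1 -/d; case dE: d dr => [|e] dr /=.
  rewrite [Uh ka la 1]Uh0 //; try by apply/eqP; rewrite -/d; lia.
  by do ![case: ifP => ?; try (exfalso; lia)]; ring.
have [dr'|dr'] := ltnP e.+1 r.+1.
  by do ![case: ifP => ?; try (exfalso; lia)]; ring.
by do ![case: ifP => ?; try (exfalso; lia)]; ring.
Qed.

Lemma nfac_lt k n n2 : (n < k)%N -> nfac k n n2 = 0.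
Proof. by rewrite /nfac ltnNge => /negbTE->. Qed.

(** For [l > k] the two possible first parts [l] and [l - 1] of [nu] cancel: the longer row costs
    [- be / 2] in [N], while [M] gives [2] for a row that stays and [be] for one that grows. *)
Lemma Uh_total ka la : strict_seq ka -> strict_seq la ->
  Uh ka la (hd la) + U1 ka la = (ka == la)%:R.
Proof.
elim: ka la => [|k ka IH] la ks ls.
  rewrite -(Uh_sum _ ls (leqnn _)) (sp_sum1 (nil_sp _)) /=.
    by rewrite mul1r eq_sym.
  by move=> l _ /negbTE->; rewrite mul0r.
move: ks; rewrite strict_cons => /andP[hk ks].
case: la ls => [|l la] ls.
  rewrite /Uh /U1 /= /nfac leqn0 ifF ?mul0r ?addr0 //; lia.
move: ls; rewrite strict_cons => /andP[hl ls].
rewrite eqseq_cons U0_cons //.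
have [lk|kl|kl] := ltngtP l k.
- rewrite !nfac_lt // !mul0r addr0 mulr0 add0r /=.
  have [l1|l1] := ltnP 1 l; last by rewrite /U1 /= (_ : l = 1%N) ?/Uh /= ?mulr0 //; lia.
  rewrite U1_cons // !nfac_lt; [|lia..].
  by case: ifP => _; ring.
- rewrite U1_cons /= //; last by lia.
  have El : (l - k = (l - k).-1.+1)%N by lia.
  have nE d' : nfac k l d' = - be * hf * nfac k l.-1 d'.
    rewrite /nfac !ifT; [|lia..].
    by rewrite El exprS (_ : l.-1 - k = (l - k).-1)%N; [ring|lia].
  case: ltnP => dl.
    rewrite ifF; last by lia.
    by rewrite !nE; apply: (lin (k := - be * (nfac k l.-1 (hd la) * Uh ka la (hd la) +
      nfac k l.-1 (hd la).-1 * U1 ka la)) _ hf2); ring.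
  have le : l = (hd la).+1 by lia.
  rewrite ifT; last by lia.
  (* The tails differ because [hd ka < k <= hd la], so the induction hypothesis turns [Uh] into
     [- U1]. The extra overlap box doubles [nfac], which makes up for the missing term and the sign
     in [U1_cons]. *)
  have := IH la ks ls; rewrite (_ : (ka == la) = false); last first.
    by apply/eqP => kla; move: hk hl; rewrite kla; lia.
  move/(canRL (addrK _)) => ->; rewrite !nE sub0r.
  have -> : nfac k l.-1 (hd la) = 2 * nfac k l.-1 (hd la).-1.
    rewrite /nfac !ifT; [|lia..].
    by rewrite (_ : (hd la).+1 - k = ((hd la).-1.+1 - k).+1)%N; [rewrite exprS; ring|lia].
  apply: (lin (k := be * nfac k l.-1 (hd la).-1 * U1 ka la) _ hf2); ring.
- rewrite kl /= -(IH la ks ls).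
  have -> : U1 (k :: ka) (k :: la) = 0.
    have [l1|l1] := ltnP 1 k; last by rewrite /U1 /= (_ : k = 1%N) ?/Uh /= ?mulr0 //; lia.
    rewrite U1_cons // -?kl // !nfac_lt; [|lia..].
    by case: ifP => _; ring.
  have e1 : ((hd la).+1 - k = 0)%N by lia.
  have e2 : ((hd la).-1.+1 - k = 0)%N by lia.
  rewrite /nfac leqnn subnn e1 e2.
  apply: (lin (k := Uh ka la (hd la) + U1 ka la) _ hf2); ring.
Qed.

Theorem ntr_mtr N ka la : strict_seq ka -> strict_seq la -> (hd la <= N)%N ->
  \sum_(nu <- sp N) ntr ka nu * mtr nu la = (ka == la)%:R.
Proof. by move=> ks ls lN; rewrite Uh_sum // Uh_total. Qed.

End Inverse.

(** * Shifted diagrams *)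

Local Open Scope fset_scope.
Local Open Scope ring_scope.

Definition emp : strictp := @StrictP [::] isT.
Definition mkp (l : seq nat) : strictp := insubd emp l.

Lemma mkpK l : strict_seq l -> parts (mkp l) = l.
Proof. by move=> ls; rewrite /mkp val_insubd ls. Qed.

Lemma partsK (la : strictp) : mkp la = la.
Proof. by apply: val_inj; apply: mkpK; exact: partsP. Qed.

Lemma strict_nth l i : strict_seq l -> (0 < nth 0 l i.+1 -> nth 0 l i.+1 < nth 0 l i)%N.
Proof.
elim: i l => [|i IH] [|b l]; rewrite ?strict_cons ?nth_nil //= => /andP[h ls].
  by rewrite nth0.
exact: IH.
Qed.

Lemma strict_ext l s : strict_seq l -> strict_seq s ->
  (forall i, nth 0%N l i = nth 0%N s i) -> l = s.
Proof.
elim: l s => [|b l IH] [|c s] // ls ss e.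
- by move: (e 0%N) ss; rewrite strict_cons /= => <-.
- by move: (e 0%N) ls; rewrite strict_cons /= => ->.
move: ls ss; rewrite !strict_cons => /andP[_ ls] /andP[_ ss].
by rewrite (e 0%N : b = c) (IH s) // => i; exact: (e i.+1).
Qed.

Lemma mk_strict (r : nat -> nat) N : r N = 0%N ->
  (forall i, 0 < r i.+1 -> r i.+1 < r i)%N ->
  exists2 l, strict_seq l & forall i, nth 0%N l i = r i.
Proof.
elim: N r => [|N IH] r rN rs.
  exists [::] => // i; rewrite nth_nil; elim: i => // i IHi.
  by move: (rs i); lia.
have [||l ls lr] := IH (fun i => r i.+1) => //; first by move=> i; exact: rs.
have [r0|r0] := posnP (r 0%N).
  exists [::] => // i; rewrite nth_nil; elim: i => // i IHi.
  by move: (rs i); lia.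
exists (r 0%N :: l); last by case.
rewrite strict_cons ls andbT -nth0 lr.
by have [->|/rs] := posnP (r 1%N).
Qed.

Arguments SD : simpl never.

Section Shapes.
Implicit Types la mu rho sig : strictp.

Lemma SD_left la i j j' : (i, j) \in SD la -> (i <= j')%N -> (j' <= j)%N -> (i, j') \in SD la.
Proof. by rewrite !in_SD /=; lia. Qed.

Lemma part_lt la i : (0 < i)%N -> (0 < part la i.+1 -> part la i.+1 < part la i)%N.
Proof. by case: i => // i _; exact: strict_nth (partsP la). Qed.

Lemma SD_up1 la i j : (0 < i)%N -> (i.+1, j) \in SD la -> (i, j) \in SD la.
Proof. by move=> i0; have := @part_lt la i i0; rewrite !in_SD /=; lia. Qed.

Lemma SD_up la i i' j : (0 < i')%N -> (i' <= i)%N -> (i, j) \in SD la -> (i', j) \in SD la.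
Proof.
move=> i0 /subnKC <-; elim: (i - i')%N => [|k IH]; rewrite ?addn0 //.
by rewrite addnS => /SD_up1 h; apply: IH; apply: h; lia.
Qed.

Lemma sub_SD mu la : (SD mu `<=` SD la) <-> subp mu la.
Proof.
split=> [h i i0|h].
  have [->//|p0] := posnP (part mu i).
  have : (i, (i + part mu i).-1) \in SD mu by rewrite in_SD /=; lia.
  by move/(fsubsetP h); rewrite in_SD /=; lia.
apply/fsubsetP => -[i j]; rewrite !in_SD /= => /and3P[i0 ij].
by have := h i i0; rewrite i0 ij /=; lia.
Qed.

Lemma SD_inj : injective SD.
Proof.
move=> la mu e; apply: val_inj; apply: strict_ext; rewrite ?partsP // => i.
have /sub_SD/(_ i.+1 isT) : SD la `<=` SD mu by rewrite e.
have /sub_SD/(_ i.+1 isT) : SD mu `<=` SD la by rewrite e.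
by rewrite /part /=; lia.
Qed.

Lemma SD_ideal la (X : {fset nat * nat}) : X `<=` SD la ->
  (forall i j j', (i, j) \in X -> (i <= j')%N -> (j' <= j)%N -> (i, j') \in X) ->
  (forall i j, (0 < i)%N -> (i.+1, j) \in X -> (i, j) \in X) ->
  exists sig, SD sig = X.
Proof.
move=> XS XL XU.
have ex i : exists n, (i.+1, (i.+1 + n)%N) \notin X.
  exists (part la i.+1); apply: contraT; rewrite negbK => /(fsubsetP XS).
  by rewrite in_SD /=; lia.
pose r i := ex_minn (ex i).
have rX i j : (0 < i)%N -> (i <= j)%N -> ((i, j) \in X) = (j < i + r i.-1)%N.
  case: i => // i _ ij; rewrite /r; case: ex_minnP => n nX nmin /=.
  apply/idP/idP => [jX|jn].
    by rewrite ltnNge; apply: contra nX => h; apply: XL jX _ h; lia.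
  apply: contraT => jX; have := nmin (j - i.+1)%N.
  by rewrite subnKC // jX => /(_ isT); lia.
have [||l ls lr] := @mk_strict r (size la).
- apply/eqP; rewrite -leqn0 leqNgt; apply/negP => r0.
  have : ((size la).+1, (size la).+1) \in X by rewrite rX //= -addn1 leq_add2l.
  by move/(fsubsetP XS); rewrite in_SD /= /part /= nth_default //; lia.
- move=> i r0.
  have : (i.+2, (i.+1 + r i.+1)%N) \in X by rewrite rX //=; lia.
  by move/XU => /(_ isT); rewrite rX //=; lia.
exists (mkp l); apply/fsetP => -[i j]; rewrite in_SD /part mkpK //= lr.
apply/and3P/idP => [[i0 ij]|]; first by rewrite rX.
by move=> ijX; have := fsubsetP XS _ ijX; rewrite in_SD /= => /and3P[i0 ij _]; split=> //; rewrite -rX.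
Qed.

Lemma SD_emp : SD emp = fset0.
Proof. by apply/fsetP => -[i j]; rewrite in_SD /part /= nth_nil inE; lia. Qed.

Definition bshift (p : nat * nat) := (p.1.+1, p.2.+1).

Lemma bshift_inj : injective bshift.
Proof. by case=> [? ?] [? ?] [-> ->]. Qed.

Lemma SD_shift b l i j : strict_seq (b :: l) ->
  ((i.+1, j.+1) \in SD (mkp (b :: l))) =
  if i == 0%N then (j < b)%N else (i, j) \in SD (mkp l).
Proof.
move=> bl; have := bl; rewrite strict_cons => /andP[_ ls].
by rewrite !in_SD /part !mkpK //=; case: i => [|i] /=; lia.
Qed.

Lemma SD_row0 la i : ((i, 0%N) \in SD la) = false.
Proof. by rewrite in_SD /=; lia. Qed.
Lemma SD_col0 la j : ((0%N, j) \in SD la) = false.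
Proof. by rewrite in_SD /=; lia. Qed.

Lemma SD_cons b l : strict_seq (b :: l) ->
  SD (mkp (b :: l)) =
  [fset (1%N, j.+1) | j in iota 0 b] `|` [fset bshift p | p in SD (mkp l)].
Proof.
move=> bl; apply/fsetP => -[[|i] [|j]]; rewrite ?SD_row0 ?SD_col0 ?SD_shift //.
- apply/esym/negbTE; rewrite in_fsetU negb_or.
  by apply/andP; split; apply/negP => /imfsetP[p _ []].
- apply/esym/negbTE; rewrite in_fsetU negb_or.
  by apply/andP; split; apply/negP => /imfsetP[p _ []].
- apply/esym/negbTE; rewrite in_fsetU negb_or.
  by apply/andP; split; apply/negP => /imfsetP[p _ []].
rewrite in_fsetU.
have -> : ((i.+1, j.+1) \in [fset bshift p | p in SD (mkp l)]) = ((i, j) \in SD (mkp l)).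
  by rewrite -[(i.+1, j.+1)]/(bshift (i, j)) mem_imfset //; exact: bshift_inj.
case: eqP => [->|i0].
  rewrite SD_col0 orbF; apply/idP/imfsetP => /= [jb|[k kb [->]]].
    by exists j => //; rewrite ?inE /= mem_iota.
  by move: kb; rewrite ?inE /= mem_iota.
rewrite orb_idl // => /imfsetP[k _ [i1 _]].
by case: i0.
Qed.

Lemma card_SD la : #|` SD la| = psize la.
Proof.
rewrite -(partsK la) /psize; move: (partsP la); elim: (parts la) => [|b l IH] bl.
  by rewrite (_ : mkp [::] = emp) ?SD_emp ?cardfs0 //; apply: val_inj; exact: mkpK.
have := bl; rewrite strict_cons => /andP[_ ls].
have {}IH : #|` SD (mkp l)| = sumn l by rewrite IH // mkpK.
rewrite SD_cons // mkpK //= cardfsU.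
have -> : [fset (1%N, j.+1) | j in iota 0 b] `&` [fset bshift p | p in SD (mkp l)] = fset0.
  apply/fsetP => p; rewrite in_fsetI inE; apply/negbTE/negP => /andP[].
  case/imfsetP => j _ -> /imfsetP[[i k] /= ik [ei _]].
  by move: ik; rewrite -ei SD_col0.
have c1 : #|` [fset (1%N, j.+1) | j in iota 0 b]| = b.
  by rewrite card_imfset /= ?undup_id ?iota_uniq ?size_iota // => ? ? [].
have c2 : #|` [fset bshift p | p in SD (mkp l)]| = sumn l.
  by rewrite card_imfset ?IH //; exact: bshift_inj.
by rewrite cardfs0 subn0 c1 c2.
Qed.

Lemma card_SDskew la mu : subp mu la -> #|` SDskew la mu| = (psize la - psize mu)%N.
Proof. by move/sub_SD => h; rewrite /SDskew cardfsDS // !card_SD. Qed.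

Lemma subp_psize la mu : subp mu la -> (psize mu <= psize la)%N.
Proof. by move/sub_SD/fsubset_leq_card; rewrite !card_SD. Qed.

End Shapes.

(** * Layers of equal entries *)

Section Layers.
Implicit Types la mu rho sig : strictp.

Definition rowfree (D : {fset nat * nat}) :=
  forall i j j', (i, j) \in D -> (i, j') \in D -> j = j'.
Definition colfree (D : {fset nat * nat}) :=
  forall i i' j, (i, j) \in D -> (i', j) \in D -> i = i'.

Lemma in_SDskew la mu p : (p \in SDskew la mu) = (p \in SD la) && (p \notin SD mu).
Proof. by rewrite in_fsetD andbC. Qed.

Lemma rowfreeP la mu : subp mu la ->
  rowfree (SDskew la mu) <-> forall i, (nth 0%N la i <= (nth 0%N mu i).+1)%N.
Proof.
move=> sub; split=> [h i|h i j j'].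
  rewrite leqNgt; apply/negP => lt.
  have := h i.+1 (i.+1 + nth 0%N mu i)%N (i.+2 + nth 0%N mu i)%N.
  by rewrite !in_SDskew !in_SD /part /=; lia.
rewrite !in_SDskew !in_SD /=; case: i => // i; have := h i; rewrite /part /=; lia.
Qed.

Lemma colfreeP la mu : subp mu la ->
  colfree (SDskew la mu) <->
  forall i, ((nth 0%N la i.+1 == 0) || (nth 0%N la i.+1 < nth 0%N mu i))%N.
Proof.
move=> sub; split=> [h i|h].
  rewrite -[_ || _]negbK negb_or -leqNgt; apply/negP => /andP[l0 lt].
  have lm := @strict_nth _ i (partsP la); have mm := @strict_nth _ i (partsP mu).
  have := h i.+1 i.+2 (i.+1 + nth 0%N la i.+1)%N.
  by have := sub i.+2 isT; rewrite !in_SDskew !in_SD /part /=; lia.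
have {}h i i' j : (i < i')%N ->
    (i, j) \in SDskew la mu -> (i', j) \in SDskew la mu -> False.
  rewrite !in_SDskew => ii' /andP[il im] /andP[il' im'].
  have i0 : (0 < i)%N by move: il; rewrite in_SD /=; lia.
  have : (i.+1, j) \in SD la by apply: SD_up il'.
  move: im il; case: i i0 ii' => // i _ _; have := h i.
  by rewrite !in_SD /part /=; lia.
move=> i i' j p q; have [ii|ii|//] := ltngtP i i'; first by case: (h i i' j).
by case: (h i' i j).
Qed.

(** Adding one letter [K] to a tableau of shape [sig] produces one of shape [la], and [rho] consists
    of the boxes without [K]. The boxes of [sig / rho] hold [K] beside smaller letters, so no two of
    them share a row or a column. *)
Record layer (P pr : bool) la sig rho : Prop := {
  layer_sub1 : SD rho `<=` SD sig;
  layer_sub2 : SD sig `<=` SD la;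
  layer_row : rowfree (SDskew sig rho);
  layer_col : colfree (SDskew sig rho);
  layer_D : if pr then rowfree (SDskew la rho) else colfree (SDskew la rho);
  layer_diag : P -> pr -> forall j, (j, j) \notin SDskew la rho }.

Definition okrow (P pr : bool) (b a c b2 a2 : nat) : bool :=
  [&& c <= a, a <= b, a <= c.+1, (a2 == 0) || (a2 < c) &
   if pr then (b <= c.+1) && [|| ~~ P, 0 < c | b == 0] else (b2 == 0) || (b2 < c)]%N.

Lemma layerP P pr la sig rho : layer P pr la sig rho <->
  forall i, okrow P pr (nth 0%N la i) (nth 0%N sig i) (nth 0%N rho i)
    (nth 0%N la i.+1) (nth 0%N sig i.+1).
Proof.
split=> [[s1 s2 r c D dg] i|h].
  have {}s1 := (sub_SD _ _).1 s1; have {}s2 := (sub_SD _ _).1 s2.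
  have s3 : subp rho la by move=> k k0; exact: leq_trans (s1 _ k0) (s2 _ k0).
  rewrite /okrow ((rowfreeP s1).1 r) ((colfreeP s1).1 c).
  rewrite (s1 i.+1 isT : (nth 0%N rho i <= nth 0%N sig i)%N).
  rewrite (s2 i.+1 isT : (nth 0%N sig i <= nth 0%N la i)%N) /=.
  case: pr D dg => D dg; last exact: ((colfreeP s3).1 D).
  rewrite ((rowfreeP s3).1 D) -implybE; apply/implyP => p.
  by have := dg p isT i.+1; rewrite in_SDskew !in_SD /part /=; lia.
have s1 : subp rho sig by case=> // i _; have /and5P[] := h i.
have s2 : subp sig la by case=> // i _; have /and5P[] := h i.
have s3 : subp rho la by move=> k k0; exact: leq_trans (s1 _ k0) (s2 _ k0).
split; try exact/sub_SD.
- by apply/(rowfreeP s1) => i; have /and5P[] := h i.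
- by apply/(colfreeP s1) => i; have /and5P[] := h i.
- case: pr h => h.
    by apply/(rowfreeP s3) => i; have /and5P[_ _ _ _ /andP[]] := h i.
  by apply/(colfreeP s3) => i; have /and5P[] := h i.
- move=> p pp j; have := h j.-1; rewrite in_SDskew !in_SD /part /okrow p pp /=.
  by case: j => //= j; lia.
Qed.

Fixpoint okl P pr (l s r : seq nat) : bool :=
  if l is b :: l' then
    okrow P pr b (hd s) (hd r) (hd l') (hd (behead s)) && okl P pr l' (behead s) (behead r)
  else (s == [::]) && (r == [::]).

Lemma oklP P pr l s r : strict_seq l -> strict_seq s -> strict_seq r ->
  reflect (forall i, okrow P pr (nth 0%N l i)%N (nth 0%N s i)%N (nth 0%N r i)%N
             (nth 0%N l i.+1)%N (nth 0%N s i.+1)%N)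
    (okl P pr l s r).
Proof.
elim: l s r => [|b l IH] s r ls ss rs.
  apply: (iffP andP) => [[/eqP-> /eqP->] i|h].
    by rewrite !nth_nil /okrow /=; case: P pr => [] [].
  have := h 0%N; rewrite /okrow /= !nth0 => /and3P[rs0 s0 _].
  have -> : s = [::] by apply: strict_hd0 => //; lia.
  by have -> : r = [::] by apply: strict_hd0 => //; lia.
move: ls; rewrite strict_cons => /andP[_ ls].
have {}IH := IH (behead s) (behead r) ls (strict_behead ss) (strict_behead rs).
apply: (iffP andP) => [[h /IH H] [|i]|h].
- by rewrite /= !nth0 -nth_behead nth0.
- by have := H i; rewrite !nth_behead.
- split; first by have := h 0%N; rewrite /= !nth0 -nth_behead nth0.
  by apply/IH => i; have := h i.+1; rewrite !nth_behead.
Qed.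

End Layers.

(** * From layers to the row weights *)

Section LayerSums.
Context {S : comNzRingType} (x be : S).
Local Notation vtr := (vtr x be).
Local Notation htr := (htr x be).
Local Notation vfac := (vfac x be).
Local Notation hfac := (hfac x be).

(** The row contains [b - c] copies of the new letter, and [a - c] of them share a box with smaller
    letters, hence the power of [be]. *)
Definition lrow P pr (b a b2 a2 c : nat) : S :=
  if okrow P pr b a c b2 a2 then x ^+ (b - c) * be ^+ (a - c) else 0.

Fixpoint lrows P pr (l s : seq nat) : seq (nat -> S) :=
  if l is b :: l' then
    lrow P pr b (hd s) (hd l') (hd (behead s)) :: lrows P pr l' (behead s)
  else [::].

Lemma lrows_compat P pr l s : rowcompat (lrows P pr l s).
Proof.
elim: l s => //= b l IH s; split; last exact: IH.
case: l {IH} => //= b2 l p q h; rewrite /lrow; case: ifP => [|_]; last by rewrite mul0r.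
case/and5P=> _ _ _ h1 _; case: ifP => [/and5P[h2 _ _ _ _]|_]; last by rewrite mulr0.
lia.
Qed.

Lemma rowprod_lrows P pr l s r : strict_seq l -> strict_seq s -> strict_seq r ->
  (size s <= size l)%N -> (size r <= size l)%N ->
  rowprod (lrows P pr l s) r =
  if okl P pr l s r then x ^+ (sumn l - sumn r) * be ^+ (sumn s - sumn r) else 0.
Proof.
elim: l s r => [|b l IH] s r ls ss rs /=.
  by rewrite !leqn0 => /nilP-> /nilP->; rewrite /= subnn mulr1.
move=> szs szr; move: ls; rewrite strict_cons => /andP[_ ls].
rewrite IH ?strict_behead ?size_behead //; [|lia..].
rewrite /lrow; case: ifP => [ok|_]; last by rewrite mul0r.
case: ifP => [okt|_] /=; last by rewrite mulr0.
have sr : (sumn (behead r) <= sumn (behead s) <= sumn l)%N.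
  elim: (l) (behead s) (behead r) okt => [|b' l' IHl] s' r' /=.
    by case/andP=> /eqP-> /eqP->.
  case/andP=> /and3P[h1 h2 _] /IHl.
  by case: s' r' h1 h2 => [|? ?] [|? ?] /=; lia.
have h : (hd r <= hd s <= b)%N by case/and3P: ok => -> ->.
have e q : sumn q = (hd q + sumn (behead q))%N by case: q.
rewrite (e r) (e s).
have -> : (b + sumn l - (hd r + sumn (behead r)) = (b - hd r) + (sumn l - sumn (behead r)))%N.
  by lia.
have -> : (hd s + sumn (behead s) - (hd r + sumn (behead r)) =
  (hd s - hd r) + (sumn (behead s) - sumn (behead r)))%N by lia.
by rewrite !exprD; ring.
Qed.

Lemma okl_size P pr l s r : okl P pr l s r -> (size s <= size l)%N /\ (size r <= size l)%N.
Proof.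
elim: l s r => [|b l IH] s r /=; first by case/andP=> /eqP-> /eqP->.
by case/andP=> _ /IH; rewrite !size_behead; lia.
Qed.

(** Only [c = a] and [c = a - 1] survive, since at most the last old box of a row is shared; the
    second choice is the origin of [t] in the weights. *)
Lemma sum_lrow P pr N b a b2 a2 : (a <= N)%N -> (a2 < a)%N || (a2 == 0%N) ->
  pr || (a2 <= b2)%N ->
  \sum_(c < N.+1) lrow P pr b a b2 a2 c = if pr then vfac P b a a2 else hfac b a b2.
Proof.
move=> aN aa ab; rewrite (@sum_two _ (lrow P pr b a b2 a2) a.-1); last first.
  by move=> q q0 q1; rewrite /lrow ifF // /okrow; apply/negbTE/negP; lia.
rewrite ifT; last by lia.
case: pr ab => ab; rewrite /lrow /okrow.
  have [->|ba] := eqVneq b a.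
    have [a0|a0] := posnP a.
      rewrite /vfac a0 /=.
      by repeat (case: ifP => ?; try (exfalso; lia)); rewrite ?subn0 ?expr0; ring.
    have e : (a - a.-1 = 1)%N by lia.
    rewrite prednK // e subnn /vfac.
    by repeat (case: ifP => ?; try (exfalso; lia)); rewrite ?expr0 ?expr1; ring.
  have [->|ba1] := eqVneq b a.+1.
    rewrite /vfac eqxx; have [a0|a0] := posnP a.
      rewrite a0 /=.
      by repeat (case: ifP => ?; try (exfalso; lia)); rewrite ?subn0 ?expr0 ?expr1; ring.
    rewrite prednK // subSnn subnn.
    by repeat (case: ifP => ?; try (exfalso; lia)); rewrite ?expr0 ?expr1; ring.
  rewrite /vfac (negbTE ba) (negbTE ba1).
  by repeat (case: ifP => ?; try (exfalso; lia)); ring.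
rewrite /hfac; have [a0|a0] := posnP a.
  rewrite a0 /= !subn0.
  by repeat (case: ifP => ?; try (exfalso; lia)); rewrite ?expr0; ring.
have [lt|le] := ltnP b a.
  by repeat (case: ifP => ?; try (exfalso; lia)); ring.
have e : (a - a.-1 = 1)%N by lia.
have e' : (b - a.-1 = (b - a).+1)%N by lia.
rewrite prednK // e e' subnn exprS.
by repeat (case: ifP => ?; try (exfalso; lia)); rewrite ?expr0 ?expr1; ring.
Qed.

Lemma sum_layers P pr N l s : strict_seq l -> strict_seq s -> (hd s <= N)%N ->
  \sum_(r <- sp N) (if okl P pr l s r then x ^+ (sumn l - sumn r) * be ^+ (sumn s - sumn r)
                    else 0) = if pr then vtr P l s else htr l s.
Proof.
move=> ls ss sN; have [sl|sl] := leqP (size s) (size l); last first.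
  rewrite vtr_size // htr_size // if_same big1 // => r _.
  by case: ifP => // /okl_size[? ?]; exfalso; lia.
have -> : \sum_(r <- sp N) (if okl P pr l s r then
    x ^+ (sumn l - sumn r) * be ^+ (sumn s - sumn r) else 0) =
  \sum_(r <- sp N) rowprod (lrows P pr l s) r.
  apply: eq_big_seq => r; rewrite mem_sp => /andP[rs _].
  have [rl|rl] := leqP (size r) (size l); first by rewrite rowprod_lrows.
  case: ifP => [/okl_size[_ h]|_]; first by move: rl; rewrite ltnNge h.
  elim: l s r rl {ls ss sl rs sN} => [|b l IH] s r /=; first by case: r.
  by move=> h; rewrite -IH ?mulr0 // size_behead; case: (size r) h.
rewrite sum_rowprod; last exact: lrows_compat.
elim: l s ls ss sN sl => [|b l IH] s ls ss sN sl /=.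
  by rewrite big_nil; case: s sl {ss sN} => //= _; rewrite if_same.
move: ls; rewrite strict_cons => /andP[_ ls].
have h1 := strict_hd_behead ss.
rewrite big_cons IH ?strict_behead ?size_behead //; [|lia..|by move: sl => /=; lia].
have aa : (hd (behead s) < hd s)%N || (hd (behead s) == 0%N) by lia.
case: (pr) {IH} => /=; first by rewrite sum_lrow.
have [ab|ab] := leqP (hd (behead s)) (hd l); first by rewrite sum_lrow.
(* The next row of [s] exceeds that of [l], so [sum_lrow] does not apply, but the factor of the
   tails is already zero. *)
by rewrite htr_hd ?strict_behead ?mulr0.
Qed.

End LayerSums.

(** * Tableaux layer by layer *)

Definition spS N : seq strictp := map mkp (sp N).

Lemma mem_spS N (la : strictp) : (la \in spS N) = (hd la <= N)%N.
Proof.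
apply/mapP/idP => [[l +] ->|h]; first by rewrite mem_sp => /andP[ls lN]; rewrite mkpK.
by exists (parts la); rewrite ?partsK // mem_sp partsP.
Qed.

Lemma uniq_spS N : uniq (spS N).
Proof.
rewrite map_inj_in_uniq ?uniq_sp // => l s; rewrite !mem_sp => /andP[ls _] /andP[ss _].
by move/(congr1 parts); rewrite !mkpK.
Qed.

Lemma hd_part (la : strictp) : hd la = part la 1.
Proof. by rewrite /part /= nth0. Qed.

Section Tableaux.
Implicit Types (P : bool) (T : filling) (la sig rho : strictp) (K : nat).

Definition addK K (D : {fset nat * nat}) T : filling :=
  [fsfun p in finsupp T `|` D => if p \in D then K |` T p else T p | fset0].
Definition cutK K T : filling := [fsfun p in finsupp T => T p `\ K | fset0].

Lemma Tout T p : p \notin finsupp T -> T p = fset0.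
Proof. by move/fsfun_dflt. Qed.

Lemma addKE K D T p : addK K D T p = if p \in D then K |` T p else T p.
Proof.
rewrite fsfun_fun in_fsetU; case: (boolP (p \in finsupp T)) => //= /Tout Tp.
by rewrite Tp; case: (p \in D).
Qed.

Lemma cutKE K T p : cutK K T p = T p `\ K.
Proof.
rewrite fsfun_fun; case: (boolP (p \in finsupp T)) => //= /Tout ->.
by rewrite fset0D.
Qed.

Definition bnd K T := forall p k, k \in T p -> (k < K)%N.

Record tab (P : bool) K la T : Prop := {
  tab_ss : semistandard la T;
  tab_P : P -> Ptype T;
  tab_bnd : bnd K T }.

Lemma in_supp T p k : k \in T p -> p \in finsupp T.
Proof. by move=> kT; apply: contraLR kT => /Tout ->. Qed.

Lemma supp_in T p : p \in finsupp T -> exists k, k \in T p.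
Proof. by rewrite mem_finsupp => /fset0Pn. Qed.

Lemma tab_notinK P K sig T p : tab P K sig T -> K \in T p = false.
Proof. by move=> Tt; apply/negP => /(tab_bnd Tt); rewrite ltnn. Qed.

Lemma addK_in K D T p k : k \in addK K D T p ->
  k \in T p \/ (k = K /\ p \in D).
Proof.
rewrite addKE; case: ifP => pD; last by left.
by rewrite in_fset1U => /orP[/eqP->|]; [right|left].
Qed.

Lemma addK_supp K D T : finsupp (addK K D T) = finsupp T `|` D.
Proof.
apply/fsetP => p; rewrite in_fsetU !mem_finsupp addKE; case: ifP => pD; last by rewrite orbF.
by rewrite orbT; apply/fset0Pn; exists K; rewrite in_fset1U eqxx.
Qed.

Lemma SDskewU la sig rho : SD rho `<=` SD sig -> SD sig `<=` SD la ->
  SD sig `|` SDskew la rho = SD la.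
Proof.
move=> s1 s2; apply/fsetP => p; rewrite in_fsetU in_SDskew.
have := fsubsetP s1 p; have := fsubsetP s2 p.
by do 3 case: (p \in _) => //=; move=> h1 h2; rewrite ?h1 ?h2 //; case: h1; case: h2.
Qed.

(** The order could only fail if a copy of [K] preceded a smaller letter in its row or column. Both
    boxes would then lie in [sig / rho], which has no two boxes in a row or column. *)
Lemma tab_addK P K la sig rho T : tab P K sig T -> layer P (primed K) la sig rho ->
  tab P K.+1 la (addK K (SDskew la rho) T).
Proof.
move=> [[sh rw cl up pr] tP tb] [s1 s2 lr lc lD lg].
have inT p k : k \in T p -> p \in SD sig by move/in_supp; rewrite sh.
have inD p : p \in SDskew la rho -> p \in SD la by rewrite in_SDskew => /andP[].
have Sr la' i j : (i, j) \in SD la' -> (0 < i)%N /\ (i <= j)%N.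
  by rewrite in_SD /= => /and3P[].
split; first split.
- by rewrite addK_supp sh SDskewU.
- move=> i j j' jj k k' /addK_in[kT|[-> pD]] /addK_in[kT'|[-> pD']] //.
  + exact: rw jj _ _ kT kT'.
  + by apply/ltnW/(tb _ _ kT).
  + exfalso; have ij' := inT _ _ kT'; have [i0 ij] := Sr _ _ _ (inD _ pD).
    have ijs : (i, j) \in SD sig by apply: SD_left ij' _ _ => //; exact: ltnW.
    have ijr : (i, j) \notin SD rho by move: pD; rewrite in_SDskew => /andP[].
    suff : j = j' by move: jj => /[swap] ->; rewrite ltnn.
    apply: (lr i); rewrite in_SDskew ?ijs ?ij' //=.
    by apply: contra ijr => h; apply: SD_left h _ _ => //; exact: ltnW.
- move=> i i' j ii k k' /addK_in[kT|[-> pD]] /addK_in[kT'|[-> pD']] //.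
  + exact: cl ii _ _ kT kT'.
  + by apply/ltnW/(tb _ _ kT).
  + exfalso; have ij' := inT _ _ kT'; have [i0 ij] := Sr _ _ _ (inD _ pD).
    have ijs : (i, j) \in SD sig by apply: SD_up ij' => //; exact: ltnW.
    have ijr : (i, j) \notin SD rho by move: pD; rewrite in_SDskew => /andP[].
    suff : i = i' by move: ii => /[swap] ->; rewrite ltnn.
    apply: (lc _ _ j); rewrite in_SDskew ?ijs ?ij' //=.
    by apply: contra ijr => h; apply: SD_up h => //; exact: ltnW.
- move=> i i' j k kp /addK_in[kT|[kK pD]] /addK_in[kT'|[kK' pD']].
  + exact: up kp kT kT'.
  + by move: (tb _ _ kT); rewrite kK' ltnn.
  + by move: (tb _ _ kT'); rewrite kK ltnn.
  + by move: lD; rewrite -kK (negbTE kp) => /(_ _ _ _ pD pD').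
- move=> i j j' k kp /addK_in[kT|[kK pD]] /addK_in[kT'|[kK' pD']].
  + exact: pr kp kT kT'.
  + by move: (tb _ _ kT); rewrite kK' ltnn.
  + by move: (tb _ _ kT'); rewrite kK ltnn.
  + by move: lD; rewrite -kK kp => /(_ _ _ _ pD pD').
- move=> p j k /addK_in[kT|[kK pD]]; first exact: tP p _ _ kT.
  by apply/negP => kp; have := lg p; rewrite -kK => /(_ kp j); rewrite pD.
- move=> p k /addK_in[kT|[-> _]] //; exact/ltnW/(tb _ _ kT).
Qed.

Lemma tab_cutK P K la T : tab P K.+1 la T ->
  exists sig rho, [/\ layer P (primed K) la sig rho, tab P K sig (cutK K T) &
    T = addK K (SDskew la rho) (cutK K T)].
Proof.
move=> [[sh rw cl up pr] tP tb].
have inT p k : k \in T p -> p \in SD la by move/in_supp; rewrite sh.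
have cT p k : (k \in cutK K T p) = (k \in T p) && (k < K)%N.
  rewrite cutKE in_fsetD1 andbC; apply: andb_id2l => kT.
  by move: (tb _ _ kT); rewrite ltnS leq_eqVlt; case: eqP => [->|]; rewrite ?ltnn.
(* [X] becomes the diagram of [sig], the boxes with a letter below [K], and [Y] that of [rho], the
   boxes without [K]. *)
pose X := finsupp (cutK K T); pose Y := [fset p in SD la | K \notin T p].
have XP p : reflect (exists2 k, k \in T p & (k < K)%N) (p \in X).
  apply: (iffP idP) => [/supp_in[k]|[k kT kK]]; first by rewrite cT => /andP[]; exists k.
  by apply: (@in_supp _ _ k); rewrite cT kT.
have inY p : (p \in Y) = (p \in SD la) && (K \notin T p).
  by rewrite /Y !inE.
have ne p : p \in SD la -> exists k, k \in T p by rewrite -sh; exact: supp_in.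
have [||| sig sigE] := @SD_ideal la X.
- by apply/fsubsetP => p /XP[k kT _]; exact: inT kT.
- move=> i j j' /XP[k kT kK] ij; rewrite leq_eqVlt => /orP[/eqP->|jj].
    by apply/XP; exists k.
  have [k' kT'] := ne (i, j') (SD_left (inT _ _ kT) ij (ltnW jj)).
  by apply/XP; exists k' => //; apply: leq_ltn_trans kK; exact: rw jj _ _ kT' kT.
- move=> i j i0 /XP[k kT kK].
  have [k' kT'] := ne (i, j) (SD_up1 i0 (inT _ _ kT)).
  by apply/XP; exists k' => //; apply: leq_ltn_trans kK; exact: cl (ltnSn i) _ _ kT' kT.
have [||| rho rhoE] := @SD_ideal la Y.
- by apply/fsubsetP => p; rewrite inY => /andP[].
- move=> i j j'; rewrite !inY => /andP[pS pK] ij; rewrite leq_eqVlt => /orP[/eqP->|jj].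
    by rewrite pS.
  rewrite (SD_left pS ij (ltnW jj)) /=; apply: contra pK => pK.
  have [k kT] := ne _ pS; have := rw _ _ _ jj _ _ pK kT.
  by move: (tb _ _ kT); rewrite ltnS => h1 h2; rewrite (_ : K = k) //; lia.
- move=> i j i0; rewrite !inY => /andP[pS pK].
  rewrite (SD_up1 i0 pS) /=; apply: contra pK => pK.
  have [k kT] := ne _ pS; have := cl _ _ _ (ltnSn i) _ _ pK kT.
  by move: (tb _ _ kT); rewrite ltnS => h1 h2; rewrite (_ : K = k) //; lia.
have inD p : (p \in SDskew la rho) = (K \in T p).
  rewrite in_SDskew rhoE inY; case: (boolP (K \in T p)) => [/inT->|] //=.
  by rewrite andbT andbN.
have inS p : (p \in SDskew sig rho) -> (K \in T p) /\ exists2 k, k \in T p & (k < K)%N.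
  rewrite in_SDskew sigE rhoE inY => /andP[/XP h pY]; split=> //.
  by case: h pY => k /inT -> _ /=; rewrite negbK.
exists sig, rho; split.
- split.
  + apply/fsubsetP => p; rewrite rhoE sigE inY => /andP[/ne[k kT] pK].
    apply/XP; exists k => //; move: (tb _ _ kT); rewrite ltnS leq_eqVlt => /orP[/eqP kK|//].
    by rewrite -kK kT in pK.
  + by apply/fsubsetP => p; rewrite sigE => /XP[k /inT].
  + move=> i j j' /inS[h1 [k1 t1 l1]] /inS[h2 [k2 t2 l2]].
    have [jj|jj|//] := ltngtP j j'.
      by have := rw _ _ _ jj _ _ h1 t2; lia.
    by have := rw _ _ _ jj _ _ h2 t1; lia.
  + move=> i i' j /inS[h1 [k1 t1 l1]] /inS[h2 [k2 t2 l2]].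
    have [jj|jj|//] := ltngtP i i'.
      by have := cl _ _ _ jj _ _ h1 t2; lia.
    by have := cl _ _ _ jj _ _ h2 t1; lia.
  + case: (boolP (primed K)) => Kp.
      by move=> i j j'; rewrite !inD; exact: pr.
    by move=> i i' j; rewrite !inD; exact: up.
  + move=> p Kp j; rewrite inD; apply/negP => /(tP p).
    by rewrite Kp.
- split; first split.
  + by rewrite sigE.
  + by move=> i j j' jj k k'; rewrite !cT => /andP[h _] /andP[h' _]; exact: rw jj _ _ h h'.
  + by move=> i j j' jj k k'; rewrite !cT => /andP[h _] /andP[h' _]; exact: cl jj _ _ h h'.
  + by move=> i j j' k kp; rewrite !cT => /andP[h _] /andP[h' _]; exact: up kp h h'.
  + by move=> i j j' k kp; rewrite !cT => /andP[h _] /andP[h' _]; exact: pr kp h h'.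
  + by move=> p j k; rewrite cT => /andP[h _]; exact: tP p _ _ h.
  + by move=> p k; rewrite cT => /andP[].
- apply/fsfunP => p; rewrite addKE inD cutKE; case: ifP => KT.
    by rewrite fsetD1K.
  by rewrite mem_fsetD1 // KT.
Qed.

End Tableaux.

(** * Branching *)

Local Notation "1" := (@mone _) : monom_scope.
Local Notation "x * y" := (mmul x y) : monom_scope.

(** * Coefficients of power series in a separated variable *)

Section SeriesMore.
Context {I : choiceType} {R : comNzRingType}.
Implicit Types (f g : series I R) (m d e : {cmonom I}).

Lemma mulm_inj d : injective (mmul d).
Proof.
move=> m e /eqP/cmP h; apply/eqP/cmP => i; have := h i; rewrite !cmM; lia.
Qed.

Lemma smon_coef d f m : (smon d * f) (d * m)%M = f m.
Proof.
rewrite scoefM (big_fsetD1 (d, m)) /=; last by rewrite in_splits.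
rewrite eqxx mul1r big_seq big1 ?addr0 // => -[a b].
rewrite in_fsetD1 in_splits /= => /andP[ne /eqP ab].
have [ad|] := eqVneq a d; last by rewrite mul0r.
by rewrite ad in ab ne; rewrite (mulm_inj ab) eqxx in ne.
Qed.

Lemma smon_coef0 d f m : (forall e, m != (d * e)%M) -> (smon d * f) m = 0.
Proof.
move=> h; rewrite scoefM big_seq big1 // => -[a b]; rewrite in_splits /= => /eqP ab.
by case: eqP => [ad|]; rewrite ?mul0r //; move: (h b); rewrite -ad ab eqxx.
Qed.

Lemma smonM d e : smon (d * e)%M = smon d * smon e :> series I R.
Proof.
apply: seriesP => m; have [[b ->]|h] := pselect (exists b, m = (d * b)%M).
  by rewrite smon_coef /= (inj_eq (@mulm_inj d)).
rewrite smon_coef0 /=; last by move=> b; apply/eqP => mb; apply: h; exists b.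
by rewrite (_ : (m == _) = false) //; apply/eqP => mb; apply: h; exists e.
Qed.

Definition ucmn (i : I) n : {cmonom I} := iter n (mmul (ucm i)) 1%M.

Lemma ucmnE i n j : ucmn i n j = if i == j then n else 0%N.
Proof.
elim: n => [|n IH] /=; first by rewrite onecmE if_same.
by rewrite cmM IH ucmE; case: eqP.
Qed.

Lemma svarX i n : svar i ^+ n = smon (ucmn i n) :> series I R.
Proof. by elim: n => [|n IH] //; rewrite exprS IH -smonM. Qed.

Definition free_of i f := forall m, m i != 0%N -> f m = 0.

(** A monomial factors uniquely into a part without the variable [i] and a power of it, so the
    product of a polynomial in that variable with a series free of it has no mixed terms to
    collect. *)
Lemma horner_alg_coef i (p : {poly R}) f m0 j : free_of i f -> m0 i = 0%N ->
  (horner_alg (svar i) p * f) (m0 * ucmn i j)%M = p`_j * f m0.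
Proof.
move=> fi m0i; have -> : horner_alg (svar i) p = \sum_(k < size p) p`_k *: svar i ^+ k.
  rewrite -{1}[p]coefK poly_def rmorph_sum; apply: eq_bigr => k _.
  by rewrite -mul_polyC rmorphM rmorphXn /= horner_algX horner_algC mulr_algl.
have term k : ((p`_k *: svar i ^+ k) * f) (m0 * ucmn i j)%M = if k == j then p`_j * f m0 else 0.
  rewrite -scalerAl scoefZ svarX mulmC; have [->|kj] := eqVneq k j; first by rewrite smon_coef.
  have [lt|gt] := ltnP k j.
    have -> : ucmn i j = (ucmn i k * ucmn i (j - k))%M.
      apply/eqP/cmP => l; rewrite cmM !ucmnE; case: eqP => // _; lia.
    rewrite -mulmA smon_coef fi ?mulr0 // cmM ucmnE eqxx; lia.
  rewrite smon_coef0 ?mulr0 // => e; apply/eqP => /eqP/cmP/(_ i).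
  rewrite !cmM !ucmnE eqxx m0i; lia.
rewrite mulr_suml scoef_sum.
under eq_bigr do rewrite term.
have [lt|ge] := ltnP j (size p).
  rewrite (bigD1 (Ordinal lt)) //= eqxx big1 ?addr0 // => k; rewrite -val_eqE /=.
  by move/negbTE->.
rewrite nth_default // mul0r big1 // => k _; case: eqP => // _.
Qed.

End SeriesMore.

Section TransferMorph.
Context {S S' : comNzRingType} (f : {rmorphism S -> S'}) (x be : S).

Lemma rmorph_if (b : bool) (u v : S) : f (if b then u else v) = if b then f u else f v.
Proof. by case: b. Qed.

Lemma vfac_morph P p a d : f (vfac x be P p a d) = vfac (f x) (f be) P p a d.
Proof. by rewrite /vfac !rmorph_if rmorphD rmorph_if rmorphM !rmorph0 rmorph1. Qed.

Lemma hfac_morph b p c : f (hfac x be b p c) = hfac (f x) (f be) b p c.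
Proof.
by rewrite /hfac !rmorph_if rmorphM rmorphXn rmorphD !rmorph_if rmorphM !rmorph0 !rmorph1.
Qed.

Lemma tr_morph P l s : f (tr x be P l s) = tr (f x) (f be) P l s.
Proof.
elim: l s => [|b l IH] s /=; first by rewrite rmorph_nat.
by rewrite rmorphM IH /wfac rmorphD !rmorphM !vfac_morph !hfac_morph.
Qed.

End TransferMorph.

Section Branching.
Implicit Types (T : filling) (la sig rho : strictp) (K : nat) (P : bool).

Definition layers P K la : seq (strictp * strictp) :=
  [seq q : strictp * strictp <- [seq (s, r) | s <- spS (hd la), r <- spS (hd la)]
     | okl P (primed K) la q.1 q.2].

(** A finite list of the tableaux with entries below [K]. The sums defining [GP] and [GQ] are
    infinite, but a monomial bounds the entries, so its coefficient is computed on this list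
    ([GX_SK]). *)
Fixpoint tabs P K la : seq filling :=
  if K is K'.+1 then
    [seq addK K' (SDskew la q.2) T | q <- layers P K' la, T <- tabs P K' q.1]
  else if la == emp then [:: [fsfun for fun=> fset0]] else [::].

Lemma layersP P K la sig rho :
  reflect (layer P (primed K) la sig rho) ((sig, rho) \in layers P K la).
Proof.
rewrite mem_filter /=; apply: (iffP andP) => [[/oklP h _]|h].
  by apply/layerP => i; apply: h; exact: partsP.
have s1 := (sub_SD _ _).1 (layer_sub1 h); have s2 := (sub_SD _ _).1 (layer_sub2 h).
split; first by apply/oklP; rewrite ?partsP // => i; move: i; apply/layerP.
apply/allpairsPdep; exists sig, rho; rewrite !mem_spS !hd_part s2 //; split=> //.
by rewrite (leq_trans (s1 _ _) (s2 _ _)).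
Qed.

Lemma uniq_layers P K la : uniq (layers P K la).
Proof.
apply: filter_uniq; apply: allpairs_uniq; rewrite ?uniq_spS //.
by case=> [? ?] [? ?] _ _ [-> ->].
Qed.

Lemma tabsP P K la T : T \in tabs P K la <-> tab P K la T.
Proof.
elim: K la T => [|K IH] la T /=.
  case: eqP => [->|ne].
    rewrite inE; split=> [/eqP->|[[sh _ _ _ _] _ tb]].
      have E p k : (k \in ([fsfun for fun=> fset0] : filling) p) = false by rewrite fsfunE inE.
      split; first split.
      - by rewrite SD_emp; apply/fsetP => p; rewrite mem_finsupp fsfunE eqxx inE.
      - by move=> i j j' _ k k'; rewrite E.
      - by move=> i j j' _ k k'; rewrite E.
      - by move=> i j j' k _; rewrite E.
      - by move=> i j j' k _; rewrite E.
      - by move=> _ j k; rewrite E.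
      - by move=> p k; rewrite E.
    apply/eqP/fsfunP => p; rewrite fsfunE; apply: Tout; rewrite sh SD_emp inE //.
  rewrite in_nil; split=> // -[[sh _ _ _ _] _ tb]; case: ne; apply: SD_inj.
  rewrite SD_emp -sh; apply/fsetP => p; rewrite inE; apply/negbTE/negP => /supp_in[k].
  by move/tb.
split=> [/allpairsPdep[[sig rho] [T' [/layersP ly /IH Tt ->]]]|/tab_cutK[sig [rho [ly Tt ->]]]].
  exact: tab_addK ly.
by apply/allpairsPdep; exists (sig, rho), (cutK K T); split=> //; [exact/layersP|exact/IH].
Qed.

Lemma cutK_addK P K la sig rho T : tab P K sig T -> cutK K (addK K (SDskew la rho) T) = T.
Proof.
move=> Tt; apply/fsfunP => p; rewrite cutKE addKE; have KT := tab_notinK p Tt.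
by case: ifP => _; rewrite ?fsetU1K ?mem_fsetD1 ?KT.
Qed.

Lemma addK_D P K la sig rho T p : tab P K sig T ->
  (K \in addK K (SDskew la rho) T p) = (p \in SDskew la rho).
Proof.
move=> Tt; rewrite addKE; case: ifP => _; first by rewrite in_fset1U eqxx.
exact: tab_notinK Tt.
Qed.

(** The data of a layer can be read back: deleting [K] gives the old tableau, its support gives
    [sig], and the boxes with [K] determine [rho]. *)
Lemma uniq_tabs P K la : uniq (tabs P K la).
Proof.
elim: K la => [|K IH] la /=; first by case: ifP.
apply: allpairs_uniq_dep => [|q _|]; rewrite ?uniq_layers //.
move=> u v /allpairsPdep[[sig rho] [T [/layersP ly /tabsP Tt ->]]].
move=> /allpairsPdep[[sig' rho'] [T' [/layersP ly' /tabsP Tt' ->]]] /= e.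
have TT : T = T' by rewrite -(cutK_addK la rho Tt) e (cutK_addK la rho' Tt').
have ss : sig = sig'.
  by apply: SD_inj; rewrite -(ss_shape (tab_ss Tt)) -(ss_shape (tab_ss Tt')) TT.
have rr : rho = rho'.
  have D p : (p \in SDskew la rho) = (p \in SDskew la rho').
    by rewrite -(addK_D la rho p Tt) e (addK_D la rho' p Tt').
  apply: SD_inj; apply/fsetP => p; have := D p; rewrite !in_SDskew.
  have h := fsubsetP (fsubset_trans (layer_sub1 ly) (layer_sub2 ly)) p.
  have h' := fsubsetP (fsubset_trans (layer_sub1 ly') (layer_sub2 ly')) p.
  case: (boolP (p \in SD la)) h h' => [_ _ _|_ h h'] /=; first by move/negb_inj.
  by move=> _; apply/idP/idP => [/h|/h'].
by move: Tt Tt' ly ly' e; rewrite TT ss rr.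
Qed.

Lemma tab_size_ge P K la T : tab P K la T -> (psize la <= tab_size T)%N.
Proof.
move=> Tt; have sh := ss_shape (tab_ss Tt).
rewrite -card_SD /tab_size sh cardfE -sum1_card -(big_seq_fsetE _ _ xpredT (fun=> 1%N)) /=.
rewrite big_seq [X in (_ <= X)%N]big_seq; apply: leq_sum => p; rewrite -sh => /supp_in[k kT].
by rewrite cardfs_gt0; apply/fset0Pn; exists k.
Qed.

End Branching.

(** * Generating functions of tableaux with bounded entries *)

Section Weights.
Implicit Types (T : filling) (la sig rho : strictp) (K : nat) (P : bool).

Lemma vtr_hd (S : comNzRingType) (x be : S) P l s : strict_seq l -> strict_seq s ->
  (hd l < hd s)%N -> vtr x be P l s = 0.
Proof.
case: l => [|b l] _ /=; first by case: s => [|c s].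
by move=> _ h; rewrite /vfac !ifF ?mul0r //; apply/negbTE; lia.
Qed.

Lemma big_ucm (i : nat) (A D : {fset nat * nat}) : D `<=` A ->
  \big[mmul/1%M]_(p <- A) (if p \in D then ucm i else 1%M) = ucmn i #|` D|.
Proof.
move=> DA; have -> : \big[mmul/1%M]_(p <- A) (if p \in D then ucm i else 1%M) =
  \big[mmul/1%M]_(p <- D) (if p \in D then ucm i else 1%M).
  by apply/esym/big_fset_incl => // p _ /negbTE->.
rewrite big_seq (eq_bigr (fun=> ucm i)); last by move=> p ->.
by rewrite -big_seq big_const_seq count_predT.
Qed.

Lemma tab_size_addK P K la sig rho T : tab P K sig T -> layer P (primed K) la sig rho ->
  tab_size (addK K (SDskew la rho) T) = (tab_size T + #|` SDskew la rho|)%N.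
Proof.
move=> Tt ly; rewrite /tab_size addK_supp (ss_shape (tab_ss Tt)).
rewrite (SDskewU (layer_sub1 ly) (layer_sub2 ly)).
have -> : (\sum_(p <- SD sig) #|` T p| = \sum_(p <- SD la) #|` T p|)%N.
  apply: big_fset_incl (layer_sub2 ly) _ => p _.
  by rewrite -(ss_shape (tab_ss Tt)) => /Tout ->.
have -> : (#|` SDskew la rho| = \sum_(p <- SD la) (p \in SDskew la rho))%N.
  rewrite -(@big_fset_incl _ _ _ _ (SDskew la rho)).
  - by rewrite big_seq (eq_bigr (fun=> 1%N)) => [|p ->//]; rewrite -big_seq sum1_size.
  - by apply/fsubsetP => p; rewrite in_SDskew => /andP[].
  - by move=> p _ /negbTE->.
rewrite -big_split; apply: eq_bigr => p _ /=; rewrite addKE; case: ifP => _.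
  by rewrite cardfsU1 (tab_notinK p Tt) addnC.
by rewrite addn0.
Qed.

Lemma tab_weight_addK P K la sig rho T : tab P K sig T -> layer P (primed K) la sig rho ->
  tab_weight (addK K (SDskew la rho) T) =
  (ucmn (entry_var K) #|` SDskew la rho| * tab_weight T)%M.
Proof.
move=> Tt ly; rewrite /tab_weight addK_supp (ss_shape (tab_ss Tt)).
rewrite (SDskewU (layer_sub1 ly) (layer_sub2 ly)).
have -> : \big[mmul/1%M]_(p <- SD sig) \big[mmul/1%M]_(k <- T p) ucm (entry_var k) =
  \big[mmul/1%M]_(p <- SD la) \big[mmul/1%M]_(k <- T p) ucm (entry_var k).
  apply: big_fset_incl (layer_sub2 ly) _ => p _.
  by rewrite -(ss_shape (tab_ss Tt)) => /Tout ->; rewrite big_seq_fset0.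
rewrite -(@big_ucm _ (SD la)); last first.
  by apply/fsubsetP => p; rewrite in_SDskew => /andP[].
rewrite -big_split; apply: eq_bigr => p _ /=; rewrite addKE; case: ifP => _.
  by rewrite big_fsetU1 // (tab_notinK p Tt).
by rewrite mul1m.
Qed.

Local Notation X i := (svar i : series nat {poly int}).
Local Notation be := (beta%:A : series nat {poly int}).

(** The [|la| - |rho|] new letters occupy [|la| - |sig|] new boxes, so the exponent of [beta] grows
    by [|sig| - |rho|]. *)
Lemma term_addK P K la sig rho T : tab P K sig T -> layer P (primed K) la sig rho ->
  tableau_term la (addK K (SDskew la rho) T) =
  X (entry_var K) ^+ (sumn la - sumn rho) * be ^+ (sumn sig - sumn rho) * tableau_term sig T.
Proof.
move=> Tt ly; rewrite /tableau_term (tab_size_addK Tt ly) (tab_weight_addK Tt ly).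
have s1 := (sub_SD _ _).1 (layer_sub1 ly); have s2 := (sub_SD _ _).1 (layer_sub2 ly).
have s3 : subp rho la by move=> i i0; exact: leq_trans (s1 _ i0) (s2 _ i0).
rewrite card_SDskew // smonM -svarX -/(psize la) -/(psize rho) -/(psize sig).
have h1 := subp_psize s1; have h2 := subp_psize s2; have h3 := tab_size_ge Tt.
have -> : (tab_size T + (psize la - psize rho) - psize la =
  (psize sig - psize rho) + (tab_size T - psize sig))%N by lia.
have -> : be ^+ (psize sig - psize rho) = (beta ^+ (psize sig - psize rho))%:A.
  by rewrite exprZn expr1n.
by rewrite exprD -mulrA [_%:A * _]mulr_algl scalerA -scalerAr.
Qed.

Definition SK P K la : series nat {poly int} := \sum_(T <- tabs P K la) tableau_term la T.

Lemma big_spS (V : nmodType) N (F : strictp -> V) :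
  \sum_(la <- spS N) F la = \sum_(l <- sp N) F (mkp l).
Proof. by rewrite big_map. Qed.

Lemma SK_rec P K la : SK P K.+1 la = \sum_(s <- sp (hd la))
  (if primed K then vtr (X (entry_var K)) be P la s else htr (X (entry_var K)) be la s) *
    SK P K (mkp s).
Proof.
rewrite /SK /= big_allpairs_dep /layers.
transitivity (\sum_(q <- layers P K la)
  X (entry_var K) ^+ (sumn la - sumn q.2) * be ^+ (sumn q.1 - sumn q.2) * SK P K q.1).
  apply: eq_big_seq => -[sig rho] /layersP ly; rewrite /SK mulr_sumr.
  by apply: eq_big_seq => T /tabsP Tt; exact: term_addK Tt ly.
rewrite big_filter big_mkcond big_allpairs_dep /= big_spS; apply: eq_big_seq => s.
rewrite mem_sp => /andP[ss sN]; rewrite -(sum_layers _ _ _ _ (partsP la) ss sN) mulr_suml.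
rewrite big_spS; apply: eq_big_seq => r; rewrite mem_sp => /andP[rs _].
by rewrite !mkpK //; case: ifP => _; rewrite ?mul0r.
Qed.

(** The codes [2n] and [2n + 1] are the primed and the unprimed letter of the variable with index
    [n]. The primed layer is added first, and [tr_comp] sums out the shape between the two. *)
Lemma SK_rec2 P n la : SK P n.+1.*2 la = \sum_(s <- sp (hd la))
  tr (X n) be P la s * SK P n.*2 (mkp s).
Proof.
rewrite doubleS SK_rec /primed /= odd_double /= /entry_var /= uphalf_double.
transitivity (\sum_(p <- sp (hd la)) \sum_(s <- sp (hd la))
   (vtr (X n) be P p s * htr (X n) be la p) * SK P n.*2 (mkp s)).
  apply: eq_big_seq => p; rewrite mem_sp => /andP[ps pN].
  rewrite SK_rec /primed odd_double /= /entry_var doubleK mkpK // mulr_sumr.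
  rewrite -(sp_widen pN); last first.
    by move=> s ss lt; rewrite vtr_hd // mul0r mulr0.
  by apply: eq_bigr => s _; ring.
rewrite exchange_big; apply: eq_big_seq => s; rewrite mem_sp => /andP[ss sN].
by rewrite -mulr_suml tr_comp ?partsP.
Qed.

Lemma weight_coef T i : (exists p k, k \in T p /\ entry_var k = i) <-> tab_weight T i != 0%N.
Proof.
have ev (J : eqType) (r : seq J) (F : J -> {cmonom nat}) :
    (\big[mmul/1%M]_(j <- r) F j) i != 0%N <-> exists2 j, j \in r & F j i != 0%N.
  elim: r => [|j r IH]; first by rewrite big_nil onecmE; split=> // -[].
  rewrite big_cons cmM addn_eq0 negb_and; split.
    case/orP=> [h|/IH[k kr h]]; first by exists j; rewrite ?mem_head.
    by exists k; rewrite // in_cons kr orbT.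
  case=> k; rewrite in_cons => /orP[/eqP-> ->//|kr h].
  by apply/orP; right; apply/IH; exists k.
rewrite /tab_weight ev; split.
  case=> p [k [kT ki]]; exists p; first exact: in_supp kT.
  by apply/ev; exists k; rewrite // ucmE ki eqxx.
by case=> p _ /ev[k kT]; rewrite ucmE; case: (entry_var k =P i) => // ki _; exists p, k.
Qed.

Lemma SK_free P n i la : (n <= i)%N -> free_of i (SK P n.*2 la).
Proof.
move=> ni m mi; rewrite /SK scoef_sum big_seq big1 // => T /tabsP Tt.
rewrite scoefZ /=; case: eqP => [e|_]; last by rewrite mulr0.
move: mi; rewrite e => /weight_coef[p [k [/(tab_bnd Tt) kn ki]]].
by move: ki ni kn; rewrite /entry_var => <-; lia.
Qed.

Definition GX P la := if P then GP la else GQ la.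

Lemma GX_SK P n la (m : {cmonom nat}) : (forall i, (n <= i)%N -> m i = 0%N) -> GX P la m = SK P n.*2 la m.
Proof.
move=> mn; pose A : set filling := [set T | semistandard la T /\ (P -> Ptype T)]%classic.
have -> : GX P la = ssum A (tableau_term la).
  rewrite /GX /GP /GQ /A; case: (P); congr (ssum _ _); apply/funext => T; apply/propext.
    by split=> -[h1 h2]; split=> //; exact: h2.
  by split=> // -[].
rewrite /SK scoef_sum /= (@fsbigE _ _ _ _ _ (tabs P n.*2 la)) ?uniq_tabs //.
- rewrite big_seq_cond [RHS]big_seq; apply: eq_bigl => T; apply: andb_idr => /tabsP Tt.
  by rewrite inE /A /=; split; [exact: tab_ss Tt|exact: tab_P Tt].
- by move=> T /= /tabsP Tt; split; [exact: tab_ss Tt|exact: tab_P Tt].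
move=> T [ss tP] nT; rewrite /tableau_term ?scoefZ /=; case: eqP => [e|_]; last by rewrite mulr0.
exfalso; move/negP: nT; apply; apply/tabsP; split=> // p k kT.
have : tab_weight T (entry_var k) != 0%N by apply/weight_coef; exists p, k.
rewrite -e; have [ge|lt] := leqP n (entry_var k); first by rewrite mn.
by move=> _; move: lt; rewrite /entry_var; lia.
Qed.

Definition trp P (l s : seq nat) : {poly {poly int}} := tr 'X beta%:P P l s.

Theorem branching P n la (m : {cmonom nat}) j : (forall i, (n <= i)%N -> m i = 0%N) ->
  GX P la (m * ucmn n j)%M = \sum_(s <- sp (hd la)) (trp P la s)`_j * GX P (mkp s) m.
Proof.
move=> mn; rewrite (@GX_SK _ n.+1); last first.
  by move=> i ni; rewrite cmM ucmnE mn ?(ltnW ni) // ifF //; lia.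
rewrite SK_rec2 scoef_sum; apply: eq_bigr => s _; rewrite (GX_SK _ _ mn).
rewrite -(@horner_alg_coef _ _ n); [|exact: SK_free|exact: mn].
by rewrite /trp tr_morph /= horner_algX horner_algC.
Qed.

Lemma GX_one P la : GX P la 1%M = (la == emp)%:R.
Proof.
rewrite (@GX_SK _ 0) => [|i _]; last by rewrite onecmE.
rewrite /SK /=; case: eqP => [->|_]; last by rewrite big_nil.
rewrite big_seq1 /tableau_term /tab_size /tab_weight.
have -> : finsupp ([fsfun for fun=> fset0] : filling) = fset0.
  by apply/fsetP => p; rewrite mem_finsupp fsfunE eqxx inE.
by rewrite !big_seq_fset0 /= sub0n expr0 mul1r !eqxx.
Qed.

End Weights.

(** * Linear independence *)

Section TransferSupport.
Context {S : comNzRingType} (x be : S).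

Definition interl (l s : seq nat) :=
  forall i, (nth 0 s i <= nth 0 l i)%N /\ (nth 0 l i.+1 <= nth 0 s i)%N.

Lemma wfac_supp P b a c d :
  wfac x be P b a c d = 0 \/
  (a <= b)%N /\ (c <= a)%N /\ exists u, wfac x be P b a c d = x ^+ (b - a) * u.
Proof.
have [ba|ab] := ltnP b a; first by left; rewrite wfac_lt.
have [ac|ca] := ltnP a c; first by left; rewrite wfac_gt.
right; split=> //; split=> //; have [->|] := eqVneq b a.
  by exists (wfac x be P a a c d); rewrite subnn mul1r.
move=> ne; have [g [z [h _]]] := wspec_ex x be P a c d.
exists g; have e : b = (a + (b - a).-1.+1)%N by lia.
by rewrite {1}e h; congr (_ ^+ _ * _); lia.
Qed.

Lemma tr_supp P l s : strict_seq l -> strict_seq s -> tr x be P l s = 0 \/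
  (interl l s /\ (sumn s <= sumn l)%N /\ exists u, tr x be P l s = x ^+ (sumn l - sumn s) * u).
Proof.
elim: l s => [|b l IH] s ls ss /=.
  case: eqP => [->|_]; last by left.
  right; split=> [i|]; first by rewrite !nth_nil.
  by split=> //; exists 1; rewrite mulr1 subnn.
move: ls; rewrite strict_cons => /andP[_ ls].
have [->|[ab [ca [u ->]]]] := wfac_supp P b (hd s) (hd l) (hd (behead s)).
  by left; rewrite mul0r.
have [->|[il [sl [v ->]]]] := IH (behead s) ls (strict_behead ss); first by left; rewrite mulr0.
right; have es : sumn s = (hd s + sumn (behead s))%N by case: (s).
split; last split; first 1 last.
- by rewrite es leq_add.
- exists (u * v).
  have -> : (b + sumn l - sumn s = (b - hd s) + (sumn l - sumn (behead s)))%N by lia.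
  by rewrite exprD; ring.
case=> [|i] /=; first by rewrite !nth0.
by have := il i; rewrite !nth_behead.
Qed.

(** Extreme interlacing: each part of the smaller partition equals the next part of the larger one,
    so [wfac1] gives pure powers of [x], and only the new last row depends on [P]. *)
Lemma tr_top P b l : strict_seq (b :: l) ->
  tr x be P (b :: l) l = x ^+ b * (if P then 1 else 2 + be * x).
Proof.
elim: l b => [|c l IH] b; rewrite strict_cons => /andP[h ls].
  by case: b h => // b _; rewrite /= wfac_new // mulr1.
rewrite [LHS]/= -[wfac _ _ _ _ _ _ _ * _]/(wfac _ _ _ _ _ _ _ * tr x be P (c :: l) l) IH //.
have -> : b = (c + (b - c).-1.+1)%N by move: h => /=; lia.
rewrite wfac1; last by move: ls; rewrite strict_cons; case: (c).
by rewrite exprD; ring.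
Qed.

End TransferSupport.

Lemma sumn_nth_le l s : strict_seq l -> strict_seq s ->
  (forall i, nth 0 l i <= nth 0 s i)%N -> (sumn l <= sumn s)%N /\ (sumn s <= sumn l -> l = s)%N.
Proof.
elim: l s => [|b l IH] s ls ss h.
  split=> //; rewrite leqn0 => /eqP s0; case: s ss s0 {h} => // c s.
  by rewrite strict_cons /=; lia.
case: s ss h => [|c s] ss h.
  by exfalso; move: ls (h 0%N); rewrite strict_cons /=; lia.
move: ls ss; rewrite !strict_cons => /andP[_ ls] /andP[_ ss].
have [h1 h2] := IH s ls ss (fun i => h i.+1).
move: (h 0%N) => /= h0; split; first by lia.
by move=> h3; rewrite h2; [congr (_ :: _)|]; lia.
Qed.

(** The order in which the leading coefficients of branching are triangular. Size alone does not
    suffice, since other partitions of the same size can branch to the tail of [l0]. *)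
Definition lexlt (l l0 : seq nat) :=
  ((sumn l < sumn l0) || (sumn l == sumn l0) && (sumn (behead l) < sumn (behead l0)))%N.

Lemma lex_ind (Q : seq nat -> Prop) :
  (forall l0, strict_seq l0 -> (forall l, strict_seq l -> lexlt l l0 -> Q l) -> Q l0) ->
  forall l, strict_seq l -> Q l.
Proof.
(* As [sumn (behead s)] is at most [sumn s], this number encodes the lexicographic order. *)
move=> H l; pose f (s : seq nat) := (sumn s * (sumn s).+1 + sumn (behead s))%N.
have [n] := ubnP (f l); elim: n l => // n IH l lt ls; apply: H => // s ss sl.
apply: IH => //; apply: leq_trans (lt : (f l <= n)%N).
have hs : (sumn (behead s) <= sumn s)%N by case: (s) => //= b s'; exact: leq_addl.
rewrite /f; case/orP: sl => [h|/andP[/eqP-> h]]; last by rewrite ltn_add2l.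
have [k ->] : exists k, sumn l = (sumn s + k).+1.
  by exists (sumn l - (sumn s).+1)%N; lia.
by nia.
Qed.

Lemma lexlt_behead l : strict_seq l -> l != [::] -> lexlt (behead l) l.
Proof. by case: l => // b l; rewrite strict_cons /lexlt /= => /andP[h _] _; apply/orP; left; lia. Qed.

Lemma hd_le_sumn l : (hd l <= sumn l)%N.
Proof. by case: l => //= b l; exact: leq_addr. Qed.

(** * Branching and linear independence over Q[beta] *)

Local Notation R := {poly rat}.
Definition bR : R := 'X.
Definition qmap : {poly int} -> R := map_poly intr.
HB.instance Definition _ := GRing.RMorphism.on qmap.

Lemma qmap_beta : qmap beta = bR.
Proof. by rewrite /qmap map_polyX. Qed.

Lemma qmap_inj : injective qmap.
Proof. by apply: map_inj_poly => //; exact: intr_inj. Qed.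

Definition Gq P l m : R := qmap (GX P (mkp l) m).
Definition trQ P l s : {poly R} := tr 'X bR%:P P l s.

Lemma trQ_eq0 P j l s : strict_seq l -> strict_seq s -> (trQ P l s)`_j != 0 ->
  [/\ interl l s, (sumn s <= sumn l)%N & (sumn l <= sumn s + j)%N].
Proof.
move=> ls ss; have [e|[il [sl [u e]]]] := tr_supp 'X bR%:P P ls ss.
  by rewrite /trQ e coef0 eqxx.
move=> h; split=> //; rewrite leqNgt; apply: contra h => h.
by rewrite /trQ e coefXnM ifT //; lia.
Qed.

Lemma trQ_top P l : strict_seq l -> l != [::] ->
  (trQ P l (behead l))`_(hd l) = if P then 1 else 2.
Proof.
case: l => // b l ls _; rewrite /trQ tr_top //= coefXnM ltnn subnn.
case: P; first by rewrite coef1.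
by rewrite coefD coefCM coefX mulr0 addr0 -[2]/(2%:R) -polyC1 -polyCMn coefC.
Qed.

(** Interlacing puts the tail of [l] inside the tail of [l0], and the degree gives [|l| <= |l0|];
    equality in both forces [l = l0]. *)
Lemma trQ_lex P l l0 : strict_seq l -> strict_seq l0 -> l0 != [::] ->
  (trQ P l (behead l0))`_(hd l0) != 0 -> l = l0 \/ lexlt l l0.
Proof.
move=> ls l0s l0n /(trQ_eq0 ls (strict_behead l0s))[il _ sz].
have e (q : seq nat) : sumn q = (hd q + sumn (behead q))%N by case: q.
have [h1 h2] := @sumn_nth_le (behead l) (behead l0) (strict_behead ls) (strict_behead l0s)
  (fun i => ltac:(by rewrite nth_behead; case: (il i))).
have sz' : (sumn l <= sumn l0)%N by rewrite (e l0); lia.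
have [lt|ge] := ltnP (sumn (behead l)) (sumn (behead l0)).
  by right; rewrite /lexlt lt andbT; lia.
have [lt|ge'] := ltnP (sumn l) (sumn l0); first by right; rewrite /lexlt lt.
left; have eb := h2 ge; have eh : hd l = hd l0 by move: (e l) (e l0); rewrite eb; lia.
case: l l0 l0n l0s eb eh ls {il sz e h1 h2 sz' ge ge'} => [|b l] [|c l0] //= _ l0s eb eh.
  by move: l0s; rewrite strict_cons -eh ltn0.
by rewrite eb eh.
Qed.

Lemma R2 : (2 : R) != 0.
Proof. by rewrite -[2]/(2%:R) -polyC1 -polyCMn polyC_eq0. Qed.

(** The common last step of the vanishing arguments below: one equation, indexed by the tail and the
    first part of [l0], whose other unknowns are smaller than [l0]. *)
Lemma triangular P N l0 (c : seq nat -> R) : strict_seq l0 -> l0 != [::] -> (sumn l0 <= N)%N ->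
  \sum_(l <- sp N) (trQ P l (behead l0))`_(hd l0) * c l = 0 ->
  (forall l, strict_seq l -> lexlt l l0 -> (trQ P l (behead l0))`_(hd l0) != 0 -> c l = 0) ->
  c l0 = 0.
Proof.
move=> ls l0n lN + H; rewrite (@sp_sum1 _ _ l0) => [|| l]; first 1 last.
- by rewrite mem_sp ls (leq_trans (hd_le_sumn _)).
- rewrite mem_sp => /andP[ss _] ne.
  have [->|h] := eqVneq (trQ P l (behead l0))`_(hd l0) 0; first by rewrite mul0r.
  by rewrite H ?mulr0 //; have [e|//] := trQ_lex ss ls l0n h; rewrite e eqxx in ne.
rewrite trQ_top //; case: P {H} => /eqP; first by rewrite mul1r => /eqP.
by rewrite mulf_eq0 (negbTE R2) => /eqP.
Qed.

Definition supp_lt n (m : {cmonom nat}) := forall i, (n <= i)%N -> m i = 0%N.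

Lemma supp_lt_ex m : exists n, supp_lt n m.
Proof.
exists (\max_(i <- finsupp m) i).+1 => i h; apply/eqP; rewrite cmE_eq0; apply/negP => im.
by have := @leq_bigmax_seq _ (enum_fset (finsupp m)) xpredT (fun i => i) i im isT; rewrite leqNgt h.
Qed.

Lemma mon_split n m : supp_lt n.+1 m ->
  exists m', supp_lt n m' /\ m = (m' * ucmn n (m n))%M.
Proof.
move=> h; exists (divcm m (ucmn n (m n))); split.
  move=> i ni; rewrite divcmE ucmnE; case: eqP => [->|ne]; first by rewrite subnn.
  by rewrite h //; lia.
apply/eqP/cmP => i; rewrite cmM divcmE ucmnE; case: eqP => [->|_]; first by rewrite subnK.
by rewrite subn0 addn0.
Qed.

Lemma mdeg_ucmn i j : mdeg (ucmn i j : {cmonom nat}) = j.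
Proof. by elim: j => [|j IH] /=; rewrite ?mdeg1 // mdegM mdegU IH. Qed.

Lemma supp0 m : supp_lt 0 m -> m = 1%M.
Proof. by move=> h; apply/eqP/cmP => i; rewrite h // onecmE. Qed.

Lemma Gq_br P n l m j : strict_seq l -> supp_lt n m ->
  Gq P l (m * ucmn n j)%M = \sum_(s <- sp (hd l)) (trQ P l s)`_j * Gq P s m.
Proof.
move=> ls mn; rewrite /Gq branching // mkpK // rmorph_sum; apply: eq_big_seq => s.
rewrite mem_sp => /andP[ss _]; rewrite rmorphM; congr (_ * _).
transitivity ((map_poly qmap (trp P l s))`_j); first by rewrite coef_map.
by rewrite /trp tr_morph /= map_polyX map_polyC /= qmap_beta.
Qed.

Lemma Gq_one P l : strict_seq l -> Gq P l 1%M = (l == [::])%:R.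
Proof.
move=> ls; rewrite /Gq GX_one rmorph_nat; congr (_%:R); congr nat_of_bool.
by apply/eqP/eqP => [/(congr1 parts)|->]; rewrite ?mkpK //; apply: val_inj; exact: mkpK.
Qed.

Lemma Gq_deg P l m : strict_seq l -> (mdeg m < sumn l)%N -> Gq P l m = 0.
Proof.
have [n mn] := supp_lt_ex m; elim: n l m mn => [|n IH] l m mn ls h.
  by rewrite (supp0 mn) Gq_one //; case: l ls h => //; rewrite (supp0 mn) mdeg1.
have [m' [mn' me]] := mon_split mn; move: h; rewrite me mdegM mdeg_ucmn => h.
rewrite Gq_br // big_seq big1 // => s; rewrite mem_sp => /andP[ss _].
have [->|/(trQ_eq0 ls ss)[_ _ sz]] := eqVneq (trQ P l s)`_(m n) 0; first by rewrite mul0r.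
by rewrite IH ?mulr0 //; lia.
Qed.

Lemma Gq_widen P N m (c : seq nat -> R) : (mdeg m <= N)%N ->
  \sum_(l <- sp N) c l * Gq P l m = \sum_(l <- sp (mdeg m)) c l * Gq P l m.
Proof.
move=> h; apply: sp_widen => // l ls lt; rewrite Gq_deg ?mulr0 //.
exact: leq_trans lt (hd_le_sumn l).
Qed.

Lemma Gq_br_sum P n m j N (c : seq nat -> R) : supp_lt n m -> (mdeg m + j <= N)%N ->
  \sum_(l <- sp N) c l * Gq P l (m * ucmn n j)%M =
  \sum_(s <- sp (mdeg m)) (\sum_(l <- sp N) (trQ P l s)`_j * c l) * Gq P s m.
Proof.
move=> mn mN; rewrite -(Gq_widen P (N := N)); last by lia.
under [RHS]eq_bigr do rewrite mulr_suml.
rewrite exchange_big; apply: eq_big_seq => l; rewrite mem_sp => /andP[ls lN].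
rewrite Gq_br // -(sp_widen lN) ?mulr_sumr; last first.
  move=> s ss lt; have [->|/(trQ_eq0 ls ss)[il _ _]] := eqVneq (trQ P l s)`_j 0.
    by rewrite mul0r.
  by case: (il 0%N); rewrite !nth0; lia.
by apply: eq_bigr => s _; ring.
Qed.

Lemma trQ_widen P j s N (c : seq nat -> R) : strict_seq s -> (sumn s + j <= N)%N ->
  \sum_(l <- sp N) (trQ P l s)`_j * c l = \sum_(l <- sp (sumn s + j)) (trQ P l s)`_j * c l.
Proof.
move=> ss h; apply: sp_widen => // l ls lt.
have [->|/(trQ_eq0 ls ss)[_ _ sz]] := eqVneq (trQ P l s)`_j 0; first by rewrite mul0r.
by have := hd_le_sumn l; lia.
Qed.

(** The bound [D] covers series known to vanish only up to some degree. Taking the power [hd l0] of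
    a fresh variable lowers [D] by [hd l0], and the induction hypothesis at the tail of [l0] yields
    the equation required by [triangular]. *)
Theorem independence P l : strict_seq l -> forall D (c : seq nat -> R),
  (forall m, (mdeg m < D)%N -> \sum_(s <- sp (mdeg m)) c s * Gq P s m = 0) ->
  (sumn l < D)%N -> c l = 0.
Proof.
move: l; apply: lex_ind => l0 ls IH D c H lD.
have [l00|l0n] := eqVneq l0 [::].
  have := H 1%M; rewrite mdeg1 /= big_seq1 Gq_one //= mulr1 l00; apply.
  exact: leq_ltn_trans (leq0n _) lD.
have e : sumn l0 = (hd l0 + sumn (behead l0))%N by case: (l0).
apply: (@triangular P (sumn l0) l0 c) => //; last first.
  move=> l ls' lt _; apply: (IH l ls' lt D c H).
  by case/orP: lt => [h|/andP[/eqP h _]]; lia.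
have := IH _ (strict_behead ls) (lexlt_behead ls l0n) (D - hd l0)%N
  (fun s => \sum_(l <- sp (sumn s + hd l0)) (trQ P l s)`_(hd l0) * c l).
rewrite addnC -e; apply; last by lia.
move=> m mD; have [n mn] := supp_lt_ex m.
have := H (m * ucmn n (hd l0))%M; rewrite mdegM mdeg_ucmn => h.
rewrite -[RHS]h; last by lia.
rewrite Gq_br_sum //; apply: eq_big_seq => s; rewrite mem_sp => /andP[ss sm].
have [lt|le] := ltnP (mdeg m) (sumn s); first by rewrite Gq_deg // !mulr0.
by congr (_ * _); rewrite trQ_widen // leq_add2r.
Qed.

(** * The expansion of GQ in GP and structure constants *)

Lemma mtr_morph (S S' : comNzRingType) (f : {rmorphism S -> S'}) be mu la :
  f (mtr be mu la) = mtr (f be) mu la.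
Proof.
elim: mu la => [|m mu IH] la /=; first by rewrite rmorph_nat.
rewrite rmorphM IH; congr (_ * _); rewrite /mfac !rmorph_if rmorphM rmorph_if.
by rewrite rmorphN !rmorph1 rmorph0 rmorph_nat.
Qed.

Lemma trQ_hd P j l s : strict_seq l -> strict_seq s -> (hd l < hd s)%N -> (trQ P l s)`_j = 0.
Proof.
move=> ls ss lt; have [//|/(trQ_eq0 ls ss)[il _ _]] := eqVneq (trQ P l s)`_j 0.
by case: (il 0%N); rewrite !nth0; lia.
Qed.

Lemma intertwine_coef N mu rho j : strict_seq mu -> strict_seq rho ->
  (hd mu < N)%N -> (hd rho <= N)%N ->
  \sum_(la <- sp N) mtr bR mu la * (trQ true la rho)`_j =
  \sum_(s <- sp N) (trQ false mu s)`_j * mtr bR s rho.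
Proof.
move=> ms rs mN rN.
have /(congr1 (fun p : {poly R} => p`_j)) := intertwine 'X bR%:P ms rs mN rN.
rewrite !coef_sum => e; under eq_bigr do rewrite mulrC.
have h mu' la : mtr (bR%:P) mu' la = (mtr bR mu' la)%:P by rewrite mtr_morph.
under eq_bigr do rewrite -coefMC -h.
by rewrite e; apply: eq_bigr => s _; rewrite h coefCM mulrC.
Qed.

(** The variables are removed one at a time, and [intertwine_coef] carries [M] past each branching.
    The bound [hd l < N] is strict because [M] may lengthen the first row by one box. *)
Theorem GQ_GP l m N : strict_seq l -> (hd l < N)%N ->
  Gq false l m = \sum_(la <- sp N) mtr bR l la * Gq true la m.
Proof.
have [n mn] := supp_lt_ex m; elim: n l m mn N => [|n IH] l m mn N ls lN.
  rewrite (supp0 mn) Gq_one // (sp_sum1 (nil_sp N)) ?Gq_one //=.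
    case: l ls {lN} => [|b l] ls /=; first by rewrite mulr1.
    rewrite strict_cons in ls; rewrite mfac0 ?mul0r //; lia.
  by move=> s; rewrite mem_sp => /andP[ss _] /negbTE sn; rewrite Gq_one // sn mulr0.
have [m' [mn' ->]] := mon_split mn; move: (m n) => j {m mn}.
rewrite Gq_br // -(sp_widen (ltnW lN)); last first.
  by move=> s ss lt; rewrite trQ_hd // mul0r.
transitivity (\sum_(s <- sp N | (hd s <= hd l)%N) \sum_(rho <- sp N)
   (trQ false l s)`_j * mtr bR s rho * Gq true rho m').
  rewrite big_seq [RHS]big_seq_cond [RHS]big_mkcond [LHS]big_mkcond /=; apply: eq_bigr => s _.
  rewrite mem_sp; case: (boolP (strict_seq s)) => //= ss; case: leqP => //= sN.
  case: leqP => ll; last by rewrite trQ_hd // mul0r.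
  rewrite (IH _ _ mn' N) ?mulr_sumr //; last by lia.
  by apply: eq_bigr => rho _; rewrite mulrA.
have -> : \sum_(s <- sp N | (hd s <= hd l)%N) \sum_(rho <- sp N)
   (trQ false l s)`_j * mtr bR s rho * Gq true rho m' =
   \sum_(s <- sp N) \sum_(rho <- sp N) (trQ false l s)`_j * mtr bR s rho * Gq true rho m'.
  rewrite big_mkcond big_seq [RHS]big_seq; apply: eq_bigr => s; rewrite mem_sp => /andP[ss _].
  by case: leqP => // ll; rewrite big1 // => rho _; rewrite trQ_hd // !mul0r.
rewrite exchange_big.
transitivity (\sum_(la <- sp N) \sum_(rho <- sp N)
   mtr bR l la * (trQ true la rho)`_j * Gq true rho m'); last first.
  apply: eq_big_seq => la; rewrite mem_sp => /andP[las laN].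
  rewrite Gq_br // -(sp_widen laN) ?mulr_sumr; last first.
    by move=> s ss lt; rewrite trQ_hd // mul0r.
  by apply: eq_bigr => rho _; rewrite mulrA.
rewrite [RHS]exchange_big; apply: eq_big_seq => rho; rewrite mem_sp => /andP[rs rN].
by rewrite -!mulr_suml intertwine_coef.
Qed.

Section MonSplits.
Context {V : nmodType}.

Lemma splits_var n j (m : {cmonom nat}) (F : {cmonom nat} * {cmonom nat} -> V) : m n = 0%N ->
  \sum_(p <- splits (m * ucmn n j)%M) F p =
  \sum_(i < j.+1) \sum_(p <- splits m) F ((p.1 * ucmn n i)%M, (p.2 * ucmn n (j - i))%M).
Proof.
move=> mn; rewrite -(big_mkord xpredT (fun i => \sum_(p <- splits m)
   F ((p.1 * ucmn n i)%M, (p.2 * ucmn n (j - i))%M))) /index_iota subn0.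
rewrite -(big_allpairs_dep (h := fun i (p : {cmonom nat} * {cmonom nat}) =>
   ((p.1 * ucmn n i)%M, (p.2 * ucmn n (j - i))%M))).
have z d e : (d * e)%M = m -> d n = 0%N /\ e n = 0%N.
  by move=> de; move: mn; rewrite -de cmM => /eqP; rewrite addn_eq0 => /andP[/eqP-> /eqP->].
have inj d e i i' : (d * ucmn n i)%M = (e * ucmn n i')%M -> d n = 0%N -> e n = 0%N ->
    i = i' /\ d = e.
  move=> h d0 e0; have ii : i = i'.
    by have := congr1 (fun m : {cmonom nat} => m n) h; rewrite !cmM !ucmnE eqxx d0 e0.
  by split=> //; move: h; rewrite ii mulmC [(e * _)%M]mulmC => /mulm_inj.
apply: perm_big; apply: uniq_perm; first exact: fset_uniq.
  apply: allpairs_uniq_dep; first exact: iota_uniq.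
    by move=> i _; exact: fset_uniq.
  move=> u v /allpairsPdep[i [[d e] [_ hde ->]]] /allpairsPdep[i' [[d' e'] [_ hde' ->]]].
  move: hde hde'; rewrite !in_splits /= => /eqP de /eqP de' [h1 h2]; have [d0 e0] := z _ _ de; have [d0' e0'] := z _ _ de'.
  have [ii dd] := inj _ _ _ _ h1 d0 d0'; have [_ ee] := inj _ _ _ _ h2 e0 e0'.
  by rewrite ii dd ee.
case=> d e; rewrite in_splits; apply/eqP/allpairsPdep; rewrite [(d, e).1]/= [(d, e).2]/=.
  move=> h; have hi i : (d i + e i = m i + ucmn n j i)%N by rewrite -!cmM h.
  have hn : (d n + e n = j)%N by rewrite hi mn ucmnE eqxx.
  exists (d n), (divcm d (ucmn n (d n)), divcm e (ucmn n (e n))).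
  rewrite mem_iota in_splits; split; first by rewrite /= add0n ltnS -hn leq_addr.
    apply/cmP => i; rewrite /= cmM !divcmE !ucmnE; have := hi i; rewrite ucmnE.
    by case: eqP => [<-|_]; rewrite ?subnn ?mn // !subn0 addn0.
  have -> : (j - d n = e n)%N by rewrite -hn addKn.
  congr (_, _); apply/eqP/cmP => i; rewrite cmM divcmE ucmnE; case: eqP => [->|_];
    by rewrite ?subnK // subn0 addn0.
case=> i [[d' e'] [+ + [-> ->]]]; rewrite mem_iota in_splits /= => ij /eqP <-.
by apply/eqP/cmP => k; rewrite !cmM !ucmnE; case: eqP; lia.
Qed.

End MonSplits.

(** * Infinite expansions and their products *)

Definition GS P l : series nat R := Series (Gq P l).
(** The value of the infinite combination of the [G_l]: at a monomial, every partition with first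
    part beyond its degree contributes zero ([Gq_widen]). *)
Definition FS P (c : seq nat -> R) : series nat R :=
  Series (fun m => \sum_(l <- sp (mdeg m)) c l * Gq P l m).

Lemma FS_inj P c c' : FS P c = FS P c' -> forall l, strict_seq l -> c l = c' l.
Proof.
move=> e l ls; apply/eqP; rewrite -subr_eq0; apply/eqP.
apply: (@independence P l ls (sumn l).+1 (fun l => c l - c' l)) => // m _.
under eq_bigr do rewrite mulrBl.
rewrite sumrB; apply/eqP; rewrite subr_eq0; apply/eqP.
exact: (congr1 (fun f : series nat R => f m) e).
Qed.

Section Structure.
Variables (P : bool) (bb : seq nat -> seq nat -> seq nat -> R).
Hypothesis Hbb : forall mu nu, strict_seq mu -> strict_seq nu -> GS P mu * GS P nu = FS P (bb mu nu).

Lemma bb_size mu nu l : strict_seq mu -> strict_seq nu -> strict_seq l ->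
  (sumn l < sumn mu + sumn nu)%N -> bb mu nu l = 0.
Proof.
move=> ms ns ls lt; apply: (@independence P l ls (sumn mu + sumn nu)) => // m mD.
rewrite -[LHS]/(FS P (bb mu nu) m) -Hbb // scoefM big_seq big1 // => -[d e].
rewrite in_splits /= => /eqP de; rewrite -de mdegM in mD.
have [h|h] := ltnP (mdeg d) (sumn mu); first by rewrite Gq_deg ?mul0r.
by rewrite [Gq P nu e]Gq_deg ?mulr0 //; lia.
Qed.

Lemma lin_mul c ka : strict_seq ka ->
  FS P c * GS P ka = FS P (fun l => \sum_(nu <- sp (sumn l)) c nu * bb nu ka l).
Proof.
move=> ks; apply: seriesP => m; rewrite scoefM /=.
transitivity (\sum_(nu <- sp (mdeg m)) c nu * (GS P nu * GS P ka) m).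
  under [RHS]eq_bigr do rewrite scoefM mulr_sumr.
  rewrite exchange_big big_seq [RHS]big_seq; apply: eq_bigr => -[d e].
  rewrite in_splits /= => /eqP de; rewrite -(@Gq_widen _ (mdeg m)) ?mulr_suml.
    by apply: eq_bigr => nu _; rewrite mulrA.
  by rewrite -de mdegM leq_addr.
transitivity (\sum_(nu <- sp (mdeg m)) \sum_(l <- sp (mdeg m)) c nu * bb nu ka l * Gq P l m).
  apply: eq_big_seq => nu; rewrite mem_sp => /andP[ns _]; rewrite Hbb // /= mulr_sumr.
  by apply: eq_bigr => l _; rewrite mulrA.
rewrite exchange_big; apply: eq_big_seq => l; rewrite mem_sp => /andP[ls _].
have [lt|le] := ltnP (mdeg m) (sumn l).
  by rewrite Gq_deg // mulr0 big1 // => nu _; rewrite mulr0.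
rewrite -mulr_suml; congr (_ * _); apply: sp_widen => // nu ns lt.
rewrite bb_size ?mulr0 //; have := hd_le_sumn nu; lia.
Qed.

(** Both sides are the coefficient of [G_l] in [G_th G_s G_ka]. *)
Lemma bb_assoc th s ka l : strict_seq th -> strict_seq s -> strict_seq ka -> strict_seq l ->
  \sum_(nu <- sp (sumn l)) bb th s nu * bb nu ka l =
  \sum_(nu <- sp (sumn l)) bb th ka nu * bb nu s l.
Proof.
move=> ts ss ks ls.
pose c1 l := \sum_(nu <- sp (sumn l)) bb th s nu * bb nu ka l.
pose c2 l := \sum_(nu <- sp (sumn l)) bb th ka nu * bb nu s l.
apply: (@FS_inj P c1 c2) => //; rewrite /c1 /c2 -!lin_mul // -!Hbb //.
by rewrite -!mulrA [GS P s * _]mulrC.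
Qed.

(** Two ways to take the [j]-th power of a fresh variable in [G_mu G_nu]: branch both factors, or
    expand the product and branch every term. *)
Lemma bb_branch mu nu rho j : strict_seq mu -> strict_seq nu -> strict_seq rho ->
  \sum_(s <- sp (hd mu)) \sum_(u <- sp (hd nu)) (trQ P mu s * trQ P nu u)`_j * bb s u rho =
  \sum_(l <- sp (sumn rho + j)) (trQ P l rho)`_j * bb mu nu l.
Proof.
move=> ms ns rs.
pose c1 rho := \sum_(s <- sp (hd mu)) \sum_(u <- sp (hd nu))
  (trQ P mu s * trQ P nu u)`_j * bb s u rho.
pose c2 rho := \sum_(l <- sp (sumn rho + j)) (trQ P l rho)`_j * bb mu nu l.
apply: (@FS_inj P c1 c2) => //; apply: seriesP => m; have [n mn] := supp_lt_ex m.
transitivity ((GS P mu * GS P nu) (m * ucmn n j)%M); last first.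
  rewrite Hbb //= mdegM mdeg_ucmn Gq_br_sum //; apply: eq_big_seq => s.
  rewrite mem_sp => /andP[ss _].
  have [lt|le] := ltnP (mdeg m) (sumn s); first by rewrite Gq_deg // !mulr0.
  by congr (_ * _); rewrite trQ_widen // leq_add2r.
rewrite scoefM splits_var; last exact: mn.
transitivity (\sum_(s <- sp (hd mu)) \sum_(u <- sp (hd nu))
   (trQ P mu s * trQ P nu u)`_j * (GS P s * GS P u) m).
  rewrite [LHS]/= /c1; under eq_bigr do rewrite mulr_suml.
  rewrite exchange_big; apply: eq_big_seq => s; rewrite mem_sp => /andP[ss _].
  under eq_bigr do rewrite mulr_suml.
  rewrite exchange_big; apply: eq_big_seq => u; rewrite mem_sp => /andP[us _].
  by rewrite Hbb //= mulr_sumr; apply: eq_bigr => l _; rewrite mulrA.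
transitivity (\sum_(p <- splits m) \sum_(i < j.+1)
   Gq P mu (p.1 * ucmn n i)%M * Gq P nu (p.2 * ucmn n (j - i))%M); last first.
  by rewrite exchange_big.
under eq_bigr => s _ do under eq_bigr => u _ do rewrite scoefM mulr_sumr.
under eq_bigr => s _ do rewrite exchange_big.
rewrite exchange_big big_seq [RHS]big_seq; apply: eq_bigr => -[d e].
rewrite in_splits /= => /eqP de.
have dn : supp_lt n d by move=> i /mn; rewrite -de cmM; lia.
have en : supp_lt n e by move=> i /mn; rewrite -de cmM; lia.
transitivity (\sum_(i < j.+1) \sum_(s <- sp (hd mu)) \sum_(u <- sp (hd nu))
   ((trQ P mu s)`_i * Gq P s d) * ((trQ P nu u)`_(j - i) * Gq P u e)).
  rewrite [RHS]exchange_big; apply: eq_bigr => s _; rewrite [RHS]exchange_big.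
  apply: eq_bigr => u _.
  by rewrite coefM mulr_suml; apply: eq_bigr => i _; ring.
apply: eq_bigr => i _; rewrite !Gq_br // mulr_suml; apply: eq_bigr => s _.
by rewrite mulr_sumr.
Qed.

End Structure.

(** * Containment *)

Section IncHead.
Context {S : comNzRingType} (x be : S).

(** In a row that has already grown, one more box at the end can hold nothing but the unprimed
    letter. *)
Lemma wfac_inc P a b c d : (a < b)%N -> wfac x be P b.+1 a c d = x * wfac x be P b a c d.
Proof.
move=> ab; have [g [z [h _]]] := wspec_ex x be P a c d.
have e : b = (a + (b - a).-1.+1)%N by lia.
have e' : b.+1 = (a + (b - a).-1.+2)%N by lia.
by rewrite {1}e' {2}e !h [in LHS]exprS mulrA.
Qed.

(** For [b = a] the added box may hold [{n}], as in [wfac_inc], but also [{n'}] or [{n', n}]; the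
    latter two give [x * (1 + be * x)]. *)
Lemma wfac_diag P a c d : (0 < a)%N -> (c < a)%N ->
  wfac x be P a.+1 a c d = x * wfac x be P a a c d + x * (1 + be * x).
Proof.
move=> a0 ca; rewrite /wfac /hfac leqnn leqnSn ltnn subSnn subnn /vfac eqxx.
have -> : (P && (a == 0%N)) = false by case: (P); lia.
have -> : (a.+1 == a) = false by lia.
have -> : (c == 0%N) || (c < a)%N by lia.
have -> : (c == 0%N) || (c < a.+1)%N by lia.
have -> : (a == a.+1) = false by lia.
rewrite /= ?expr1 ?expr0 ?subnn ?eqxx; do 6? [case: ifP => ?; try (exfalso; lia)]; ring.
Qed.

Lemma tr_inc P b l s : (hd s < b)%N -> tr x be P (b.+1 :: l) s = x * tr x be P (b :: l) s.
Proof. by move=> h; rewrite /= wfac_inc // mulrA. Qed.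

Lemma tr_diag P b l s : (hd s = b)%N -> strict_seq (b :: l) ->
  tr x be P (b.+1 :: l) s =
  x * tr x be P (b :: l) s + x * (1 + be * x) * tr x be P l (behead s).
Proof.
move=> sb; rewrite strict_cons => /andP[lb _]; rewrite /= sb wfac_diag; [|lia..].
by ring.
Qed.

End IncHead.

Definition inc (l : seq nat) := (hd l).+1 :: behead l.
(** Transports a coefficient function along the first row. The value is [0] where the shortened
    first row would not exceed the second one, in particular where it would become empty. *)
Definition dech (d : seq nat -> R) (l : seq nat) :=
  if (hd (behead l) < (hd l).-1)%N then d ((hd l).-1 :: behead l) else 0.

Lemma sum_dech M (A d : seq nat -> R) :
  \sum_(l <- sp M.+1) A l * dech d l =
  \sum_(l <- sp M) (if l == [::] then 0 else A (inc l) * d l).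
Proof.
rewrite !sp_split big_ord_recl /= big_seq1 /dech /= !mulr0 !add0r.
apply: eq_bigr => q _; rewrite /bump [(1 + q)%N]/= (@sp_widen _ q q.+1) //; last first.
  by move=> l _ lt; rewrite ltnNge lt mulr0.
apply: eq_big_seq => l; rewrite mem_sp => /andP[_ lq]; rewrite /inc /=.
by rewrite ltnS lq.
Qed.

Lemma Gq_nil m : Gq false [::] m = (m == 1%M)%:R.
Proof.
have [n mn] := supp_lt_ex m; elim: n m mn => [|n IH] m mn.
  by rewrite (supp0 mn) Gq_one // !eqxx.
have [m' [mn' me]] := mon_split mn; rewrite me Gq_br //= big_seq1 /trQ /= coef1 IH //.
rewrite -natrM mulnb; congr (_%:R); congr nat_of_bool.
by rewrite cmM_eq1 andbC -[ucmn n (m n) == 1%M]mdeg_eq0 mdeg_ucmn.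
Qed.

Lemma sum_ord_one (V : nmodType) (F : nat -> V) K M : (M < K)%N ->
  (forall q, q != M -> F q = 0) -> \sum_(q < K) F q = F M.
Proof.
move=> MK F0; rewrite (bigD1 (Ordinal MK)) //= big1 ?addr0 // => q.
by rewrite -val_eqE /=; exact: F0.
Qed.

Lemma hd2_sumn l : strict_seq l -> l != [::] ->
  (hd (behead l) + hd (behead l) < sumn l)%N.
Proof.
case: l => [|b l] //; rewrite strict_cons => /andP[h _] _ /=.
by have := hd_le_sumn l; lia.
Qed.

(** * Products with a single row, then arbitrary products *)

Section Containment.
Variable bb : seq nat -> seq nat -> seq nat -> R.
Hypothesis Hbb : forall mu nu, strict_seq mu -> strict_seq nu ->
  GS false mu * GS false nu = FS false (bb mu nu).
Local Notation A j l s := ((trQ false l s)`_j).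
Local Notation t := (bR%:P * 'X : {poly R}).

Lemma strict1 n : (0 < n)%N -> strict_seq [:: n].
Proof. by move=> n0; rewrite strict_cons n0. Qed.

Lemma bb_nil s l : strict_seq s -> strict_seq l -> bb [::] s l = (l == s)%:R.
Proof.
move=> ss ls; apply: (@FS_inj false (bb [::] s) (fun l => (l == s)%:R)) => //.
rewrite -Hbb //; have -> : GS false [::] = 1 by apply: seriesP => m; rewrite /= Gq_nil.
rewrite mul1r; apply: seriesP => m /=.
have [lt|le] := ltnP (mdeg m) (sumn s).
  rewrite Gq_deg // big_seq big1 // => l' _.
  by case: eqP => [->|]; rewrite ?mul0r // Gq_deg // mulr0.
rewrite (sp_sum1 (l0 := s)) ?eqxx ?mul1r //.
  by rewrite mem_sp ss (leq_trans (hd_le_sumn s)).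
by move=> l' _ /negbTE->; rewrite mul0r.
Qed.

(** The part of [bb_branch] for a product with [GQ_n] that depends on [n]. *)
Definition Wrow n s rho : {poly R} :=
  \sum_(u <- sp n) trQ false [:: n] u * (bb s u rho)%:P.

(** The summands for the empty [u] and for [u = (q)] with [q < n] gain exactly a factor ['X] when
    [n] grows, so they cancel; only [q = n] and [q = n + 1] are left. *)
Lemma Wrow_diff n s rho : (0 < n)%N -> Wrow n.+1 s rho - 'X * Wrow n s rho =
  (1 + t) ^+ 2 * (bb s [:: n.+1] rho)%:P + (1 + t) * 'X * (bb s [:: n] rho)%:P.
Proof.
move=> n0.
have z k q u : u != [::] -> trQ false [:: k] (q :: u) = 0 by case: u => // *; rewrite /trQ /= mulr0.
have W k : (0 < k)%N -> Wrow k s rho = 'X ^+ k * (2 + t) * (bb s [::] rho)%:P +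
   \sum_(q < k) wfac 'X bR%:P false k q.+1 0 0 * (bb s [:: q.+1] rho)%:P.
  move=> k0; rewrite /Wrow sp_split; congr (_ + _).
    by case: k k0 => // k _; rewrite /trQ /= wfac_new // mulr1.
  apply: eq_bigr => q _; rewrite (sp_sum1 (nil_sp q)); first by rewrite /trQ /= mulr1.
  by move=> u _ un; rewrite z // mul0r.
case: n n0 W => // n _ W; rewrite !W // exprS !big_ord_recr.
rewrite [nat_of_ord _]/= [nat_of_ord _]/= !wfac4e //; last by case: (n).
have -> : wfac 'X bR%:P false n.+2 n.+1 0 0 = 'X * ((1 + t) * (2 + t)).
  by rewrite -addn1 wfac4 ?expr1 //; case: (n).
have -> : \sum_(q < n) wfac 'X bR%:P false n.+2 q.+1 0 0 * (bb s [:: q.+1] rho)%:P =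
  'X * \sum_(q < n) wfac 'X bR%:P false n.+1 q.+1 0 0 * (bb s [:: q.+1] rho)%:P.
  by rewrite mulr_sumr; apply: eq_bigr => q _; rewrite wfac_inc ?mulrA // ltnS ltn_ord.
move: ('X ^+ n.+1) => Y /=.
by ring.
Qed.

Lemma Wrow_sum nu n rho j : strict_seq nu -> strict_seq rho -> (0 < n)%N ->
  (\sum_(s <- sp (hd nu)) trQ false nu s * Wrow n s rho)`_j =
  \sum_(l <- sp (sumn rho + j)) A j l rho * bb nu [:: n] l.
Proof.
move=> ns rs n0; rewrite -(bb_branch Hbb j ns (strict1 n0) rs) coef_sum; apply: eq_bigr => s _.
by rewrite /Wrow mulr_sumr coef_sum; apply: eq_bigr => u _; rewrite mulrA coefMC.
Qed.

(** The branching equation for [n.+1] minus ['X] times the one for [n]. By [tr_inc] the terms of the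
    second sum with [hd rho < hd l] vanish. *)
Lemma telescope nu rho n j : strict_seq nu -> strict_seq rho -> (0 < n)%N ->
  \sum_(l <- sp (sumn rho + j).+1) A j.+1 l rho * (bb nu [:: n.+1] l - dech (bb nu [:: n]) l) +
  \sum_(l <- sp (sumn rho + j)) (if l == [::] then 0 else
      (A j.+1 (inc l) rho - A j l rho) * bb nu [:: n] l) =
  (\sum_(s <- sp (hd nu)) trQ false nu s *
    ((1 + t) ^+ 2 * (bb s [:: n.+1] rho)%:P + (1 + t) * 'X * (bb s [:: n] rho)%:P))`_j.+1.
Proof.
move=> ns rs n0.
under [in RHS]eq_bigr do rewrite -Wrow_diff // mulrBr mulrCA.
rewrite sumrB coefB -mulr_sumr coefXM /= !Wrow_sum // addnS.
under eq_bigr do rewrite mulrBr.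
rewrite sumrB sum_dech -addrA; congr (_ + _); rewrite addrC -sumrB.
(* [sum_dech] omits the empty partition; its structure constant is zero by degree because
   [n > 0]. *)
rewrite -sumrN; apply: eq_bigr => l _; case: eqP => [->|_].
  by rewrite subr0 (bb_size Hbb) ?mulr0 ?oppr0 ?strict1 //= addn0; lia.
by ring.
Qed.

(** The difference of both sides solves a triangular system, namely [telescope] with the tail of
    [l0] as [rho]. Its remaining terms vanish by degree or are one-row constants at smaller
    partitions whose first part is below the row, which [IH0] annihilates. *)
Lemma bb_row_shift l0 : strict_seq l0 -> l0 != [::] -> forall nu n, strict_seq nu ->
  (hd (behead l0) < n)%N -> bb nu [:: n.+1] l0 = dech (bb nu [:: n]) l0.
Proof.
move: l0; apply: lex_ind => l0 ls IH l0n nu n ns hn.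
(* Each shift shortens both [k] and the first part of [l], until the shortened partition ceases to
   be strict and [dech] returns [0]. *)
have IH0 l k nu' : strict_seq l -> lexlt l l0 -> strict_seq nu' -> (hd l < k)%N ->
    bb nu' [:: k] l = 0.
  elim: k l => // k IHk l ls' lt ns' lk.
  have [l00|ln] := eqVneq l [::].
    by rewrite (bb_size Hbb) // l00 /=; lia.
  have l1 : (0 < hd l)%N by rewrite lt0n; apply: contra ln => /eqP/(strict_hd0 ls') ->.
  rewrite (IH l ls' lt ln) //; last by have := strict_hd_behead ls'; lia.
  rewrite /dech; case: ifP => // h; case: l ls' lt ln lk h {l1} => //= b l ls' lt _ lk h.
  apply: IHk => //=; last by lia.
    by rewrite strict_cons h; move: ls'; rewrite strict_cons => /andP[].
  by move: lt; rewrite /lexlt /=; lia.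
have e : sumn l0 = (sumn (behead l0) + (hd l0).-1.+1)%N.
  by case: (l0) ls l0n => //= b l; rewrite strict_cons => /andP[h _] _; lia.
have h0 : (hd l0).-1.+1 = hd l0.
  by case: (l0) ls l0n => //= b l; rewrite strict_cons => /andP[h _] _; lia.
apply/eqP; rewrite -subr_eq0; apply/eqP.
apply: (@triangular false (sumn l0) l0 (fun l => bb nu [:: n.+1] l - dech (bb nu [:: n]) l)) => //.
  have n0 : (0 < n)%N by lia.
  have := telescope (hd l0).-1 ns (strict_behead ls) n0.
  rewrite -addnS -e h0 [X in _ + X]big_seq [X in _ + X]big1 ?addr0 => [->|l]; last first.
    rewrite mem_sp => /andP[ls' _]; case: eqP => // /eqP ln.
    have [lt|le] := ltnP (hd (behead l0)) (hd l).
      have -> : A (hd l0) (inc l) (behead l0) = A (hd l0).-1 l (behead l0).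
        rewrite -{1}h0; case: (l) ln lt => // b l' _ lt.
        by rewrite -[inc _]/(b.+1 :: l') /trQ tr_inc // coefXM.
      by rewrite subrr mul0r.
    have [lt|ge] := ltnP (sumn l) (sumn l0).
      by rewrite IH0 ?mulr0 // ?/lexlt ?lt //; lia.
    have -> : A (hd l0).-1 l (behead l0) = 0.
      have [//|/(trQ_eq0 ls' (strict_behead ls))[_ _ sz]] := eqVneq (A (hd l0).-1 l (behead l0)) 0.
      by lia.
    have -> : A (hd l0) (inc l) (behead l0) = 0.
      have is' : strict_seq (inc l).
        by case: (l) ls' ln => //= b l'; rewrite /inc !strict_cons /= => /andP[h ->] _; lia.
      have [//|/(trQ_eq0 is' (strict_behead ls))[_ _ sz]] := eqVneq (A (hd l0) (inc l) (behead l0)) 0.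
      have : sumn (inc l) = (sumn l).+1 by case: (l) ln.
      by lia.
    by rewrite subrr mul0r.
  rewrite coef_sum big_seq big1 // => s; rewrite mem_sp => /andP[ss _].
  by rewrite !IH0 ?strict_behead ?lexlt_behead ?polyC0 ?mulr0 ?addr0 ?mulr0 ?coef0 //; lia.
move=> l ls' lt /(trQ_eq0 ls' (strict_behead ls))[il _ _].
have [->|ln] := eqVneq l [::].
  by rewrite (bb_size Hbb) ?strict1 //= ?addn1 /dech /=; [rewrite subrr|lia].
rewrite (IH l ls' lt ln) ?subrr //; case: (il 0%N) => _; rewrite !nth0 -nth_behead nth0 => h.
exact: leq_ltn_trans h hn.
Qed.

Lemma bb_row_lt n l nu : strict_seq l -> strict_seq nu -> (hd l < n)%N -> bb nu [:: n] l = 0.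
Proof.
move=> ls ns; elim: n l ls => // k IHk l ls' lk.
have [l00|ln] := eqVneq l [::].
  by rewrite (bb_size Hbb) // l00 /=; lia.
have l1 : (0 < hd l)%N by rewrite lt0n; apply: contra ln => /eqP/(strict_hd0 ls') ->.
rewrite (bb_row_shift ls' ln) //; last by have := strict_hd_behead ls'; lia.
rewrite /dech; case: ifP => // h; case: l ls' ln lk h {l1} => //= b l ls' _ lk h.
apply: IHk => //=; last by lia.
by rewrite strict_cons h; move: ls'; rewrite strict_cons => /andP[].
Qed.

(** The row shift replaces [m] by a large [M.+1]. There [telescope] at [M.+1 :: rp] becomes, up to a
    factor [1 + t], a branching relation for the deviation [L] from the claimed value. *)
Lemma bb_row_top l0 : strict_seq l0 -> forall m nu, strict_seq nu -> (hd l0 < m)%N ->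
  bb nu [:: m] (m :: l0) = (l0 == nu)%:R.
Proof.
move: l0; apply: lex_ind => l0 ls IH m nu ns lm.
have sm k l : strict_seq l -> (hd l < k)%N -> strict_seq (k :: l).
  by move=> ls' lk; rewrite strict_cons lk.
have shift l k k' : strict_seq l -> (hd l < k)%N -> (k <= k')%N ->
    bb nu [:: k'] (k' :: l) = bb nu [:: k] (k :: l).
  move=> ls' lk /subnKC <-; elim: (k' - k)%N => [|i IHi]; rewrite ?addn0 // addnS.
  rewrite bb_row_shift ?sm //=; try lia.
  by rewrite /dech /= ifT //; lia.
have [l00|l0n] := eqVneq l0 [::].
  rewrite l00; have [<-|nn] := eqVneq [::] nu.
    by rewrite bb_nil ?strict1 ?eqxx //; lia.
  rewrite (bb_size Hbb) ?strict1 //=; try lia.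
  have : (0 < hd nu)%N by rewrite lt0n; apply: contra nn => /eqP/(strict_hd0 ns) ->.
  by have := hd_le_sumn nu; lia.
have e : sumn l0 = (sumn (behead l0) + hd l0)%N by case: (l0) => //= *; rewrite addnC.
pose rp := behead l0; have rps : strict_seq rp := strict_behead ls.
(* With [M] this large, the second part of every partition that contributes stays below [M.+1], so
   [bb_row_shift] annihilates the first sum of [telescope]. *)
have [M hM] : exists M, (sumn l0 + m < M)%N by exists (sumn l0 + m).+1.
pose L l := bb nu [:: M.+1] (M.+1 :: l) - (l == nu)%:R.
suff L0 : L l0 = 0.
  rewrite -(shift l0 m M.+1) //; last by lia.
  by move/eqP: L0; rewrite /L subr_eq0 => /eqP.
have rN : (hd rp < M.+1)%N by have := hd_le_sumn rp; rewrite /rp; lia.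
have S0 j : (j <= hd l0)%N -> \sum_(l <- sp M) A j l rp * L l = 0.
  move=> jl.
  (* The factor [1 + t] stems from [tr_diag]; having constant term one, it is removed afterwards by
     induction on the degree [j]. *)
  have step i : (i <= hd l0)%N ->
      \sum_(l <- sp M) ((1 + t) * trQ false l rp)`_i * L l = 0.
    move=> il; have Ns : strict_seq (M.+1 :: rp) by rewrite sm.
    have := telescope i ns Ns (isT : (0 < M.+1)%N).
    rewrite big_seq big1 ?add0r; last first.
      move=> l; rewrite mem_sp => /andP[ls' _].
      have [->|nz] := eqVneq (A i.+1 l (M.+1 :: rp)) 0; first by rewrite mul0r.
      have [il1 _ sz] := trQ_eq0 ls' Ns nz.
      have [->|ln] := eqVneq l [::].
        by rewrite (bb_size Hbb) ?strict1 //= ?/dech ?subrr ?mulr0 //; lia.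
      rewrite bb_row_shift ?subrr ?mulr0 //.
      have := hd2_sumn ls' ln; move: sz; rewrite [sumn (_ :: _)]/= /rp.
      by lia.
    (* The constants with [M.+2] vanish by [bb_row_lt], and the induction hypothesis at [rp] leaves
       only [s = rp] in the rest. *)
    rewrite (_ : \sum_(s <- sp (hd nu)) _ = (1 + t) * 'X * trQ false nu rp); last first.
      transitivity (\sum_(s <- sp (hd nu)) (1 + t) * 'X * trQ false nu s * (rp == s)%:R).
        apply: eq_big_seq => s; rewrite mem_sp => /andP[ss _].
        rewrite [bb s [:: M.+2] _]bb_row_lt // polyC0 mulr0 add0r.
        rewrite (IH rp rps (lexlt_behead ls l0n) M.+1 s ss rN) polyCMn polyC1; ring.
      have [lt|ge] := ltnP (hd nu) (hd rp).
        have -> : trQ false nu rp = 0 by apply/polyP => k; rewrite trQ_hd // coef0.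
        rewrite mulr0 big_seq big1 // => s; rewrite mem_sp => /andP[ss sn].
        case: eqP => [e'|_]; last by rewrite mulr0.
        by rewrite -e' leqNgt lt in sn.
      rewrite (sp_sum1 (l0 := rp)) ?mem_sp ?rps ?ge ?eqxx ?mulr1 //.
      by move=> s _; rewrite eq_sym => /negbTE->; rewrite mulr0.
    rewrite -mulrAC coefMX -[_ == 0%N]/false.
    (* Only first part [M.+1] contributes: below it the constants vanish by [bb_row_lt], above it
       the two coefficients cancel by [tr_inc]. *)
    have -> : (\sum_(l <- sp (sumn (M.+1 :: rp) + i)) (if l == [::] then 0 else
        (A i.+1 (inc l) (M.+1 :: rp) - A i l (M.+1 :: rp)) * bb nu [:: M.+1] l)) =
      \sum_(l <- sp M) ((1 + t) * trQ false l rp)`_i * bb nu [:: M.+1] (M.+1 :: l).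
      have E (q : nat) l : ((q.+1 :: l) == [::]) = false by [].
      rewrite sp_split eqxx add0r.
      have NK : (M < sumn (M.+1 :: rp) + i)%N by rewrite /=; lia.
      rewrite (@sum_ord_one _ (fun q => \sum_(l <- sp q) (if q.+1 :: l == [::] then 0 else
          (A i.+1 (inc (q.+1 :: l)) (M.+1 :: rp) - A i (q.+1 :: l) (M.+1 :: rp)) *
          bb nu [:: M.+1] (q.+1 :: l))) _ M) //.
        apply: eq_big_seq => l; rewrite mem_sp => /andP[ls' lN]; rewrite ?E.
        congr (_ * _); rewrite -[inc _]/(M.+2 :: l) /trQ tr_diag ?sm //.
        by rewrite coefD coefXM -[_ == 0%N]/false addrAC subrr add0r -mulrA coefXM.
      move=> q qN; rewrite big_seq big1 // => l.
      rewrite mem_sp => /andP[ls' lq]; rewrite ?E.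
      have [lt|ge] := ltnP q.+1 M.+1.
        by rewrite [bb _ _ _]bb_row_lt ?mulr0 ?sm.
      rewrite -[inc _]/(q.+2 :: l) /trQ tr_inc ?coefXM -?[_ == 0%N]/false ?subrr ?mul0r //.
      by move: qN ge => /=; lia.
    move=> h; under eq_bigr do rewrite mulrBr.
    rewrite sumrB h; apply/eqP; rewrite subr_eq0; apply/eqP.
    have [nN|nN] := boolP (nu \in sp M).
      rewrite (sp_sum1 nN) ?eqxx ?mulr1 // => l _ /negbTE->; exact: mulr0.
    rewrite big_seq big1 => [|l lN]; last first.
      case: eqP => [e'|_]; last by rewrite mulr0.
      by rewrite -e' lN in nN.
    have z k : (k <= hd l0)%N -> A k nu rp = 0.
      move=> kl; have [//|/(trQ_eq0 ns rps)[_ _ sz]] := eqVneq (A k nu rp) 0.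
      have := hd_le_sumn nu; move: nN; rewrite mem_sp ns /= -ltnNge.
      by rewrite /rp in sz; lia.
    rewrite mulrDl mul1r coefD z // add0r -mulrA coefCM coefXM.
    by case: eqP => _; rewrite ?mulr0 // z ?mulr0 //; lia.
  elim: j jl => [|j IHj] jl.
    rewrite -[RHS](step 0%N) //; apply: eq_bigr => l _.
    by rewrite mulrDl mul1r coefD -mulrA coefCM coefXM /= mulr0 addr0.
  have := step j.+1 jl; under eq_bigr do rewrite mulrDl mul1r coefD -mulrA coefCM coefXM /= mulrDl.
  rewrite big_split /=; under [X in _ + X]eq_bigr do rewrite -mulrA.
  by rewrite -mulr_sumr IHj ?mulr0 ?addr0 // ltnW.
apply: (@triangular false M l0 L) => //; first by lia.
  exact: S0.
move=> l ls' lt _; rewrite /L (IH l ls' lt M.+1 nu ns) ?subrr //.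
have := hd_le_sumn l; case/orP: lt => [h|/andP[/eqP h _]]; lia.
Qed.

(** Write [nu = (s, u)]. In [GQ_u GQ_s] the only term with first part at most [s] is [GQ_nu], so
    multiplying by [GQ_ka] and reassociating leaves only constants with a larger first part, treated
    by induction on [|l| - hd nu], and one-row constants that vanish by [bb_row_lt]. *)
Lemma bb_hd nu ka l : strict_seq nu -> strict_seq ka -> strict_seq l ->
  (hd l < hd nu)%N -> bb nu ka l = 0.
Proof.
move=> + ks ls; have [k] := ubnP (sumn l - hd nu)%N.
elim: k nu => // k IH nu hk ns lt.
have [sz|sz] := ltnP (sumn l) (sumn nu); first by rewrite (bb_size Hbb) //; lia.
case: nu ns hk lt sz => // s u su hk lt sz; have := su; rewrite strict_cons => /andP[us u0].
have s0 : (0 < s)%N by lia.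
have := bb_assoc Hbb u0 (strict1 s0) ks ls.
rewrite [RHS]big_seq [RHS]big1; last first.
  by move=> p; rewrite mem_sp => /andP[ps _]; rewrite [X in _ * X]bb_row_lt ?mulr0.
rewrite (sp_sum1 (l0 := s :: u)) ?bb_row_top ?eqxx ?mul1r //.
  by rewrite mem_sp su /=; apply: leq_trans sz => /=; exact: leq_addr.
move=> v; rewrite mem_sp => /andP[vs vl] vn.
have [h|h|h] := ltngtP (hd v) s.
- by rewrite bb_row_lt ?mul0r.
- rewrite [X in _ * X]IH ?mulr0 //; first by move: hk h vl => /=; lia.
  by move: lt h => /=; lia.
case: v vs vl vn h => [|c v] vs vl vn /= h; first by lia.
rewrite h in vs vn *; rewrite bb_row_top //; [|by move: vs; rewrite strict_cons => /andP[]..].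
have -> : (v == u) = false by apply/negbTE; apply: contra vn => /eqP->.
by rewrite mul0r.
Qed.

Theorem bb_contain k nu ka l : strict_seq nu -> strict_seq ka -> strict_seq l ->
  (nth 0%N l k < nth 0%N nu k)%N -> bb nu ka l = 0.
Proof.
elim: k nu ka l => [|k IHk] nu ka l ns ks; first by rewrite !nth0; exact: bb_hd.
move: l; apply: lex_ind => l0 ls IH lt.
have [l00|l0n] := eqVneq l0 [::].
  rewrite (bb_size Hbb) // l00 /=.
  case: nu ns lt {IH} => [|b nu]; first by rewrite !nth_nil.
  by rewrite strict_cons /= => /andP[]; lia.
have e : sumn l0 = (sumn (behead l0) + hd l0)%N by case: (l0) => //= *; rewrite addnC.
apply: (@triangular false (sumn l0) l0 (bb nu ka)) => //.
  rewrite e -(bb_branch Hbb _ ns ks (strict_behead ls)) big_seq big1 // => s.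
  rewrite mem_sp => /andP[ss _]; rewrite big_seq big1 // => u; rewrite mem_sp => /andP[us _].
  have [z|il] := tr_supp 'X bR%:P false ns ss; first by rewrite /trQ z mul0r coef0 mul0r.
  (* Interlacing gives [nth nu k.+1 <= nth s k], so [s] violates containment in the tail of [l0]
     already at position [k]. *)
  rewrite IHk ?mulr0 ?strict_behead // nth_behead; case: il => il _.
  by have [_ h] := il k; apply: leq_trans h.
move=> l ls' lx /(trQ_eq0 ls' (strict_behead ls))[il _ _]; apply: IH => //.
by have [_ h] := il k; rewrite nth_behead in h; apply: leq_ltn_trans h lt.
Qed.

End Containment.

(** * Strips, columns and overlaps *)

Lemma mtr_supp be mu la : strict_seq mu -> strict_seq la -> mtr (be : R) mu la != 0 ->
  size la = size mu /\ forall i, (nth 0 mu i <= nth 0 la i <= (nth 0 mu i).+1)%N.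
Proof.
elim: mu la => [|m mu IH] la ms ls /=.
  case: (la =P [::]) => [->|_]; last by rewrite eqxx.
  by move=> _; split=> // i; rewrite nth_nil.
move: ms; rewrite strict_cons => /andP[hm ms]; rewrite mulf_eq0 negb_or => /andP[h1 h2].
have [sz h] := IH _ ms (strict_behead ls) h2.
have hl : (hd la == m) || (hd la == m.+1).
  by apply: contraR h1; rewrite negb_or => /andP[h3 h4]; rewrite mfac0.
case: la ls h1 h2 sz h hl => [|b la] ls h1 h2 sz h /= hl; first by exfalso; lia.
split; first by rewrite sz.
by case=> [|i] /=; [lia|exact: h].
Qed.

Lemma ntr_supp (be hf : R) ka nu : strict_seq ka -> strict_seq nu -> ntr be hf ka nu != 0 ->
  size nu = size ka /\ forall i, (nth 0 ka i <= nth 0 nu i)%N.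
Proof.
elim: ka nu => [|m mu IH] la ms ls /=.
  case: (la =P [::]) => [->|_]; last by rewrite eqxx.
  by move=> _; split=> // i; rewrite nth_nil.
move: ms; rewrite strict_cons => /andP[hm ms]; rewrite mulf_eq0 negb_or => /andP[h1 h2].
have [sz h] := IH _ ms (strict_behead ls) h2.
have hl : (m <= hd la)%N.
  by apply: contraR h1; rewrite -ltnNge => h3; rewrite nfac_lt.
case: la ls h1 h2 sz h hl => [|b la] ls h1 h2 sz h /= hl; first by exfalso; lia.
by split; [rewrite sz|case].
Qed.

Lemma SDskew_shift b l m mu i j : strict_seq (b :: l) -> strict_seq (m :: mu) ->
  ((i.+1, j.+1) \in SDskew (mkp (b :: l)) (mkp (m :: mu))) =
  if i == 0%N then (m <= j < b)%N else (i, j) \in SDskew (mkp l) (mkp mu).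
Proof.
move=> bs ms; rewrite !in_SDskew !SD_shift //; case: (i == 0%N) => //.
by rewrite -leqNgt andbC.
Qed.

Lemma SDskew_row0 la mu i : ((i, 0%N) \in SDskew la mu) = false.
Proof. by rewrite in_SDskew SD_row0. Qed.

Lemma SDskew_col0 la mu j : ((0%N, j) \in SDskew la mu) = false.
Proof. by rewrite in_SDskew SD_col0. Qed.

(** The box added to the first row opens a new column unless the second row also grows right below
    it; this is the sign condition in [mfac]. *)
Lemma cols_cons b l m mu : strict_seq (b :: l) -> strict_seq (m :: mu) ->
  (m <= b <= m.+1)%N -> (hd l <= (hd mu).+1)%N ->
  cols (mkp (b :: l)) (mkp (m :: mu)) =
  (cols (mkp l) (mkp mu) + ((b == m.+1) && ~~ ((m == (hd mu).+1) && (hd l == m))))%N.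
Proof.
move=> bs ms mb h2; have := bs; rewrite strict_cons => /andP[hb ls].
have := ms; rewrite strict_cons => /andP[hm mus].
pose C := [fset p.2 | p in SDskew (mkp l) (mkp mu)].
have CE : [fset p.2 | p in SDskew (mkp (b :: l)) (mkp (m :: mu))] =
    (if b == m.+1 then [fset m.+1] else fset0) `|` [fset j.+1 | j in C].
  apply/fsetP => j; apply/imfsetP/idP => /=.
    case=> -[i k] /= + ->; case: i k => [|i] [|k]; rewrite ?SDskew_row0 ?SDskew_col0 //.
    rewrite SDskew_shift // in_fsetU; case: eqP => [_ km|_ ik].
      have -> : b == m.+1 by lia.
      by rewrite in_fset1 (_ : k = m) ?eqxx //; lia.
    by apply/orP; right; apply/imfsetP; exists k => //=; apply/imfsetP; exists (i, k).
  rewrite in_fsetU => /orP[|/imfsetP[k /= /imfsetP[[i k'] /= ik ->] ->]].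
    case: eqP => // bm; rewrite in_fset1 => /eqP ->.
    by exists (1%N, m.+1) => //=; rewrite SDskew_shift //=; lia.
  exists (i.+1, k'.+1) => //=; rewrite SDskew_shift //; case: eqP ik => [->|//].
  by rewrite SDskew_col0.
have cC : #|` [fset j.+1 | j in C]| = #|` C| by apply: card_imfset => ? ? [].
have mC : b = m.+1 -> (m.+1 \in [fset j.+1 | j in C]) = (m == (hd mu).+1) && (hd l == m).
  move=> bm; rewrite (mem_imfset _ _ succn_inj) /=; apply/imfsetP/andP => /=.
    case=> -[i k] /= + km; rewrite -{}km => ik.
    have ik' : (i, m) \in SD (mkp l) by move: ik; rewrite in_SDskew => /andP[].
    have i0 : (0 < i)%N by move: ik'; rewrite in_SD /=; lia.
    have := SD_up (ltn0Sn 0) i0 ik'; rewrite in_SD /part mkpK //= nth0.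
    by rewrite !eqn_leq => h; split; apply/andP; split; lia.
  case=> /eqP m1 /eqP l1; exists (1%N, m) => //=.
  by rewrite in_SDskew !in_SD /part !mkpK //= !nth0; lia.
rewrite {1}/cols CE; case: eqP => [bm|_] /=; last by rewrite fset0U cC addn0.
by rewrite cardfsU1 mC // cC addnC.
Qed.

(** The correction counts the boxes of the second row under added boxes of the first; it is the
    exponent of [2] in [nfac]. *)
Lemma overlap_cons n nu k ka : strict_seq (n :: nu) -> strict_seq (k :: ka) ->
  (hd ka <= hd nu)%N ->
  overlap (mkp (n :: nu)) (mkp (k :: ka)) =
  (overlap (mkp nu) (mkp ka) + ((hd nu).+1 - k))%N.
Proof.
move=> ns ks h2; have := ns; rewrite strict_cons => /andP[hn nus].
have := ks; rewrite strict_cons => /andP[hk kas].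
pose O := [fset p in SDskew (mkp nu) (mkp ka) | (p.1.-1, p.2) \in SDskew (mkp nu) (mkp ka)].
have inO l s p : (p \in [fset p in SDskew l s | (p.1.-1, p.2) \in SDskew l s]) =
    (p \in SDskew l s) && ((p.1.-1, p.2) \in SDskew l s) by rewrite !inE.
pose D := [fset (2%N, j.+1) | j in iota k ((hd nu).+1 - k)].
have E : [fset p in SDskew (mkp (n :: nu)) (mkp (k :: ka))
     | (p.1.-1, p.2) \in SDskew (mkp (n :: nu)) (mkp (k :: ka))] =
   [fset bshift p | p in O] `|` D.
  apply/fsetP => -[i j]; rewrite inO in_fsetU.
  case: i j => [|i] [|j]; rewrite ?SDskew_row0 ?SDskew_col0 /=.
  - by apply/esym/negbTE; rewrite negb_or; apply/andP; split; apply/negP => /imfsetP[p _ []].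
  - by apply/esym/negbTE; rewrite negb_or; apply/andP; split; apply/negP => /imfsetP[p _ []].
  - by apply/esym/negbTE; rewrite negb_or; apply/andP; split; apply/negP => /imfsetP[p _ []].
  have -> : ((i.+1, j.+1) \in [fset bshift p | p in O]) = ((i, j) \in O).
    by rewrite -[(i.+1, j.+1)]/(bshift (i, j)) mem_imfset //; exact: bshift_inj.
  have -> : ((i.+1, j.+1) \in D) = (i == 1%N) && (k <= j < k + ((hd nu).+1 - k))%N.
    rewrite -mem_iota; apply/imfsetP/andP => /= [[j' jj [-> ->]]|[/eqP-> jj]]; first by split.
    by exists j.
  rewrite inO SDskew_shift //=; case: i => [|i].
    by rewrite !SDskew_col0 /= andbF.
  rewrite SDskew_shift //=; case: i => [|i] /=; last by rewrite orbF.
  rewrite SDskew_col0 andbF /= in_SDskew !in_SD /part !mkpK //= !nth0; lia.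
have dis : [fset bshift p | p in O] `&` D = fset0.
  apply/fsetP => p; rewrite in_fsetI inE; apply/negbTE/negP => /andP[/imfsetP[[i j] /= ij ->]].
  case/imfsetP => j' _ [i1 _]; move: ij; rewrite inO /= i1.
  by rewrite /= SDskew_col0 andbF.
have c1 : #|` [fset bshift p | p in O]| = #|` O| by apply: card_imfset; exact: bshift_inj.
have c2 : #|` D| = ((hd nu).+1 - k)%N.
  by rewrite card_imfset /= ?undup_id ?iota_uniq ?size_iota // => ? ? [].
by rewrite {1}/overlap E cardfsU dis cardfs0 subn0 c1 c2.
Qed.

Definition hf : R := (2^-1)%:P.
Lemma hf2 : 2 * hf = 1.
Proof.
have -> : (2 : R) = (2%:R)%:P by rewrite polyCMn polyC1.
by rewrite /hf -polyCM divff // polyC1.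
Qed.

Lemma subp_mkp l s : strict_seq l -> strict_seq s ->
  (forall i, nth 0 s i <= nth 0 l i)%N -> subp (mkp s) (mkp l).
Proof. by move=> ls ss h [|i] // _; rewrite /part !mkpK. Qed.

Lemma skew_sizeE l s : strict_seq l -> strict_seq s ->
  (forall i, nth 0 s i <= nth 0 l i)%N -> skew_size (mkp l) (mkp s) = (sumn l - sumn s)%N.
Proof.
by move=> ls ss h; rewrite /skew_size card_SDskew ?/psize ?mkpK //; exact: subp_mkp.
Qed.

(** A growing row gives [be = 2 * (-1) * (- be / 2)] if its box opens a column and
    [- be = 2 * (- be / 2)] if it continues one. *)
Lemma mtrE mu la : strict_seq mu -> strict_seq la -> size la = size mu ->
  (forall i, (nth 0 mu i <= nth 0 la i <= (nth 0 mu i).+1)%N) ->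
  mtr bR mu la = 2 ^+ size la * (-1) ^+ cols (mkp la) (mkp mu) *
    (- (hf * bR)) ^+ skew_size (mkp la) (mkp mu).
Proof.
move=> ms ls sz h; rewrite skew_sizeE => //; last by move=> i; case/andP: (h i).
elim: mu la ms ls sz h => [|m mu IH] la ms ls sz h.
  case: la ls sz {h} => //= _ _; rewrite (_ : cols _ _ = 0%N) ?subnn ?expr0 ?mulr1 //.
  by rewrite /cols /SDskew fsetDv imfset0 cardfs0.
case: la ls sz h => // b la ls [sz] h.
have ms' := ms; have ls' := ls; move: ms' ls'; rewrite !strict_cons => /andP[hm ms'] /andP[hb ls'].
have h' i : (nth 0 mu i <= nth 0 la i <= (nth 0 mu i).+1)%N := h i.+1.
have h0 : (m <= b <= m.+1)%N := h 0%N.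
have h1 : (hd mu <= hd la <= (hd mu).+1)%N by have := h' 0%N; rewrite !nth0.
have [hs _] := sumn_nth_le ms' ls' (fun i => proj1 (andP (h' i))).
rewrite cols_cons //; last by case/andP: h1.
rewrite [LHS]/= IH // [size _]/= exprS exprD [sumn (_ :: _)]/= [sumn (_ :: _)]/=.
have -> : (b + sumn la - (m + sumn mu) = (b - m) + (sumn la - sumn mu))%N by lia.
rewrite exprD; set X := (2 ^+ _); set Y := ((-1) ^+ _); set Z := ((- _) ^+ (_ - sumn mu)).
have [bm|bm] : b = m \/ b = m.+1 by lia.
  rewrite bm mfac_id subnn (_ : (m == m.+1) = false) ?expr0 /=; first by ring.
  by lia.
rewrite bm mfac_succ eqxx subSnn /= expr1; case: ifP => _ /=; rewrite ?expr0 ?expr1.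
  by apply: (lin (k := - bR * X * Y * Z) _ (esym hf2)); ring.
by apply: (lin (k := bR * X * Y * Z) _ (esym hf2)); ring.
Qed.

Lemma ntrE ka nu : strict_seq ka -> strict_seq nu -> size nu = size ka ->
  (forall i, (nth 0 ka i <= nth 0 nu i)%N) ->
  ntr bR hf ka nu = hf ^+ size ka * 2 ^+ overlap (mkp nu) (mkp ka) *
    (- (hf * bR)) ^+ skew_size (mkp nu) (mkp ka).
Proof.
move=> ks ns sz h; rewrite skew_sizeE //.
elim: ka nu ks ns sz h => [|k ka IH] nu ks ns sz h.
  case: nu ns sz {h} => //= _ _; rewrite (_ : overlap _ _ = 0%N) ?subnn ?expr0 ?mulr1 //.
  rewrite /overlap /SDskew fsetDv; apply/eqP; rewrite cardfs_eq0; apply/eqP/fsetP => p.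
  by rewrite !inE.
case: nu ns sz h => // n nu ns [sz] h.
have ks' := ks; have ns' := ns; move: ks' ns'; rewrite !strict_cons => /andP[hk ks'] /andP[hn ns'].
have h' i : (nth 0 ka i <= nth 0 nu i)%N := h i.+1.
have h0 : (k <= n)%N := h 0%N.
have h1 : (hd ka <= hd nu)%N by have := h' 0%N; rewrite !nth0.
have [hs _] := sumn_nth_le ks' ns' h'.
rewrite overlap_cons // [LHS]/= IH // /nfac h0 [size _]/= exprS exprD.
rewrite [sumn (_ :: _)]/= [sumn (_ :: _)]/=.
have -> : (n + sumn nu - (k + sumn ka) = (n - k) + (sumn nu - sumn ka))%N by lia.
rewrite exprD; move: (hf ^+ _) (2 ^+ _) (2 ^+ _) ((- _) ^+ _) ((- _) ^+ _) => X1 X2 X3 X4 X5.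
by move: hf => h2; ring.
Qed.

(** * The Cauchy sums at a fixed monomial and the final comparison *)

Lemma fsum_sp (V : nmodType) N (F : strictp -> V) :
  (forall la : strictp, (N < hd la)%N -> F la = 0) ->
  \sum_(la \in [set: strictp]%classic) F la = \sum_(l <- sp N) F (mkp l).
Proof.
move=> F0; rewrite (@fsbigE _ _ _ _ _ (spS N)) ?uniq_spS //; last first.
  by move=> la _; rewrite mem_spS -ltnNge; exact: F0.
rewrite -big_spS; apply: eq_bigl => la.
by rewrite in_setT.
Qed.

Definition monxy (a e : {cmonom nat}) : {cmonom (nat + nat)%type} :=
  [cmonom (match s with inl i => a i | inr j => e j end) | s in
    [fset (inl i : (nat + nat)%type) | i in finsupp a] `|`
    [fset (inr j : (nat + nat)%type) | j in finsupp e]]%M.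
Lemma xpart_monxy a e : xpart (monxy a e) = a.
Proof.
apply/eqP/cmP => i; rewrite xpartE cmE fsfun_fun in_fsetU.
rewrite mem_imfset /=; last by move=> ? ? [].
case: (boolP (i \in finsupp a)) => //=; rewrite -cmE_eq0 => /eqP a0.
by case: ifP.
Qed.
Lemma ypart_monxy a e : ypart (monxy a e) = e.
Proof.
apply/eqP/cmP => i; rewrite ypartE cmE fsfun_fun in_fsetU orbC.
rewrite mem_imfset /=; last by move=> ? ? [].
case: (boolP (i \in finsupp e)) => //=; rewrite -cmE_eq0 => /eqP a0.
by case: ifP.
Qed.

(** Both double sums are coefficientwise limits of the same partial products. *)
Lemma cauchy_eq G G' g g' : cauchy_dual G g -> cauchy_dual G' g' -> forall a e,
  \sum_(la \in [set: strictp]%classic) G la a * g la e =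
  \sum_(la \in [set: strictp]%classic) G' la a * g' la e.
Proof.
move=> h1 h2 a e; have [N1 H1] := h1 (monxy a e); have [N2 H2] := h2 (monxy a e).
have := H1 _ (leq_maxl N1 N2); rewrite (H2 _ (leq_maxr N1 N2)) /=.
by rewrite xpart_monxy ypart_monxy.
Qed.

Lemma GX_deg P (la : strictp) m : (mdeg m < hd la)%N -> GX P la m = 0.
Proof.
move=> lt; apply: qmap_inj; rewrite rmorph0.
have := @Gq_deg P la m (partsP la) (leq_trans lt (hd_le_sumn la)).
by rewrite /Gq partsK.
Qed.

Definition bbof (c : strictp -> strictp -> strictp -> int) (mu nu la : seq nat) : R :=
  qmap (c (mkp mu) (mkp nu) (mkp la) *:
    beta ^+ (psize (mkp la) - psize (mkp mu) - psize (mkp nu))).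
Lemma struct_bb P c : structure_constants (GX P) c ->
  forall mu nu, strict_seq mu -> strict_seq nu -> GS P mu * GS P nu = FS P (bbof c mu nu).
Proof.
move=> h mu nu ms ns; apply: seriesP => m.
transitivity (qmap ((GX P (mkp mu) * GX P (mkp nu)) m)).
  by rewrite !scoefM rmorph_sum; apply: eq_bigr => p _; rewrite rmorphM.
rewrite h [X in qmap X]/= (@fsum_sp _ (mdeg m)); last first.
  by move=> la lt; rewrite GX_deg ?mulr0.
by rewrite rmorph_sum; apply: eq_bigr => l _; rewrite rmorphM.
Qed.

Lemma skew_coef P c g (la mu : strictp) e : structure_constants (GX P) c ->
  toQ (skew_dual c g la mu) e =
  \sum_(l <- sp (sumn la)) bbof c mu l la * qmap (g (mkp l) e).
Proof.
move=> h; rewrite -[LHS]/(qmap (skew_dual c g la mu e)) [skew_dual _ _ _ _ _]/=.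
rewrite (@fsum_sp _ (sumn la)).
  rewrite rmorph_sum; apply: eq_bigr => l _; rewrite rmorphM; congr (_ * _).
  by rewrite /bbof !partsK.
move=> nu lt; suff -> : c mu nu la *: beta ^+ (psize la - psize mu - psize nu) = 0.
  by rewrite mul0r.
apply: qmap_inj; rewrite rmorph0.
have := bb_size (struct_bb h) (partsP mu) (partsP nu) (partsP la).
rewrite /bbof !partsK; apply; have := hd_le_sumn nu; lia.
Qed.

Lemma mtr_hd0 be mu la : strict_seq mu -> strict_seq la -> (hd la < hd mu)%N ->
  mtr (be : R) mu la = 0.
Proof.
move=> ms ls lt; have [//|/(mtr_supp ms ls)[_ /(_ 0%N)]] := eqVneq (mtr be mu la) 0.
by rewrite !nth0; lia.
Qed.

Lemma FS_QP c : FS false c = FS true (fun l => \sum_(mu <- sp (sumn l)) c mu * mtr bR mu l).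
Proof.
apply: seriesP => m /=.
transitivity (\sum_(mu <- sp (mdeg m)) \sum_(l <- sp (mdeg m).+1)
   c mu * mtr bR mu l * Gq true l m).
  apply: eq_big_seq => mu; rewrite mem_sp => /andP[ms mm].
  rewrite (@GQ_GP mu m (mdeg m).+1) // mulr_sumr.
  by apply: eq_bigr => l _; rewrite mulrA.
rewrite exchange_big -(@Gq_widen true (mdeg m).+1 m) //.
apply: eq_big_seq => l; rewrite mem_sp => /andP[ls _]; rewrite -mulr_suml.
have [lt|le] := ltnP (mdeg m) (sumn l); first by rewrite Gq_deg // !mulr0.
congr (_ * _); apply: sp_widen => // mu ms lt; rewrite mtr_hd0 ?mulr0 //.
exact: leq_ltn_trans (hd_le_sumn l) lt.
Qed.

(** [gpe] and [gqe] stand for the dual functions read at one monomial in [y]; the hypothesis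
    [FS false gpe = FS true gqe] says that both Cauchy sums give the same series [K]. *)
Lemma dual_main aa bb gpe gqe ka la :
  (forall mu nu, strict_seq mu -> strict_seq nu -> GS true mu * GS true nu = FS true (aa mu nu)) ->
  (forall mu nu, strict_seq mu -> strict_seq nu -> GS false mu * GS false nu = FS false (bb mu nu)) ->
  FS false gpe = FS true gqe -> strict_seq ka -> strict_seq la -> (sumn ka <= sumn la)%N ->
  \sum_(l <- sp (sumn la)) aa ka l la * gqe l =
  \sum_(nu <- sp (sumn la)) \sum_(mu <- sp (sumn la)) ntr bR hf ka nu * mtr bR mu la *
    \sum_(l <- sp (sumn mu)) bb nu l mu * gpe l.
Proof.
move=> Ha Hb HK ks ls kl.
pose gqsk k l := \sum_(u <- sp (sumn l)) gqe u * aa u k l.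
pose gpsk k l := \sum_(u <- sp (sumn l)) gpe u * bb u k l.
have aC k u l : strict_seq k -> strict_seq u -> strict_seq l -> aa k u l = aa u k l.
  by move=> sk su sl; apply: (@FS_inj true (aa k u) (aa u k)) => //; rewrite -!Ha // mulrC.
have bC k u l : strict_seq k -> strict_seq u -> strict_seq l -> bb k u l = bb u k l.
  by move=> sk su sl; apply: (@FS_inj false (bb k u) (bb u k)) => //; rewrite -!Hb // mulrC.
have -> : \sum_(l <- sp (sumn la)) aa ka l la * gqe l = gqsk ka la.
  by apply: eq_big_seq => l; rewrite mem_sp => /andP[sl _]; rewrite aC // mulrC.
(* One more than [|la|], since [M] may lengthen the first row by a box. *)
pose N := (sumn la).+1.
have key nu l : strict_seq nu -> strict_seq l -> (hd nu < N)%N ->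
    \sum_(k <- sp N) mtr bR nu k * gqsk k l = \sum_(mu <- sp (sumn l)) gpsk nu mu * mtr bR mu l.
  move=> ns sl nN.
  pose c1 l := \sum_(k <- sp N) mtr bR nu k * gqsk k l.
  pose c2 l := \sum_(mu <- sp (sumn l)) gpsk nu mu * mtr bR mu l.
  apply: (@FS_inj true c1 c2) => //; rewrite /c2 -FS_QP /gpsk -(lin_mul Hb) // HK.
  have -> : GS false nu = \sum_(k <- sp N) mtr bR nu k *: GS true k.
    apply: seriesP => m; rewrite scoef_sum /= (@GQ_GP nu m N) //.
  rewrite mulr_sumr; apply: seriesP => m; rewrite scoef_sum.
  transitivity (\sum_(k <- sp N) mtr bR nu k * FS true (gqsk k) m); last first.
    apply: eq_big_seq => k; rewrite mem_sp => /andP[sk _].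
    by rewrite -scalerAr scoefZ (lin_mul Ha).
  rewrite /c1 /=; under eq_bigr do rewrite mulr_suml.
  rewrite exchange_big; apply: eq_bigr => k _; rewrite mulr_sumr.
  by apply: eq_bigr => u _; rewrite mulrA.
transitivity (\sum_(nu <- sp (sumn la)) ntr bR hf ka nu *
   \sum_(k <- sp N) mtr bR nu k * gqsk k la).
  under eq_bigr do rewrite mulr_sumr.
  rewrite exchange_big (sp_sum1 (l0 := ka)).
  - under eq_bigr do rewrite mulrA.
    rewrite -mulr_suml ntr_mtr ?eqxx ?mul1r //; first exact: hf2.
    exact: leq_trans (hd_le_sumn ka) kl.
  - by rewrite mem_sp ks /N ltnW // ltnS (leq_trans (hd_le_sumn ka) kl).
  move=> k; rewrite mem_sp => /andP[sk _] kn; under eq_bigr do rewrite mulrA.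
  (* The inversion needs the first part of [k] to be at most [|la|]; when [|k|] exceeds [|la|], the
     skew coefficient vanishes by degree instead. *)
  rewrite -mulr_suml; have [lt|le] := ltnP (sumn la) (sumn k).
    have -> : gqsk k la = 0; last by rewrite mulr0.
    rewrite /gqsk big_seq big1 // => u; rewrite mem_sp => /andP[su _].
    by rewrite (bb_size Ha) ?mulr0 //; lia.
  rewrite ntr_mtr //; [|exact: hf2|exact: leq_trans (hd_le_sumn k) le].
  by rewrite eq_sym (negbTE kn) mul0r.
apply: eq_big_seq => nu; rewrite mem_sp => /andP[ns nl]; rewrite key //.
rewrite mulr_sumr; apply: eq_big_seq => mu; rewrite mem_sp => /andP[sm _].
have -> : gpsk nu mu = \sum_(l <- sp (sumn mu)) bb nu l mu * gpe l.
  by apply: eq_big_seq => l; rewrite mem_sp => /andP[sl _]; rewrite bC // mulrC.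
by rewrite -!mulrA; congr (_ * _); rewrite mulrC.
Qed.

Lemma vertical_stripP (la mu : strictp) : subp mu la ->
  vertical_strip (SDskew la mu) <-> forall i, (nth 0 la i <= (nth 0 mu i).+1)%N.
Proof.
move=> sub; rewrite -rowfreeP //; split=> h.
  by move=> i j j' p q; have [] := h _ _ p q erefl.
by case=> [i j] [i' j'] p q /= e; rewrite -e in q *; rewrite (h i j j').
Qed.

Local Open Scope classical_set_scope.
Local Open Scope ring_scope.

Theorem theorem6p8
    (gp gq : strictp -> series nat {poly int})
    (a b : strictp -> strictp -> strictp -> int)
    (gp_dual : cauchy_dual GQ gp) (gq_dual : cauchy_dual GP gq)
    (aP : structure_constants GP a) (bP : structure_constants GQ b)
    (lambda kappa : strictp) (sub_kl : subp kappa lambda) :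
  toQ (skew_dual a gq lambda kappa) =
  \sum_(p \in [set p : strictp * strictp | let: (nu, mu) := p in
      [/\ subp kappa nu, subp nu mu & subp mu lambda] /\
      [/\ plen kappa = plen nu, (plen nu <= plen mu)%N,
          plen mu = plen lambda & vertical_strip (SDskew lambda mu)]])
    let: (nu, mu) := p in
    (2 ^+ (plen lambda - plen kappa + overlap nu kappa)
     * (-1) ^+ cols lambda mu
     * (- (2^-1 *: 'X)) ^+ (skew_size nu kappa + skew_size lambda mu))
    *: toQ (skew_dual b gp mu nu).
Proof.
have Ha := @struct_bb true a aP; have Hb := @struct_bb false b bP.
apply: seriesP => e; rewrite (@skew_coef true a gq lambda kappa e aP).
pose gpe l := qmap (gp (mkp l) e); pose gqe l := qmap (gq (mkp l) e).
have HK : FS false gpe = FS true gqe.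
  apply: seriesP => m /=; have := cauchy_eq gp_dual gq_dual m e.
  rewrite (@fsum_sp _ (mdeg m)); last first.
    by move=> la lt; rewrite (@GX_deg false la m lt : GQ la m = 0) mul0r.
  rewrite (@fsum_sp _ (mdeg m)); last first.
    by move=> la lt; rewrite (@GX_deg true la m lt : GP la m = 0) mul0r.
  move/(congr1 qmap); rewrite !rmorph_sum => E.
  under eq_bigr do rewrite mulrC.
  under [RHS]eq_bigr do rewrite mulrC.
  rewrite (eq_bigr (fun l => qmap (GQ (mkp l) m * gp (mkp l) e))) => [|l _]; last first.
    by rewrite rmorphM.
  by rewrite E; apply: eq_bigr => l _; rewrite rmorphM.
have kl : (sumn kappa <= sumn lambda)%N by have := subp_psize sub_kl.
rewrite (dual_main Ha Hb HK (partsP kappa) (partsP lambda) kl).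
set A := (X in \sum_(p \in X) _).
pose r := [seq p <- [seq (nu, mu) | nu <- spS (sumn lambda), mu <- spS (sumn lambda)] | p \in A].
rewrite (@fsbigE _ _ _ _ A r).
- rewrite scoef_sum /r big_filter_cond [RHS]big_mkcond [RHS]big_allpairs_dep [RHS]big_spS.
  apply: eq_big_seq => nu; rewrite mem_sp => /andP[ns _]; rewrite [RHS]big_spS.
  apply: eq_big_seq => mu; rewrite mem_sp => /andP[ms _]; rewrite andbb.
  case: ifPn => [/set_mem[[s1 s2 s3] [e1 e2 e3 vs]]|nA]; last first.
    (* A pair outside the index set contributes zero: if all three factors were nonzero, their
       supports would put the pair into the set. *)
    set Z := \sum_(l <- sp (sumn mu)) _.
    have [->|n1] := eqVneq (ntr bR hf kappa nu) 0; first by rewrite !mul0r.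
    have [->|n2] := eqVneq (mtr bR mu lambda) 0; first by rewrite mulr0 mul0r.
    have [->|n3] := eqVneq Z 0; first by rewrite mulr0.
    exfalso; move/negP: nA; apply; apply/mem_set.
    have [sz1 h1] := ntr_supp (partsP kappa) ns n1.
    have [sz2 h2] := mtr_supp ms (partsP lambda) n2.
    have h3 i : (nth 0 nu i <= nth 0 mu i)%N.
      rewrite leqNgt; apply: contra n3 => lt; rewrite /Z big_seq big1 // => l.
      rewrite mem_sp => /andP[sl _]; rewrite (bb_contain Hb (k := i)) ?mul0r //.
    have s3 : subp (mkp mu) lambda.
      by case=> // i _; rewrite /part mkpK //=; case/andP: (h2 i).
    split; split=> //.
    + by case=> // i _; rewrite /part mkpK.
    + exact: subp_mkp.
    + by rewrite /plen mkpK.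
    + rewrite /plen !mkpK // leqNgt; apply/negP => lt.
      have := h3 (size mu); rewrite [nth _ mu _]nth_default // leqn0 => /eqP z.
      move: ns; rewrite /strict_seq => /andP[_ /negP]; apply.
      by rewrite -z mem_nth.
    + by rewrite /plen mkpK.
    + by apply/(vertical_stripP s3) => i; rewrite mkpK //; case/andP: (h2 i).
  cbv beta iota; rewrite scoefZ (@skew_coef false b gp (mkp mu) (mkp nu) e bP).
  have t1 i : (nth 0 kappa i <= nth 0 nu i)%N by have := s1 i.+1 isT; rewrite /part mkpK.
  have t3 i : (nth 0 mu i <= nth 0 lambda i <= (nth 0 mu i).+1)%N.
    have := s3 i.+1 isT; rewrite /part mkpK //= => ->.
    by have := (vertical_stripP s3).1 vs i; rewrite mkpK.
  move: e1 e2 e3; rewrite /plen !mkpK // => e1 e2 e3.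
  rewrite ntrE ?partsP // mtrE ?partsP // !partsK.
  congr (_ * _).
  rewrite -mul_polyC -/hf -/bR !exprD.
  (* Of the factors [2] in [M], one for each row of [lambda], as many as [kappa] has rows cancel
     against the factors [hf] in [N]. *)
  have -> : 2 ^+ size lambda = 2 ^+ (size lambda - size kappa) * 2 ^+ size kappa :> R.
    by rewrite -exprD subnK // e1 -e3.
  have E : 2 ^+ size kappa * hf ^+ size kappa = 1 by rewrite -exprMn hf2 expr1n.
  set X := (2 ^+ (size lambda - _)); set Y := (2 ^+ size kappa) in E *.
  set W := (hf ^+ _) in E *; set U := (2 ^+ overlap _ _); set V := ((-1) ^+ _).
  set S1 := ((- _) ^+ skew_size (mkp nu) _); set S2 := ((- _) ^+ skew_size lambda _).
  by apply: (lin (k := X * U * V * S1 * S2) _ E); ring.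
- by rewrite filter_uniq // allpairs_uniq ?uniq_spS // => -[? ?] [? ?] _ _ [-> ->].
- by move=> p /=; rewrite mem_filter => /andP[/set_mem].
move=> [nu mu] [[s1 s2 s3] cnd]; rewrite mem_filter negb_and => /orP[/negP|].
  case; apply/mem_set; split=> //.
move/negP; case; apply/allpairsPdep; exists nu, mu; rewrite !mem_spS !hd_part.
have := hd_le_sumn lambda; rewrite hd_part => h; split=> //.
  by have := s2 1%N isT; have := s3 1%N isT; lia.
by have := s3 1%N isT; lia.
Qed.
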